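(* Consider the Gaussian mean return model. Let $i,j\in\{1,2\}$, $i\ne j$, fix the policy $\Pi_j$ of Agent $j$, with mean $\mu_j(t)$, and let $\Pi_i^0$ be the initial policy of Agent $i$ whose quantile function at time $t$ and state $Y(t)=y$ is, for $p\in(0,1)$, $$Q_{\Pi_i^0(t)}(p)=\frac{y}{\gamma_i\sigma}+k_i\mu_j(t)-\frac{\rho v}{\sigma}\big(a_2^{i0}(t)y+a_1^{i0}(t)\big)+\theta^0h_i'(1-p),$$ where $a_1^{i0},a_2^{i0}$ are given continuous functions on $[0,T]$ and $\theta^0\geq 0$ is a constant. For $n=0,1,2,\dots$ choose one policy $$\pi_i\in\operatorname*{arg\,max}_{\pi_i\in\mathcal M}\Big\{\mathcal L^{\pi_i,\Pi_j}V_i^{\Pi_i^n}-\frac{\gamma_i}{2}\mathcal L^{\pi_i,\Pi_j}\big(g_i^{\Pi_i^n}\big)^2+\gamma_ig_i^{\Pi_i^n}\mathcal L^{\pi_i,\Pi_j}g_i^{\Pi_i^n}+\lambda_i(t)\Phi_{h_i}(\pi_i)\Big\}$$ (pointwise in $(t,\hat x_i,y)$) and denote this policy by $\Pi_i^{n+1}$. Then: (i) For every $n\ge1$ the updated policy $\Pi_i^n$ has quantile function $$Q_{\Pi_i^n(t)}(p)=\frac{y}{\gamma_i\sigma}+k_i\mu_j(t)-\frac{\rho v}{\sigma}\big(a_2^{in}(t)y+a_1^{in}(t)\big)+\frac{\lambda_i(t)}{\gamma_i\sigma^2}h_i'(1-p),$$ where $a_1^{in},a_2^{in}$ satisfy $$(a_2^{in})'(t)=2\iota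 a_2^{in}(t)+2\rho v\,a_2^{i(n-1)}(t)-\frac{2}{\gamma_i},\quad a_2^{in}(T)=0,$$ $$(a_1^{in})'(t)=\iota a_1^{in}(t)+\rho v\,a_1^{i(n-1)}(t)-\iota\bar Y a_2^{in}(t),\quad a_1^{in}(T)=0.$$ (ii) As $n\to\infty$, $a_1^{in}$ and $a_2^{in}$ converge uniformly on $[0,T]$ to, respectively, $$a_1^i(t)=\frac{\iota\bar Y}{\gamma_i(\iota+\rho v)^2}\big[1-e^{-(\iota+\rho v)(T-t)}\big]^2\quad\text{and}\quad a_2^i(t)=\frac{1}{\gamma_i(\iota+\rho v)}\big[1-e^{-2(\iota+\rho v)(T-t)}\big].$$
   Context: Distributions. $\mathcal M$ is the set of Borel probability measures on $\mathbb R$, identified with distribution functions $\Pi(x)=\Pi((-\infty,x])$; the maximization is over those with finite second moment, for which all expressions are defined. $Q_\Pi(p)=\inf\{x:\Pi(x)\ge p\}$ is the quantile function. For concave $h:[0,1]\to\mathbb R$ of bounded variation with $h(0)=h(1)=0$, the Choquet regularizer is $\Phi_h(\Pi)=\int_{\mathbb R}h(\Pi([x,\infty)))dx$. $h'$ is the (a.e.) derivative and $\|h'\|_2$ its $L^2(0,1)$ norm. Gaussian mean return model. Fix $T>0$, $\rho\in[0,1]$, positive constants $r,\sigma,\iota,v,\bar Y$ ($\bar Y$ is written $Y$ in the paper), and independent Brownian motions $B,\widetilde B,\overline B_1,\overline B_2$. The risk-free rate is $r$, the stock satisfies $dS/S=(r+\sigma Y(t))dt+\sigma dB(t)$, and the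 state satisfies $dY(t)=\iota(\bar Y-Y(t))dt+v[\rho\,dB(t)+\sqrt{1-\rho^2}\,d\widetilde B(t)]$. For each agent $i$: $\gamma_i>0$, $k_i\in(0,1)$, $\lambda_i:[0,T]\to(0,\infty)$ continuous, and $h_i:[0,1]\to\mathbb R$ concave, of bounded variation, with $h_i(0)=h_i(1)=0$, continuous, not identically zero, with $\|h_i'\|_2<\infty$. For distributional controls $\Pi_i=(\Pi_i(t))$ with means $\mu_i(t)$ and variances $\sigma_i^2(t)$, the discounted exploratory wealth satisfies $dX_i^{\Pi_i}=\sigma Y(t)\mu_i(t)dt+\sigma[\mu_i(t)dB(t)+\sigma_i(t)d\overline B_i(t)]$, and $\hat X_i^{\Pi_i,\Pi_j}=X_i^{\Pi_i}-k_iX_j^{\Pi_j}$. Value functions. For given $\Pi_i$, with $\hat X_i^{\Pi_i,\Pi_j}(t)=\hat x_i$, $Y(t)=y$ (and $\mathbb E_t,\mathrm{Var}_t$ conditional on the state at $t$), $g_i^{\Pi_i}(t,\hat x_i,y)=\mathbb E_t[\hat X_i^{\Pi_i,\Pi_j}(T)]$ and $$V_i^{\Pi_i}(t,\hat x_i,y)=\mathbb E_t\Big[\int_t^T\lambda_i(s)\Phi_{h_i}(\Pi_i(s))ds+\hat X_i^{\Pi_i,\Pi_j}(T)\Big]-\frac{\gamma_i}2\mathrm{Var}_t[\hat X_i^{\Pi_i,\Pi_j}(T)].$$ They satisfy $\mathcal L^{\Pi_i,\Pi_j}V_i^{\Pi_i}-\frac{\gamma_i}2\mathcal L^{\Pi_i,\Pi_j}(g_i^{\Pi_i})^2+\gamma_ig_i^{\Pi_i}\mathcal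 L^{\Pi_i,\Pi_j}g_i^{\Pi_i}+\lambda_i\Phi_{h_i}(\Pi_i)=0$ and $\mathcal L^{\Pi_i,\Pi_j}g_i^{\Pi_i}=0$ with $V_i^{\Pi_i}(T,\hat x_i,y)=g_i^{\Pi_i}(T,\hat x_i,y)=\hat x_i$. They are of the form $V_i^{\Pi_i}=\hat x_i+D_i^{\Pi_i}(t,y)$, $g_i^{\Pi_i}=\hat x_i+d_i^{\Pi_i}(t,y)$ for the policies considered. Generator. For $\psi\in C^{1,2,2}([0,T]\times\mathbb R^2)$, with $\mu_i,\sigma_i^2$ and $\mu_j,\sigma_j^2$ the means and variances of $\Pi_i,\Pi_j$, $$\mathcal L^{\Pi_i,\Pi_j}\psi(t,x,y)=\psi_t+\sigma y(\mu_i-k_i\mu_j)\psi_x+\tfrac12\sigma^2\big((\mu_i-k_i\mu_j)^2+\sigma_i^2+k_i^2\sigma_j^2\big)\psi_{xx}+\iota(\bar Y-y)\psi_y+\tfrac12v^2\psi_{yy}+\rho v\sigma(\mu_i-k_i\mu_j)\psi_{xy}.$$ *)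

(* Defs.v *)
From HB Require Import structures.
From mathcomp Require Import all_boot all_order all_algebra.
From mathcomp Require Import all_classical all_reals all_analysis.

Set Implicit Arguments.
Unset Strict Implicit.
Unset Printing Implicit Defensive.

Import Order.TTheory GRing.Theory Num.Theory.
Import numFieldNormedType.Exports.

Local Open Scope classical_set_scope.
Local Open Scope ring_scope.

Section distributions.
Context {R : realType}.

Definition distr : Type := probability (measurableTypeR R) R.

Definition finite_second_moment (m : distr) : Prop :=
  (\int[m]_x (x ^+ 2)%:E < +oo)%E.

Definition mean (m : distr) : R := fine 'E_m[fun x : measurableTypeR R => x].

Definition var (m : distr) : R := fine 'V_m[fun x : measurableTypeR R => x].

Definition quantile (m : distr) (p : R) : R :=
  inf [set x : R | (p%:E <= m `]-oo, x]%classic)%E].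

Definition choquet (h : R -> R) (m : distr) : R :=
  (\int[lebesgue_measure]_x h (fine (m `[x, +oo[%classic)))%R.

(* Representative of the a.e. derivative h' of a concave function: the right
   derivative, which exists at every point of ]0, 1[.  Since quantile functions
   are left-continuous, an identity Q p = c + theta * h' (1 - p) can hold at
   every p in ]0, 1[ only for this right-continuous representative. *)
Definition rderiv (h : R -> R) (p : R) : R :=
  lim ((fun e => (h (p + e) - h p) / e) @ 0^'+).

End distributions.
Arguments distr : clear implicits.

(* rate is the interest rate r; wealth is discounted, so that it plays no role
   in the dynamics below. *)
Record market (R : realType) := Market {
  horizon : R;  (* T *)
  corr : R;     (* rho *)
  rate : R;     (* r *)
  vol : R;      (* sigma *)
  speed : R;    (* iota *)
  yvol : R;     (* v *)
  ybar : R;     (* long-run mean of Y *)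
  horizon_gt0 : 0 < horizon;
  corr_itv : 0 <= corr <= 1;
  rate_gt0 : 0 < rate;
  vol_gt0 : 0 < vol;
  speed_gt0 : 0 < speed;
  yvol_gt0 : 0 < yvol;
  ybar_gt0 : 0 < ybar
}.

Record agent (R : realType) (T : R) := Agent {
  gam : R;
  relw : R;     (* k: weight of the other agent's wealth *)
  lam : R -> R;
  reg : R -> R; (* h, only relevant on [0, 1] *)
  gam_gt0 : 0 < gam;
  relw_itv : 0 < relw < 1;
  lam_gt0 : forall t : R, t \in `[0, T] -> 0 < lam t;
  lam_cont : {within `[0, T], continuous lam};
  reg_concave : @convex_function R R^o `[0, 1] (fun p => - reg p);
  reg_bv : bounded_variation 0 1 reg;
  reg0 : reg 0 = 0;
  reg1 : reg 1 = 0;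
  reg_cont : {within `[0, 1], continuous reg};
  reg_neq0 : exists2 p : R, p \in `[0, 1] & reg p != 0;
  reg_L2 : (\int[lebesgue_measure]_(p in `]0%R, 1%R[)
              ((rderiv reg p) ^+ 2)%:E < +oo)%E
}.

Section stochastic.
Context {R : realType} {d : measure_display} {Omega : measurableType d}.
Context (P : probability Omega R) (T : R).

Definition filtration_upto (F : R -> set (set Omega)) : Prop :=
  (forall s : R, s \in `[0, T] ->
     sigma_algebra [set: Omega] (F s) /\ F s `<=` measurable) /\
  (forall s u : R, 0 <= s -> s <= u -> u <= T -> F s `<=` F u).

Definition measurable_wrt (G : set (set Omega)) (X : Omega -> R) : Prop :=
  forall U : set R, measurable U -> G (X @^-1` U).

(* A family of mutually independent standard Brownian motions on [0, T]
   relative to F: jointly over the family, increments after s are independent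
   of F s, and they are mutually independent Gaussians. *)
Definition independent_brownian (F : R -> set (set Omega)) (I : finType)
    (W : I -> R -> Omega -> R) : Prop :=
  [/\ forall i (s : R), s \in `[0, T] -> measurable_wrt (F s) (W i s),
      forall i, {ae P, forall w, W i 0 w = 0},
      forall i, {ae P, forall w, {within `[0, T], continuous (W i ^~ w)}} &
      forall (s u : R) (A : set Omega) (U : I -> set (measurableTypeR R)),
        0 <= s -> s < u -> u <= T -> F s A -> (forall i, measurable (U i)) ->
        P (A `&` \bigcap_(i in [set: I])
             [set w | U i (W i u w - W i s w)]) =
        (P A * \prod_(i : I) normal_prob 0 (Num.sqrt (u - s)) (U i))%E].

Context (F : R -> set (set Omega)).

Definition adapted_measurable (t s : R) (H : R -> Omega -> R) : Prop :=
  measurable_fun (`[t, s] `*` [set: Omega])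
    (fun z : measurableTypeR R * Omega => H z.1 z.2) /\
  forall u : R, u \in `[t, s] -> measurable_wrt (F u) (H u).

Record simple_process (t s : R) := SimpleProcess {
  sp_size : nat;
  sp_time : nat -> R;
  sp_val : nat -> Omega -> R;
  sp_time0 : sp_time 0%N = t;
  sp_time_last : sp_time sp_size = s;
  sp_time_mono : forall k, (k < sp_size)%N -> sp_time k <= sp_time k.+1;
  sp_val_adapted : forall k, (k < sp_size)%N ->
    measurable_wrt (F (sp_time k)) (sp_val k);
  sp_val_bounded : forall k, (k < sp_size)%N ->
    exists C : R, forall w, `|sp_val k w| <= C
}.

Definition simple_eval t s (H : simple_process t s) (u : R) (w : Omega) : R :=
  \sum_(k < sp_size H)
    sp_val H k w * \1_(`]sp_time H k, sp_time H k.+1]%classic) u.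

Definition simple_integral (W : R -> Omega -> R) t s
    (H : simple_process t s) (w : Omega) : R :=
  \sum_(k < sp_size H)
    sp_val H k w * (W (sp_time H k.+1) w - W (sp_time H k) w).

(* I is a version of the Ito integral of H against W over [t, s]: an L^2 limit
   of elementary integrals of simple processes converging to H in
   L^2([t, s] x Omega).  Versions agree almost surely. *)
Definition is_ito (W : R -> Omega -> R) (t s : R) (H : R -> Omega -> R)
    (I : Omega -> R) : Prop :=
  [/\ adapted_measurable t s H, measurable_fun [set: Omega] I &
   exists Hn : nat -> simple_process t s,
     ((fun n => \int[P]_w \int[lebesgue_measure]_(u in `[t, s])
         ((H u w - simple_eval (Hn n) u w) ^+ 2)%:E)%E @ \oo --> 0%E) /\
     ((fun n => \int[P]_w
         ((I w - simple_integral W (Hn n) w) ^+ 2)%:E)%E @ \oo --> 0%E)].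

Definition ito_integrable (W : R -> Omega -> R) t s H : Prop :=
  exists I, is_ito W t s H I.

(* Some version of the Ito integral (0 if H is not Ito integrable). *)
Definition ito (W : R -> Omega -> R) t s H : Omega -> R :=
  xget (fun=> 0) (is_ito W t s H).

End stochastic.

Definition noises (R : realType) (Omega : Type) (B Bt : R -> Omega -> R)
    (Bbar : 'I_2 -> R -> Omega -> R) (k : option (option 'I_2)) :
    R -> Omega -> R :=
  match k with
  | None => B
  | Some None => Bt
  | Some (Some i) => Bbar i
  end.

Section model.
Context {R : realType} {d : measure_display} {Omega : measurableType d}.
Context (P : probability Omega R) (M : market R).
Context (F : R -> set (set Omega)).
Context (B Bt : R -> Omega -> R).

(* Y is the state process started from y at time t.  Its noise coefficients are
   constant, so that the stochastic integral is an increment of B and Bt. *)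
Definition state_process (t y : R) (Y : R -> Omega -> R) : Prop :=
  [/\ adapted_measurable F t (horizon M) Y,
      {ae P, forall w, {within `[t, horizon M], continuous (Y ^~ w)}} &
      {ae P, forall w, forall s, s \in `[t, horizon M] ->
         Y s w = y
           + (\int[lebesgue_measure]_(u in `[t, s])
                (speed M * (ybar M - Y u w)))%R
           + yvol M * (corr M * (B s w - B t w)
                       + Num.sqrt (1 - corr M ^+ 2) * (Bt s w - Bt t w))}].

(* X is the discounted exploratory wealth started from x at time t, for the
   state Y, the mean mu and standard deviation sd of the control, and the
   idiosyncratic noise Bi. *)
Definition wealth_process (Bi : R -> Omega -> R) (t x : R)
    (Y mu sd X : R -> Omega -> R) : Prop :=
  [/\ adapted_measurable F t (horizon M) X,
      ito_integrable P F B t (horizon M) mu,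
      ito_integrable P F Bi t (horizon M) sd &
      forall s, s \in `[t, horizon M] -> {ae P, forall w,
        X s w = x
          + (\int[lebesgue_measure]_(u in `[t, s])
               (vol M * Y u w * mu u w))%R
          + vol M * (ito P F B t s mu w + ito P F Bi t s sd w)}].

(* V and g are the value functions of agent A (noise Bi) under the feedback
   policy Pi in (time, relative wealth, state), when the other agent
   (noise Bj) uses the feedback policy Pij in (time, state).  Conditioning on
   the state at t is starting the processes at t; Y t y is the state process
   started from y at time t.  Only the relative initial wealth xi - k xj
   enters V and g. *)
Definition value_functions (A : agent (horizon M))
    (Bi Bj : R -> Omega -> R) (Y : R -> R -> R -> Omega -> R)
    (Pij : R -> R -> distr R) (Pi : R -> R -> R -> distr R)
    (V g : R -> R -> R -> R) : Prop :=
  forall t xi xj y : R, t \in `[0, horizon M] ->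
  exists Xi Xj : R -> Omega -> R,
    let Xhat := fun s w => Xi s w - relw A * Xj s w in
    let pol := fun s w => Pi s (Xhat s w) (Y t y s w) in
    let polj := fun s w => Pij s (Y t y s w) in
    let reward := fun w =>
      (\int[lebesgue_measure]_(s in `[t, horizon M])
         (lam A s * choquet (reg A) (pol s w)))%R + Xhat (horizon M) w in
    [/\ wealth_process Bi t xi (Y t y) (fun s w => mean (pol s w))
          (fun s w => Num.sqrt (var (pol s w))) Xi,
        wealth_process Bj t xj (Y t y) (fun s w => mean (polj s w))
          (fun s w => Num.sqrt (var (polj s w))) Xj,
        Xhat (horizon M) \in Lfun P 2%:E /\ reward \in Lfun P 1%:E,
        g t (xi - relw A * xj) y = fine 'E_P[Xhat (horizon M)] &
        V t (xi - relw A * xj) y = fine 'E_P[reward]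
          - gam A / 2 * fine 'V_P[Xhat (horizon M)]].

End model.

Section generator.
Context {R : realType}.
Implicit Types (psi : R -> R -> R -> R) (t x y : R).

(* f has derivative l at t relative to [0, T] (one-sided at 0 and T). *)
Definition is_tderiv (T : R) (f : R -> R) (t l : R) : Prop :=
  (fun s => (f s - f t) / (s - t)) @ within `[0, T] t^' --> l.

Definition tderiv (T : R) (f : R -> R) (t : R) : R :=
  lim ((fun s => (f s - f t) / (s - t)) @ within `[0, T] t^').

Definition generator (M : market R) (k mui vari muj varj : R) psi t x y : R :=
  let dmu := mui - k * muj in
  tderiv (horizon M) (fun s => psi s x y) t
  + vol M * y * dmu * derive1 (fun x' => psi t x' y) x
  + 2^-1 * vol M ^+ 2 * (dmu ^+ 2 + vari + k ^+ 2 * varj)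
      * derive1n 2 (fun x' => psi t x' y) x
  + speed M * (ybar M - y) * derive1 (fun y' => psi t x y') y
  + 2^-1 * yvol M ^+ 2 * derive1n 2 (fun y' => psi t x y') y
  + corr M * yvol M * vol M * dmu
      * derive1 (fun y' => derive1 (fun x' => psi t x' y') x) y.

(* The functional of the candidate distribution m, at the point (t, x, y),
   maximized in the policy update; mj is the distribution used by the other
   agent. *)
Definition update_objective (M : market R) (A : agent (horizon M))
    (mj : distr R) (V g : R -> R -> R -> R) t x y (m : distr R) : R :=
  let L := generator M (relw A) (mean m) (var m) (mean mj) (var mj) in
  L V t x y
  - gam A / 2 * L (fun t' x' y' => g t' x' y' ^+ 2) t x y
  + gam A * g t x y * L g t x y
  + lam A t * choquet (reg A) m.

Definition is_argmax (J : distr R -> R) (m : distr R) : Prop :=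
  finite_second_moment m /\
  forall m', finite_second_moment m' -> J m' <= J m.

End generator.

(* Main.v *)
Require Import Defs.
From HB Require Import structures.
From mathcomp Require Import all_boot all_order all_algebra.
From mathcomp Require Import all_classical all_reals all_analysis.
From mathcomp Require Import measurable_realfun ring lra.

(** For each [n] the relative wealth at the horizon is, almost surely, the
    initial relative wealth plus a quadratic functional of the state path plus
    Ito integrals of mean zero.  Hence V = x + D(t, y) and g = x + d(t, y), and
    since the state started from y differs from the one started from 0 by the
    deterministic y e^{- iota (s - t)}, d is quadratic in y with
    d_y = a_2^{n+1} y + a_1^{n+1}.  The updated objective is then, up to a
    constant, a mean - (b/2) (mean^2 + variance) + lambda Phi_h with
    b = gamma sigma^2.  Writing a law as the image of the uniform law under
    s |-> Q (1 - s) gives Phi_h = int Q (1 - s) h'(s) ds, so that completing the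
    square turns the objective into a constant minus
    (b/2) int (Q (1 - s) - a/b - (lambda/b) h'(s))^2 ds: the maximizer is read
    off, first almost everywhere and then everywhere by right continuity.

    For the convergence, the errors a_k^{n+1} - a_k solve linear backward
    equations driven by the errors of stage n, and for L large the passage from
    n to n + 1 halves the weighted norm sup |f(t)| e^{- L (T - t)}. *)

Set Implicit Arguments.
Unset Strict Implicit.
Unset Printing Implicit Defensive.

Import Order.TTheory GRing.Theory Num.Theory.
Import numFieldNormedType.Exports.

Local Open Scope classical_set_scope.
Local Open Scope ring_scope.

(** * Concave functions and their right derivative *)

(** No Ito formula and no partial differential equation intervenes, since nothing is known of the
    smoothness of [V] and [g]: they are only expectations along processes that exist. A cancellation
    replaces them. The mean of the policy of agent i contains k_i times the mean of the other
    policy, so this arbitrary function of the state leaves the drift of the relative wealth, which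
    becomes c_2 Y^2 + c_1 Y with c_2 = 1 / gamma - rho v a_2^n and c_1 = - rho v a_1^n. Comparing
    two initial states then costs only an affine functional of the path of Y: second moments of Y
    never appear, and the part of d independent of y stays unevaluated. The weights e^{- iota (u -
    t)} and their squares that arise in this comparison turn the equations for a_1^{n+1} and
    a_2^{n+1} into exact primitives. Neither D nor any time derivative is computed, because the
    terms of the objective that contain them are common to all candidates. *)

Lemma continuous_integrable_cc {R : realType} (f : R -> R) (a b : R) :
  {within `[a, b], continuous f} ->
  lebesgue_measure.-integrable `[a, b] (EFin \o f).
Proof. by move=> cf; apply: continuous_compact_integrable => //; exact: segment_compact. Qed.

Section concave.
Context {R : realType}.
Implicit Types (h : R -> R) (x y z p q e : R).

(** Concavity as an inequality between consecutive chords, with denominators cleared so that its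
    instances feed linear and nonlinear arithmetic directly. *)
Definition chord_concave h : Prop := forall x y z,
  0 <= x -> x < y -> y < z -> z <= 1 ->
  (h z - h y) * (y - x) <= (h y - h x) * (z - y).

Lemma convex_chord_concave h :
  @convex_function R R^o `[0, 1] (fun p => - h p) -> chord_concave h.
Proof.
move=> hcv x y z x0 xy yz z1.
have zx : 0 < z - x by lra.
have t0 : 0 <= (z - y) / (z - x) by rewrite divr_ge0 ?ltW//; lra.
have t1 : (z - y) / (z - x) <= 1 by rewrite ler_pdivrMr//; lra.
pose t : {i01 R} := Itv01 t0 t1.
have xin : (x : convex_lmodType R^o) \in (`[0, 1]%classic : set R).
  by rewrite inE/= in_itv/=; apply/andP; split; lra.
have zin : (z : convex_lmodType R^o) \in (`[0, 1]%classic : set R).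
  by rewrite inE/= in_itv/=; apply/andP; split; lra.
have := hcv t x z xin zin.
set u := (z - y) / (z - x).
have cE : conv t (x : convex_lmodType R^o) z = u * x + (1 - u) * z :> R by [].
have cE2 : conv t (- h x : R^o) (- h z) = u * (- h x) + (1 - u) * (- h z) :> R by [].
rewrite cE cE2 (_ : u * x + (1 - u) * z = y); last by rewrite /u; field; lra.
have uE : u * (z - x) = z - y by rewrite /u mulfVK//; lra.
move=> H.
have H2 : (- h y) * (z - x) <= (u * - h x + (1 - u) * - h z) * (z - x).
  by rewrite ler_wpM2r// ltW.
have H3 : (u * - h x + (1 - u) * - h z) * (z - x) =
  (z - y) * - h x + (y - x) * - h z.
  transitivity (u * (z - x) * - h x + ((z - x) - u * (z - x)) * - h z); first by ring.
  by rewrite uE; ring.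
rewrite H3 in H2; nra.
Qed.

Section slopes.
Context h (hc : chord_concave h).

Let slope p e := (h (p + e) - h p) / e.

(** The slopes from p decrease in the step e, so their limit at 0 from the right is their supremum;
    the chord from 0 to p bounds them all, which makes it finite. *)
Lemma rderiv_cvg p : 0 < p < 1 -> slope p e @[e --> 0^'+] --> rderiv h p.
Proof.
move=> /andP[p0 p1].
have H : slope p e @[e --> 0^'+] -->
    sup [set slope p x | x in [set` `]0, (1 - p)[]].
  apply: nonincreasing_at_right_cvgr.
  - by rewrite bnd_simp subr_gt0.
  - move=> a b; rewrite !in_itv/= => /andP[a0 a1] /andP[b0 b1] ab.
    rewrite /slope ler_pdivlMr// mulrAC ler_pdivrMr//.
    have [->//|neq] := eqVneq a b.
    have {neq ab} ab : a < b by rewrite lt_neqAle neq ab.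
    have : (h (p + b) - h (p + a)) * (p + a - p) <=
      (h (p + a) - h p) * (p + b - (p + a)) by apply: hc; lra.
    by lra.
  - exists ((h p - h 0) / p) => ? [e /=]; rewrite in_itv/= => /andP[e0 e1] <-.
    rewrite /slope ler_pdivlMr// mulrAC ler_pdivrMr//.
    have := @hc 0 p (p + e); nra.
by rewrite /rderiv -/(slope p); move/cvg_lim : (H) => -> //.
Qed.

Lemma rderiv_ge_chord p q : 0 < p -> p < q -> q <= 1 ->
  h q - h p <= rderiv h p * (q - p).
Proof.
move=> p0 pq q1; rewrite -ler_pdivrMr ?subr_gt0//.
have p01 : 0 < p < 1 by rewrite p0; exact: lt_le_trans q1.
apply: (cvgr_to_ge (rderiv_cvg p01)); near=> e.
have e0 : 0 < e by [].
have epq : e < q - p by near: e; apply: nbhs_right_lt; rewrite subr_gt0.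
rewrite /slope ler_pdivlMr// mulrAC ler_pdivrMr ?subr_gt0//.
by have := @hc p (p + e) q; nra.
Unshelve. all: by end_near. Qed.

Lemma rderiv_le_chord x p : 0 <= x -> x < p -> p < 1 ->
  rderiv h p * (p - x) <= h p - h x.
Proof.
move=> x0 xp p1; rewrite -ler_pdivlMr ?subr_gt0//.
have p01 : 0 < p < 1 by rewrite p1 andbT; exact: le_lt_trans xp.
apply: (cvgr_to_le (rderiv_cvg p01)); near=> e.
have e0 : 0 < e by [].
have epq : e < 1 - p by near: e; apply: nbhs_right_lt; rewrite subr_gt0.
rewrite /slope ler_pdivrMr// mulrAC ler_pdivlMr ?subr_gt0//.
by have := @hc x p (p + e); nra.
Unshelve. all: by end_near. Qed.

Lemma rderiv_nincr p q : 0 < p -> p <= q -> q < 1 -> rderiv h q <= rderiv h p.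
Proof.
move=> p0; rewrite le_eqVlt => /predU1P[->//|pq] q1.
have qp : 0 < q - p by rewrite subr_gt0.
rewrite -(ler_pM2r qp).
apply: (le_trans (rderiv_le_chord _ _ _)) => //; first exact: ltW.
by apply: rderiv_ge_chord => //; exact: ltW.
Qed.

(** Right continuity of a nonincreasing function, in a form without limits. Some chord from p to p +
    e has slope above y; by continuity of h the chord from a nearby x > p to the same endpoint still
    has, and [rderiv h x] dominates that chord. *)
Lemma rderiv_right_cont p y : {within `[0, 1], continuous h} ->
  0 < p < 1 -> y < rderiv h p -> exists2 q, p < q < 1 & y < rderiv h q.
Proof.
move=> ch /andP[p0 p1] yD.
have p01 : 0 < p < 1 by rewrite p0.
have [e /andP[e0 e1] he] : exists2 e, 0 < e < 1 - p & y < slope p e.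
  have H : \forall e \near 0^'+, y < slope p e.
    by apply: (cvgr_gt (rderiv h p)) => //; exact: rderiv_cvg.
 
  have : \forall e \near 0^'+, 0 < e < 1 - p /\ y < slope p e.
    near=> e; split; last by near: e.
    apply/andP; split => //.
    by near: e; apply: nbhs_right_lt; rewrite subr_gt0.
  by move=> /filter_ex[e [? ?]]; exists e.
have hcp : h x @[x --> p] --> h p.
  have [+ _ _] := (continuous_within_itvP h ltr01).1 ch.
  by move=> /(_ p); rewrite in_itv/= p0 p1 => /(_ isT).
have K : h (p + e) - h x - y * (p + e - x) @[x --> p^'+] -->
    h (p + e) - h p - y * (p + e - p).
  apply: cvg_at_right_filter.
  apply: cvgB; first by apply: cvgB => //; exact: cvg_cst.
  apply: cvgM; first exact: cvg_cst.
  by apply: cvgB; [exact: cvg_cst|exact: cvg_id].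
have K0 : 0 < h (p + e) - h p - y * (p + e - p).
  have -> : h (p + e) - h p - y * (p + e - p) = h (p + e) - h p - y * e by ring.
  rewrite subr_gt0.
  by rewrite -ltr_pdivlMr.
have : \forall x \near p^'+, [/\ p < x, x < p + e &
   0 < h (p + e) - h x - y * (p + e - x)].
  near=> x; split => //.
  - by near: x; apply: nbhs_right_lt; rewrite ltrDl.
  - by near: x; apply: (cvgr_gt _ K).
move=> /filter_ex[x [px xpe yx]].
exists x; first by rewrite px/=; lra.
have := @rderiv_ge_chord x (p + e).
move=> /(_ _ _ _); have xe : 0 < p + e - x by lra.
move=> H; rewrite -(ltr_pM2r xe); apply: (@lt_le_trans _ _ (h (p + e) - h x)).
  by rewrite -subr_gt0.
by apply: H; lra.
Unshelve. all: by end_near. Qed.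

Lemma measurable_rderiv : measurable_fun (`]0, 1[%classic : set R) (rderiv h).
Proof.
apply: (measurability _ (RGenOInfty.measurableE R)) => //= _ [_ [y ->] <-].
apply: is_interval_measurable => a b /= [] [+ +] [+ +] c /andP[ac cb].
rewrite /= !in_itv/= !andbT => /andP[a0 a1] ay /andP[b0 b1] yb.
have c0 : 0 < c by exact: lt_le_trans ac.
have c1 : c < 1 by exact: le_lt_trans b1.
split; first by rewrite c0 c1.
by apply: (lt_le_trans yb); exact: rderiv_nincr.
Qed.

Let mu := (@lebesgue_measure R).

Lemma integrable_rderiv_cc a b : 0 < a -> b < 1 ->
  mu.-integrable `[a, b] (EFin \o rderiv h).
Proof.
move=> a0 b1.
have ab01 : (`[a, b]%classic : set R) `<=` `]0, 1[%classic.
  move=> x /=; rewrite !in_itv/= => /andP[ax xb].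
  by rewrite (lt_le_trans a0 ax) (le_lt_trans xb b1).
apply: (@le_integrable _ _ R mu _ _ _
  (EFin \o cst (`|rderiv h a| + `|rderiv h b|))) => //.
- apply/measurable_EFinP; apply: (measurable_funS _ ab01) => //.
  exact: measurable_rderiv.
- move=> x /=; rewrite in_itv/= => /andP[ax xb].
  rewrite lee_fin [leRHS]ger0_norm ?addr_ge0// ler_norml.
  have := @rderiv_nincr a x a0 ax (le_lt_trans xb b1).
  have := @rderiv_nincr x b (lt_le_trans a0 ax) xb b1.
  have := ler_norm (rderiv h a); have := ler_norm (- rderiv h b).
  have := normr_ge0 (rderiv h a); have := normr_ge0 (rderiv h b).
  by rewrite normrN => *; apply/andP; split; lra.
- by apply: continuous_integrable_cc => x; exact: cvg_cst.
Qed.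

(* Monotonicity of the right derivative gives the case [n = 0]; each bisection of
   [a, b] halves the bound. *)
Lemma rderiv_FTC_approx n a b : 0 < a -> a < b -> b < 1 ->
  `|h b - h a - \int[mu]_(x in `[a, b]) rderiv h x| <=
  (b - a) * (rderiv h a - rderiv h b) * 2 ^- n.
Proof.
elim: n a b => [|n IHn] a b a0 ab b1.
- rewrite expr0 invr1 mulr1.
  have iD := integrable_rderiv_cc a0 b1.
  have cstI c : \int[mu]_(x in `[a, b]) (cst c x) = c * (b - a).
    rewrite Rintegral_cst//= /mu lebesgue_measure_itv/= lte_fin ab.
    by rewrite -EFinD.
  have icst c : mu.-integrable `[a, b] (EFin \o cst c).
    by apply: continuous_integrable_cc => x; exact: cvg_cst.
  have I1 : rderiv h b * (b - a) <= \int[mu]_(x in `[a, b]) rderiv h x.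
    rewrite -cstI; apply: le_Rintegral => // x /=; rewrite in_itv/= => /andP[ax xb].
    by apply: rderiv_nincr => //; exact: lt_le_trans ax.
  have I2 : \int[mu]_(x in `[a, b]) rderiv h x <= rderiv h a * (b - a).
    rewrite -cstI; apply: le_Rintegral => // x /=; rewrite in_itv/= => /andP[ax xb].
    by apply: rderiv_nincr => //; exact: le_lt_trans b1.
  have := rderiv_ge_chord a0 ab (ltW b1).
  have := rderiv_le_chord (ltW a0) ab b1.
  move: I1 I2; set J := Rintegral _ _ _; clear iD cstI icst => I1 I2 H1 H2.
  by rewrite ler_norml; apply/andP; split; lra.
- pose m := (a + b) / 2.
  have am : a < m by rewrite /m; lra.
  have mb : m < b by rewrite /m; lra.
  have := IHn a m a0 am (lt_trans mb b1).
  have := IHn m b (lt_trans a0 am) mb b1.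
  have iD := integrable_rderiv_cc a0 b1.
  have := @Rintegral_itvB _ (rderiv h) (BLeft a) (BRight b) m iD.
  rewrite !bnd_simp => /(_ (ltW am) (ltW mb)).
  rewrite Rintegral_itv_obnd_cbnd; last first.
    by apply: integrableS iD => //; apply: subset_itvr; rewrite bnd_simp ltW.
  move=> E H1 H2; rewrite exprS invfM.
  have -> : h b - h a - \int[mu]_(x in `[a, b]) rderiv h x =
    (h b - h m - \int[mu]_(x in `[m, b]) rderiv h x) +
    (h m - h a - \int[mu]_(x in `[a, m]) rderiv h x) by rewrite -E; ring.
  apply: (le_trans (ler_normD _ _)); apply: (le_trans (lerD H1 H2)).
  have -> : b - m = (b - a) / 2 by rewrite /m; field.
  have -> : m - a = (b - a) / 2 by rewrite /m; field.
  by rewrite le_eqVlt; apply/orP; left; apply/eqP; field.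
Qed.

Lemma rderiv_FTC_oo a b : 0 < a -> a < b -> b < 1 ->
  \int[mu]_(x in `[a, b]) rderiv h x = h b - h a.
Proof.
move=> a0 ab b1; apply/esym/eqP; rewrite -subr_eq0 -normr_eq0.
apply/eqP/le_anti; rewrite normr_ge0 andbT.
set C := (b - a) * (rderiv h a - rderiv h b).
have cv : C * 2 ^- n @[n --> \oo] --> (0 : R).
  rewrite -[X in _ --> X](mulr0 C); apply: cvgM; first exact: cvg_cst.
  under eq_fun do rewrite -exprVn.
  by apply: cvg_expr; rewrite ger0_norm//; lra.
apply: (cvgr_to_ge cv); near=> n.
exact: rderiv_FTC_approx.
Unshelve. all: by end_near. Qed.

(** Extends the interior identity to the closed interval: the difference [K] of the primitive and h
    is constant inside, and it is continuous up to 0 and 1, hence equal to - h 0 everywhere. *)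
Lemma rderiv_FTC p : {within `[0, 1], continuous h} ->
  mu.-integrable `]0, 1[ (EFin \o rderiv h) -> 0 <= p <= 1 ->
  \int[mu]_(x in `]0, p[) rderiv h x = h p - h 0.
Proof.
move=> ch iD /andP[p0 p1].
(* [rderiv h] has no controlled value outside ]0, 1[, hence the extension by 0. *)
pose D0 : R -> R := rderiv h \_ `]0, 1[.
have iD0 : mu.-integrable setT (EFin \o D0).
  rewrite /D0 -restrict_EFin; apply/integrable_restrict => //=.
  by rewrite setTI.
have iD0S A : measurable A -> mu.-integrable A (EFin \o D0).
  by move=> mA; apply: integrableS iD0.
pose K x := \int[mu]_(t in `[0, x]) D0 t - h x.
have K0 : K 0 = - h 0 by rewrite /K set_itv1 Rintegral_set1 sub0r.
have Kcst a b : 0 < a -> a < b -> b < 1 -> K a = K b.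
  move=> a0 ab b1; apply/eqP; rewrite -subr_eq0; apply/eqP.
  have := @Rintegral_itvB _ D0 (BLeft 0) (BRight b) a (iD0S _ _).
  rewrite !bnd_simp => /(_ _ (ltW a0) (ltW ab)) -/(_ (measurable_itv _)).
  rewrite Rintegral_itv_obnd_cbnd; last exact: iD0S.
  have -> : \int[mu]_(x in `[a, b]) D0 x = \int[mu]_(x in `[a, b]) rderiv h x.
    apply: eq_Rintegral => x; rewrite inE/= in_itv/= => /andP[ax xb].
    rewrite /D0 patchE ifT// inE/= in_itv/= (lt_le_trans a0 ax)/=.
    exact: le_lt_trans b1.
  by rewrite (rderiv_FTC_oo a0 ab b1) /K; set u := Rintegral _ _ _; set v := Rintegral _ _ _; lra.
have cK : {within `[0, 1], continuous K}.
  move=> x; apply: cvgB; last exact: ch.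
  exact: (@parameterized_integral_continuous _ 0 1 D0 ler01 (iD0S _ _)).
have [cKoo cK0 cK1] := (continuous_within_itvP K ltr01).1 cK.
have Kall x : 0 < x -> x < 1 -> K x = - h 0.
  move=> x0 x1; rewrite -K0; apply/esym.
  suff H : K z @[z --> 0^'+] --> K x by exact: (cvg_unique _ cK0 H).
  apply: cvg_near_cst; near=> z.
  have zx : z < x by near: z; exact: nbhs_right_lt.
  by apply: Kcst.
have K1 : K 1 = - h 0.
  suff H : K z @[z --> 1^'-] --> - h 0 by exact: (cvg_unique _ cK1 H).
  apply: cvg_near_cst; near=> z.
  have z0 : 0 < z by near: z; exact: nbhs_left_gt.
  by apply: Kall.
have Kp : K p = - h 0.
  move: p0 p1; rewrite !le_eqVlt => /predU1P[<-//|p0] /predU1P[->//|p1].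
  exact: Kall.
have -> : \int[mu]_(x in `]0, p[) rderiv h x = \int[mu]_(x in `[0, p]) D0 x.
  rewrite -Rintegral_itv_bndo_bndc; last exact: iD0S.
  rewrite -Rintegral_itv_obnd_cbnd; last exact: iD0S.
  apply: eq_Rintegral => x; rewrite inE/= in_itv/= => /andP[x0 xp].
  by rewrite /D0 patchE ifT// inE/= in_itv/= x0/= (lt_le_trans xp).
by move: Kp; rewrite /K; set u := Rintegral _ _ _; lra.
Unshelve. all: by end_near. Qed.

Lemma integrable_rderiv :
  (\int[mu]_(p in `]0%R, 1%R[) ((rderiv h p) ^+ 2)%:E < +oo)%E ->
  mu.-integrable `]0, 1[ (EFin \o rderiv h).
Proof.
move=> D2.
apply: (@le_integrable _ _ R mu _ _ _ (EFin \o (fun p => 1 + rderiv h p ^+ 2))) => //.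
- by apply/measurable_EFinP; exact: measurable_rderiv.
- move=> x _ /=; rewrite lee_fin [leRHS]ger0_norm ?addr_ge0// ?sqr_ge0//.
  rewrite -[X in _ <= 1 + X]real_normK ?num_real//.
  by have := sqr_ge0 (`|rderiv h x| - 1); have := normr_ge0 (rderiv h x); nra.
- apply: (@integrableD _ _ R mu `]0, 1[ (measurable_itv _) (cst 1%:E) (fun p => (rderiv h p ^+ 2)%:E)).
    apply: (@integrableS _ _ R mu `[0, 1]) => //.
      by apply: subset_itv; rewrite bnd_simp.
    by apply: (@continuous_integrable_cc R (cst 1)) => x; exact: cvg_cst.
  apply/integrableP; split.
    by apply/measurable_EFinP; apply: measurable_funX; exact: measurable_rderiv.
  apply: le_lt_trans D2; apply: ge0_le_integral => //.
  - apply: measurableT_comp => //; apply/measurable_EFinP.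
    by apply: measurable_funX; exact: measurable_rderiv.
  - by apply/measurable_EFinP; apply: measurable_funX; exact: measurable_rderiv.
  - by move=> x _; rewrite gee0_abs// lee_fin sqr_ge0.
Qed.
End slopes.
End concave.

(** * Quantile functions and laws on the line *)

Section distr_unique.
Context {R : realType}.

Lemma distr_eq (m m' : distr R) :
  (forall x, m `]-oo, x]%classic = m' `]-oo, x]%classic) ->
  forall A, measurable A -> m A = m' A.
Proof.
move=> mm' A mA.
have RG := RGenOInfty.measurableE R.
apply: (@measure_unique _ R (measurableTypeR R) (@RGenOInfty.G R)
  (fun n => `](- n%:R)%R, +oo[%classic) RG _ _ _ m m') => //.
- move=> _ _ [x ->] [y ->]; exists (Order.max x y).
  by apply/seteqP; split=> z /=; rewrite !in_itv/= !andbT gt_max;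
    [move=> [-> ->]|move=> /andP[-> ->]].
- by move=> n; exists (- n%:R).
- apply/seteqP; split=> // z _; exists (Num.bound `|z|) => //=.
  rewrite in_itv/= andbT ltrNl.
  by apply: (le_lt_trans _ (archi_boundP (normr_ge0 z))); rewrite -normrN ler_norm.
- move=> _ [x ->].
  have mC (m0 : distr R) :
      (m0 `]x, +oo[%classic = 1 - m0 `]-oo, x]%classic)%E.
    by rewrite -probability_setC// setCitvl.
  transitivity (1 - m `]-oo, x]%classic)%E; first exact: mC.
  by rewrite mm'; apply/esym; exact: mC.
- by move=> n; apply: (le_lt_trans (probability_le1 _ _)) => //; exact: ltry.
Qed.

End distr_unique.

Section quantile.
Context {R : realType} (m : distr R).
Local Notation F := (fun x => m `]-oo, x]%classic).

(** The identity viewed as a random variable on (R, m): its [cdf] is the distribution function of m,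
    which thus inherits right continuity and the limits at both infinities. *)
Let idTR : measurableTypeR R -> R := idfun.

#[local] HB.instance Definition _ :=
  @isMeasurableFun.Build _ _ _ _ idTR (@measurable_id _ _ setT).

Let FE : cdf (idTR : {RV m >-> R}) = F.
Proof. by apply/funext => x; rewrite /cdf /distribution /pushforward preimage_id. Qed.

Let F_nondecreasing x y : x <= y -> (F x <= F y)%E.
Proof. by move=> xy; rewrite -!FE; exact: cdf_nondecreasing. Qed.

(** The Galois connection from which everything on quantiles follows. The levels 0 < p < 1 make the
    defining set nonempty and bounded below; right continuity of the distribution function makes its
    infimum belong to it. *)
Lemma quantile_le p x : 0 < p < 1 ->
  (quantile m p <= x) = (p%:E <= m `]-oo, x]%classic)%E.
Proof.
move=> /andP[p0 p1].
set S := [set x : R | (p%:E <= F x)%E].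
have Sup x1 x2 : S x1 -> x1 <= x2 -> S x2.
  by rewrite /S/= => H /F_nondecreasing; exact: le_trans.
have S0 : S !=set0.
  have := @cvg_cdfy1 _ _ _ m (idTR : {RV m >-> R}); rewrite FE => H.
  have : \forall x \near +oo, p < fine (F x).
    by apply: (cvgr_gt (1 : R)) => //; exact: fine_cvg.
  move=> /filter_ex[z pz]; exists z.
  by rewrite /S/= -(fineK (fin_num_measure m _ _))// lee_fin ltW.
have lbS : has_lbound S.
  have := @cvg_cdfNy0 _ _ _ m (idTR : {RV m >-> R}); rewrite FE => H.
  have : \forall x \near -oo, fine (F x) < p.
    by apply: (cvgr_lt (0 : R)) => //; exact: fine_cvg.
  move=> /filter_ex[z pz]; exists z => u Su.
  rewrite leNgt; apply/negP => /ltW uz.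
  have {}pz : (F z < p%:E)%E by rewrite -(fineK (fin_num_measure m _ _))// lte_fin.
  by have := lt_le_trans (le_lt_trans (F_nondecreasing uz) pz) Su; rewrite ltxx.
apply/idP/idP => [qx|pF].
- have SQ : S (inf S).
    rewrite /S/=.
    have := @cdf_right_continuous _ _ _ m (idTR : {RV m >-> R}) (inf S); rewrite FE => H.
    apply: (cvge_to_ge H); near=> z.
    have : inf S < z by [].
    move=> /(inf_lt S0)[u Su uz].
    exact: (Sup _ _ Su (ltW uz)).
  exact: (Sup _ _ SQ qx).
- exact: ge_inf.
Unshelve. all: by end_near. Qed.

Lemma quantile_nondecreasing p q : 0 < p -> p <= q -> q < 1 ->
  quantile m p <= quantile m q.
Proof.
move=> p0 pq q1; rewrite quantile_le ?p0 ?(le_lt_trans pq)//.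
apply: (@le_trans _ _ q%:E) => //.
by rewrite -quantile_le ?q1 ?andbT// (lt_le_trans p0).
Qed.

(** y < Q p means F y < p, so any level strictly between F y and p will do; the midpoint is
    taken. *)
Lemma quantile_left_cont p y : 0 < p < 1 -> y < quantile m p ->
  exists2 q, 0 < q < p & y < quantile m q.
Proof.
move=> p01; have /andP[p0 p1] := p01.
rewrite ltNge quantile_le// -ltNge => Fyp.
have Ff : m `]-oo, y]%classic \is a fin_num by rewrite fin_num_measure.
have F0 : 0 <= fine (m `]-oo, y]%classic) by rewrite fine_ge0.
move: Fyp; rewrite -(fineK Ff) lte_fin => Fyp.
exists ((fine (m `]-oo, y]%classic) + p) / 2); first by lra.
rewrite ltNge quantile_le; last by lra.
by rewrite -ltNge -(fineK Ff) lte_fin; lra.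
Qed.

End quantile.

Section uniform.
Context {R : realType}.
Local Notation mu := (@lebesgue_measure R).
(** Integrals against it are brought to the open interval ]0, 1[, the only place where [rderiv] and
    [quantile] are under control; the endpoints of the uniform law are negligible. *)
Definition unif : probability (measurableTypeR R) R := uniform_prob (@ltr01 R).

Lemma integral_unif (f : measurableTypeR R -> \bar R) : measurable_fun setT f ->
  (\int[unif]_x f x = \int[mu]_(x in `]0%R, 1%R[) f x)%E.
Proof.
move=> mf.
have H g : measurable_fun [set: measurableTypeR R] g -> (forall x, 0 <= g x)%E ->
    (\int[unif]_x g x = \int[mu]_(x in `]0%R, 1%R[) g x)%E.
  move=> mg g0; rewrite /unif integral_uniform// subr0 invr1 mul1e.
  rewrite integral_itv_bndo_bndc//; last exact: measurable_funTS.
  by rewrite integral_itv_obnd_cbnd//; exact: measurable_funTS.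
rewrite integralE [RHS]integralE; congr (_ - _)%E; apply: H => //.
- exact: measurable_funepos.
- exact: measurable_funeneg.
Qed.

Lemma unifE (A : set (measurableTypeR R)) : measurable A ->
  unif A = mu (A `&` `]0, 1[).
Proof.
move=> mA; rewrite -[LHS]mul1e -integral_cst// integral_mkcond.
rewrite integral_unif.
  by rewrite -integral_mkcondr integral_cst//= ?mul1e 1?setIC//; exact: measurableI.
by apply/(measurable_restrictT _ _).1 => //.
Qed.

End uniform.

Section decreasing_rearrangement.
Context {R : realType} (m : distr R).
Local Notation mu := (@lebesgue_measure R).

(** The decreasing rearrangement of m. The reflection 1 - s pairs it with h'(s) and with the
    survival function; the value 0 outside ]0, 1[ makes it measurable on the whole line. *)
Definition uquantile : measurableTypeR R -> measurableTypeR R :=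
  (fun s => quantile m (1 - s)) \_ `]0, 1[.

Lemma uquantileE s : 0 < s < 1 -> uquantile s = quantile m (1 - s).
Proof. by move=> s01; rewrite /uquantile patchE ifT// inE/= in_itv. Qed.

Lemma uquantile_le s x : 0 < s < 1 ->
  (uquantile s <= x) = (1 - s <= fine (m `]-oo, x]%classic)).
Proof.
move=> s01; rewrite uquantileE// quantile_le; last by lra.
by rewrite -[in LHS](fineK (fin_num_measure m _ _)).
Qed.

Lemma measurable_uquantile : measurable_fun setT uquantile.
Proof.
apply/(measurable_restrictT _ _).1 => //.
apply: (measurability _ (RGenOInfty.measurableE R)) => //= _ [_ [y ->] <-].
apply: is_interval_measurable => a b /= [] [+ +] [+ +] c /andP[ac cb].
rewrite /= !in_itv/= !andbT => /andP[a0 a1] ay /andP[b0 b1] yb.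
have c0 : 0 < c by exact: lt_le_trans ac.
have c1 : c < 1 by exact: le_lt_trans b1.
split; first by rewrite c0 c1.
apply: (lt_le_trans yb); apply: quantile_nondecreasing; lra.
Qed.

Definition uquantile_mfun : {mfun measurableTypeR R >-> measurableTypeR R} :=
  mfun_Sub (mem_set measurable_uquantile).

(** By the Galois connection the event Q (1 - s) <= x is 1 - s <= F x, an interval ending at 1 of
    length F x. *)
Lemma law_uquantile A : measurable A ->
  m A = distribution (@unif R) uquantile_mfun A.
Proof.
move: A; apply: distr_eq => x.
transitivity (@unif R (uquantile @^-1` `]-oo, x]%classic)); last by [].
rewrite unifE; last first.
  by rewrite -[X in measurable X]setTI; apply: measurable_uquantile.
set Fx := fine (m `]-oo, x]%classic).
have Ff : m `]-oo, x]%classic \is a fin_num by rewrite fin_num_measure.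
have F0 : 0 <= Fx by rewrite fine_ge0.
have F1 : Fx <= 1 by rewrite -lee_fin /Fx fineK// probability_le1.
rewrite -[LHS](fineK Ff) -/Fx.
(* The left end 1 - F x belongs to the event, except when F x = 1: then it is 0, which lies outside
   ]0, 1[. *)
have -> : uquantile @^-1` `]-oo, x]%classic `&` `]0, 1[%classic =
   [set` Interval (if Fx == 1 then BRight 0 else BLeft (1 - Fx)) (BLeft 1)].
  apply/seteqP; split=> s /=; rewrite !in_itv/=.
    move=> [sx /andP[s0 s1]]; have s01 : 0 < s < 1 by rewrite s0.
    move: sx; rewrite uquantile_le// -/Fx => sx.
    by case: ifPn => _ /=; rewrite s1 andbT//; lra.
  have [Fx1|Fx1] /= := eqVneq Fx 1; move=> /andP[s0 s1].
    by rewrite s0 s1 uquantile_le ?s0//; split => //; rewrite -/Fx; lra.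
  have FF : Fx < 1 by rewrite lt_neqAle Fx1.
  have ss0 : 0 < s by lra.
  by rewrite ss0 s1 uquantile_le ?ss0//; split => //; rewrite -/Fx; lra.
rewrite lebesgue_measure_itv/=; have [->|Fx1] := eqVneq Fx 1.
  by rewrite lte_fin ltr01 -EFinD subr0.
rewrite lte_fin; case: ltP => F10; first by rewrite -EFinD; congr EFin; ring.
by congr EFin; lra.
Qed.

Lemma ge0_integral_uquantile (f : measurableTypeR R -> \bar R) : measurable_fun setT f ->
  (forall x, 0 <= f x)%E ->
  (\int[m]_x f x = \int[@unif R]_s f (uquantile s))%E.
Proof.
move=> mf f0; rewrite (eq_measure_integral (distribution (@unif R) uquantile_mfun)).
  by rewrite ge0_integral_distribution.
by move=> A mA _; exact: law_uquantile.
Qed.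

Lemma integral_uquantile (f : measurableTypeR R -> R) : measurable_fun setT f ->
  (\int[m]_x (f x)%:E = \int[@unif R]_s (f (uquantile s))%:E)%E.
Proof.
move=> mf; rewrite integralE [RHS]integralE; congr (_ - _)%E.
  rewrite ge0_integral_uquantile//; last exact/measurable_funepos/measurable_EFinP.
  apply: eq_integral => s _.
  by rewrite !funeposE.
rewrite ge0_integral_uquantile//; last exact/measurable_funeneg/measurable_EFinP.
by apply: eq_integral => s _; rewrite !funenegE.
Qed.

End decreasing_rearrangement.

(** * Real-valued integrals *)

Section real_integrable.
Context d {T : measurableType d} {R : realType} (mu : {measure set T -> \bar R}).
Context (D : set T) (mD : measurable D).
Implicit Types f g : T -> R.
Local Notation rint f := (mu.-integrable D (EFin \o f)).

Lemma rint_measurable f : rint f -> measurable_fun D f.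
Proof. by move=> /integrableP[/measurable_EFinP]. Qed.

Lemma rint_le f g : measurable_fun D f -> rint g ->
  (forall x, D x -> `|f x| <= g x) -> rint f.
Proof.
move=> mf ig fg; apply: le_integrable ig => //; first exact/measurable_EFinP.
by move=> x Dx; rewrite lee_fin; apply: (le_trans (fg x Dx)); exact: ler_norm.
Qed.

Lemma rintD f g : rint f -> rint g -> rint (fun x => f x + g x).
Proof. by move=> fi gi; exact: (integrableD mD fi gi). Qed.

Lemma rintB f g : rint f -> rint g -> rint (fun x => f x - g x).
Proof. by move=> fi gi; exact: (integrableB mD fi gi). Qed.

Lemma rintZ k f : rint f -> rint (fun x => k * f x).
Proof. by move=> fi; exact: (integrableZl mD k fi). Qed.

Lemma rint_norm f : rint f -> rint (fun x => `|f x|).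
Proof. by move=> ?; exact: integrable_norm. Qed.

Lemma rint_cst k : (mu D < +oo)%E -> rint (cst k).
Proof.
move=> muD; apply/integrableP; split; first exact/measurable_EFinP.
have -> : (\int[mu]_(x in D) `|(EFin \o cst k) x| = `|k|%:E * mu D)%E.
  by rewrite -integral_cst.
by rewrite lte_mul_pinfty.
Qed.

Lemma rint_eq f g : (forall x, D x -> f x = g x) -> rint f -> rint g.
Proof.
by move=> fg; apply: eq_integrable => // x; rewrite inE => /fg /= ->.
Qed.

Definition sqint f : Prop := measurable_fun D f /\ rint (fun x => f x ^+ 2).

Lemma sqint_lty f : measurable_fun D f ->
  (\int[mu]_(x in D) (f x ^+ 2)%:E < +oo)%E -> sqint f.
Proof.
move=> mf f2; split=> //; apply/integrableP; split.
  by apply/measurable_EFinP; exact: measurable_funX.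
by under eq_integral => x _ do rewrite /= ger0_norm ?sqr_ge0//.
Qed.

Lemma sqint_rintM f g : sqint f -> sqint g -> rint (fun x => f x * g x).
Proof.
move=> [mf f2] [mg g2]; apply: (rint_le _ (rintD f2 g2)).
  exact: measurable_funM.
move=> x _; rewrite ler_norml; apply/andP; split.
  by have := sqr_ge0 (f x + g x); have := sqr_ge0 (f x); have := sqr_ge0 (g x); nra.
by have := sqr_ge0 (f x - g x); have := sqr_ge0 (f x); have := sqr_ge0 (g x); nra.
Qed.

Lemma sqintZ k f : sqint f -> sqint (fun x => k * f x).
Proof.
move=> [mf f2]; split; first exact: measurable_funM.
by apply: rint_eq (rintZ (k ^+ 2) f2) => x _; rewrite exprMn.
Qed.

Lemma sqintD f g : sqint f -> sqint g -> sqint (fun x => f x + g x).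
Proof.
move=> sf sg; have [mf f2] := sf; have [mg g2] := sg.
split; first exact: measurable_funD.
apply: rint_eq (rintD f2 (rintD g2 (rintZ 2 (sqint_rintM sf sg)))) => x _.
by ring.
Qed.

Lemma sqintB f g : sqint f -> sqint g -> sqint (fun x => f x - g x).
Proof.
move=> sf /(sqintZ (-1)) sg; have [mf f2] := sqintD sf sg.
have fg x : f x + (-1) * g x = f x - g x by rewrite mulN1r.
split; first by apply: eq_measurable_fun mf => x _; rewrite fg.
by apply: rint_eq f2 => x _; rewrite fg.
Qed.

Lemma sqint_cst k : (mu D < +oo)%E -> sqint (cst k).
Proof. by move=> /rint_cst H; split => //; exact: (H (k ^+ 2)). Qed.

Lemma sqint_rint f : (mu D < +oo)%E -> sqint f -> rint f.
Proof.
move=> /(sqint_cst 1) s1 sf.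
by apply: rint_eq (sqint_rintM sf s1) => x _; rewrite mulr1.
Qed.

Lemma RintegralDf f g : rint f -> rint g ->
  \int[mu]_(x in D) (f x + g x) = \int[mu]_(x in D) f x + \int[mu]_(x in D) g x.
Proof. exact: RintegralD. Qed.

End real_integrable.
Arguments rint_le {d T R mu D} mD {f} g.

Lemma ae_eq_Rintegral d {T : measurableType d} {R : realType}
    (mu : {measure set T -> \bar R}) (D : set T) (f g : T -> R) :
  measurable D -> measurable_fun D f -> measurable_fun D g ->
  {ae mu, forall x, D x -> f x = g x} ->
  \int[mu]_(x in D) f x = \int[mu]_(x in D) g x.
Proof.
move=> mD mf mg fg; rewrite /Rintegral; congr fine.
apply: ae_eq_integral => //; [exact/measurable_EFinP|exact/measurable_EFinP|].
by apply: filterS fg => x fgx Dx; rewrite fgx.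
Qed.

Lemma ae_rint d {T : measurableType d} {R : realType}
    (mu : {measure set T -> \bar R}) (D : set T) (f g : T -> R) :
  measurable D -> mu.-integrable D (EFin \o f) -> measurable_fun D g ->
  {ae mu, forall x, D x -> f x = g x} -> mu.-integrable D (EFin \o g).
Proof.
move=> mD /integrableP[mf fi] mg fg; apply/integrableP.
split; first exact/measurable_EFinP.
rewrite (_ : integral _ _ _ = \int[mu]_(x in D) `|(EFin \o f) x|)%E//.
apply: ae_eq_integral => //.
- by apply: measurableT_comp => //; exact/measurable_EFinP.
- exact: measurableT_comp.
- by apply: filterS fg => x fgx Dx /=; rewrite fgx.
Qed.

Lemma Rintegral_sqr0 d {T : measurableType d} {R : realType}
    (mu : {measure set T -> \bar R}) (f : T -> R) :
  sqint mu setT f -> \int[mu]_x f x ^+ 2 <= 0 -> {ae mu, forall x, f x = 0}.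
Proof.
move=> [mf f2] f0.
have : (\int[mu]_x `|(EFin \o (fun x => (f x ^+ 2)%R)) x| = 0)%E.
  under eq_integral => x _ do rewrite /= ger0_norm ?sqr_ge0//.
  apply/le_anti/andP; split; last by apply: integral_ge0 => x _; rewrite lee_fin sqr_ge0.
  rewrite -[X in (X <= _)%E]fineK ?lee_fin//.
  exact: integrable_fin_num.
move=> /(ae_eq_integral_abs _ measurableT) H.
apply: filterS (H _); first by move=> x /(_ I) /= [] /eqP; rewrite sqrf_eq0 => /eqP.
by apply/measurable_EFinP; exact: measurable_funX.
Qed.

Lemma Rintegral_cst_prob d {T : measurableType d} {R : realType}
  (P : probability T R) (k : R) : \int[P]_x k = k.
Proof.
transitivity (k * fine (P setT)); first exact: Rintegral_cst.
by rewrite probability_setT mulr1.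
Qed.

Lemma probability_lty d {T : measurableType d} {R : realType}
  (P : probability T R) : (P setT < +oo)%E.
Proof. by rewrite probability_setT ltry. Qed.

(** * The Choquet regularizer as a quantile integral *)

Section uniform_moments.
Context {R : realType} (m : distr R).

Lemma finite_second_momentE :
  finite_second_moment m <-> sqint (@unif R) setT (uquantile m).
Proof.
have E : (\int[m]_x (x ^+ 2)%:E = \int[@unif R]_s (uquantile m s ^+ 2)%:E)%E.
  by rewrite (integral_uquantile m (f := fun x => x ^+ 2)).
split.
  rewrite /finite_second_moment E => H.
  by apply: sqint_lty => //; exact: measurable_uquantile.
move=> [_ /integrableP[_]]; rewrite /finite_second_moment E.
by under eq_integral => x _ do rewrite /= ger0_norm ?sqr_ge0//.
Qed.

Lemma meanE : mean m = \int[@unif R]_s uquantile m s.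
Proof.
rewrite /mean unlock /Rintegral; congr fine.
by rewrite (integral_uquantile m (f := fun x => x)).
Qed.

Lemma varE : var m = \int[@unif R]_s (uquantile m s - mean m) ^+ 2.
Proof.
rewrite /var /Rintegral; congr fine.
rewrite /variance unlock /covariance unlock /mean unlock.
set c := fine _.
rewrite -(integral_uquantile m (f := fun x => (x - c) ^+ 2)).
  by apply: eq_integral => x _; rewrite expr2.
by apply: measurable_funX; exact: measurable_funB.
Qed.

End uniform_moments.

Section choquet_quantile.
Context {R : realType} (m : distr R) (h : R -> R).
Local Notation mu := (@lebesgue_measure R).
Local Notation unif := (@unif R).
Definition survival (x : R) : R := fine (m `[x, +oo[%classic).
Local Notation G := survival.

Definition dreg : measurableTypeR R -> R := rderiv h \_ `]0, 1[.

Lemma dregE s : 0 < s < 1 -> dreg s = rderiv h s.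
Proof. by move=> s01; rewrite /dreg patchE ifT// inE/= in_itv. Qed.

Lemma measurable_dreg : chord_concave h -> measurable_fun setT dreg.
Proof.
move=> hc; apply/(measurable_restrictT _ _).1 => //.
exact: measurable_rderiv.
Qed.

Lemma sqint_dreg : chord_concave h ->
  (\int[mu]_(p in `]0%R, 1%R[) ((rderiv h p) ^+ 2)%:E < +oo)%E ->
  sqint unif setT dreg.
Proof.
move=> hc h2; apply: sqint_lty => //; first exact: measurable_dreg.
rewrite integral_unif.
  apply: le_lt_trans h2; rewrite le_eqVlt; apply/orP; left; apply/eqP.
  apply: eq_integral => x; rewrite inE/= in_itv/= => x01.
  by rewrite dregE.
by apply/measurable_EFinP; apply: measurable_funX; exact: measurable_dreg.
Qed.

Lemma measurable_survival : measurable_fun setT (G : measurableTypeR R -> R).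
Proof.
apply: nonincreasing_measurable => //= x y xy.
rewrite fine_le ?fin_num_measure// le_measure ?inE//.
by apply: subset_itvr; rewrite bnd_simp.
Qed.

Lemma survival01 x : 0 <= G x <= 1.
Proof.
rewrite fine_ge0//= -lee_fin fineK ?fin_num_measure//.
exact: probability_le1.
Qed.

(** Together with [survival_le] this decides s < G x for every x other than [uquantile m s], where
    both answers are possible; a single point is negligible in x. *)
Lemma lt_survival s x : 0 < s < 1 -> x < uquantile m s -> s < G x.
Proof.
move=> s01; rewrite ltNge uquantile_le// -ltNge => H.
have : 1 - fine (m `]-oo, x]%classic) <= G x.
  rewrite -lee_fin EFinB !fineK ?fin_num_measure//.
  rewrite -probability_setC// le_measure ?inE//; first exact: measurableC.
  by rewrite setCitvl; apply: subset_itvr; rewrite bnd_simp.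
by lra.
Qed.

Lemma survival_le s x : 0 < s < 1 -> uquantile m s < x -> G x <= s.
Proof.
move=> s01 sx.
(* G counts the mass at x itself, so the distribution function is used at a level strictly below
   x. *)
have : uquantile m s <= (uquantile m s + x) / 2 by lra.
rewrite uquantile_le// => H.
have : G x <= 1 - fine (m `]-oo, (uquantile m s + x) / 2]%classic).
  rewrite -lee_fin EFinB !fineK ?fin_num_measure//.
  rewrite -probability_setC// le_measure ?inE//; first exact: measurableC.
  by rewrite setCitvl; apply: subset_itvr; rewrite bnd_simp; lra.
by lra.
Qed.

(* Signed kernel with int kappa (x, s) dx = Q (1 - s), while integrating it
   against h'(s) ds gives h (m [x, +oo[), as int h' = 0. *)
Definition kappa (z : measurableTypeR R * measurableTypeR R) : R :=
  ((z.2 : R) < G z.1)%R%:R - ((z.1 : R) < 0)%R%:R.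

Lemma measurable_kappa : measurable_fun setT kappa.
Proof.
have bool_R (f : measurableTypeR R * measurableTypeR R -> bool) :
    measurable_fun setT f -> measurable_fun setT
    (fun z : measurableTypeR R * measurableTypeR R => ((f z)%:R : R)).
  move=> mf; have -> : (fun z => ((f z)%:R : R)) = (fun z => if f z then 1 else 0).
    by apply/funext => z; case: (f z).
  exact: measurable_fun_ifT.
apply: measurable_funB; apply: bool_R; apply: measurable_fun_ltr => //.
exact: (measurableT_comp measurable_survival).
Qed.

(** Up to the point u = Q (1 - s), the condition s < G x is x < u, so [kappa] at fixed s is 1 on [0,
    u[ if u >= 0 and -1 on [u, 0[ if u < 0. The second equality provides the integrability for
    Fubini. *)
Lemma integral_kappa s : 0 < s < 1 ->
  (\int[mu]_x (kappa (x, s))%:E = (uquantile m s)%:E)%E /\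
  (\int[mu]_x (`|kappa (x, s)|)%:E = (`|uquantile m s|)%:E)%E.
Proof.
move=> s01; set u := uquantile m s.
have mk : measurable_fun [set: measurableTypeR R] (fun x => kappa (x, s)).
  exact: (measurableT_comp measurable_kappa (pair2_measurable _)).
pose k' (x : R) : R := (x < (u : R))%R%:R - (x < 0)%R%:R.
have kk' x : x != u -> kappa (x, s) = k' x.
  rewrite /kappa/= /k' neq_lt => /orP[xu|ux].
    by rewrite (lt_survival s01 xu) xu.
  by rewrite ltNge (survival_le s01 ux)/= (ltNge x u) (ltW ux).
have aekk' : {ae mu, forall x, kappa (x, s) = k' x}.
  exists [set u]; split => //; first exact: lebesgue_measure_set1.
  by move=> x /=; apply: contra_notP => /eqP; exact: kk'.
have mi (a b : R) : measurable_fun [set: measurableTypeR R] (\1_`[a, b[%classic : _ -> R).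
  exact: measurable_indic.
have k'E x : k' x = \1_`[0, u[%classic x - \1_`[u, 0[%classic x.
  rewrite /k' !indicE !mem_setE !in_itv/=.
  by case: (ltP x u) => xu; case: (ltP x 0) => x0 //=; rewrite ?subrr ?subr0 ?sub0r//.
have mk' : measurable_fun [set: measurableTypeR R] k'.
  rewrite (_ : k' = fun x => \1_`[0, u[%classic x - \1_`[u, 0[%classic x); last exact/funext.
  by apply: measurable_funB.
have len (a b : R) : (\int[mu]_x (\1_(`[a, b[%classic : set R) x)%:E =
    (Order.max 0 (b - a))%:E)%E.
  rewrite integral_indic//= setIT lebesgue_measure_itv/= lte_fin.
  by case: ltP => ab; [rewrite -EFinD max_r|rewrite max_l]; rewrite ?subr_ge0 ?subr_le0// ltW.
split.
  transitivity (\int[mu]_x (k' x)%:E)%E.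
    apply: ae_eq_integral => //; [exact/measurable_EFinP|exact/measurable_EFinP|].
    by apply: filterS aekk' => x ->.
  rewrite (_ : (fun x => (k' x)%:E) = fun x => (\1_(`[0, u[%classic : set R) x)%:E
    - (\1_(`[u, 0[%classic : set R) x)%:E)%E; last first.
    by apply/funext => x /=; rewrite k'E.
  rewrite integralB//; [|exact: integrable_indic_itv..].
  rewrite !len -EFinB; congr EFin; rewrite subr0 sub0r !maxEle.
  by case: ifPn; case: ifPn => ? ?; lra.
transitivity (\int[mu]_x (`|k' x|)%:E)%E.
  apply: ae_eq_integral => //.
  - by apply/measurable_EFinP; exact: measurableT_comp.
  - by apply/measurable_EFinP; exact: measurableT_comp.
  - by apply: filterS aekk' => x ->.
rewrite (_ : (fun x => _) = fun x => (\1_(`[0, u[%classic : set R) x)%:E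
    + (\1_(`[u, 0[%classic : set R) x)%:E)%E; last first.
  apply/funext => x /=; rewrite k'E -EFinD !indicE !mem_setE !in_itv/=.
  by case: (ltP x u) => xu; case: (ltP x 0) => x0 //=;
    rewrite ?andbF ?andbT/= ?subr0 ?addr0 ?sub0r ?add0r ?normrN ?normr1 ?normr0.
rewrite ge0_integralD//; [|exact/measurable_EFinP..].
rewrite !len -EFinD; congr EFin; rewrite subr0 sub0r !maxEle.
by have [u0|u0] := leP 0 u; [rewrite ger0_norm//|rewrite ltr0_norm//]; do ?case: ifPn => ?; lra.
Qed.

Section representation.
Context (hc : chord_concave h) (ch : {within `[0, 1], continuous h})
  (h0 : h 0 = 0) (h1 : h 1 = 0)
  (h2 : (\int[mu]_(p in `]0%R, 1%R[) ((rderiv h p) ^+ 2)%:E < +oo)%E).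

Lemma rint_dreg : unif.-integrable setT (EFin \o dreg).
Proof. by apply: sqint_rint (sqint_dreg hc h2) => //=; rewrite probability_setT ltry. Qed.

Lemma Rintegral_dreg (p : R) : 0 <= p <= 1 ->
  (\int[unif]_s (((s : R) < p)%R%:R * dreg s)%:E = (h p)%:E)%E.
Proof.
move=> p01; have /andP[p0 p1] := p01.
have iD := integrable_rderiv hc h2.
transitivity (\int[mu]_(s in `]0%R, p[) (rderiv h s)%:E)%E.
  rewrite integral_unif; last first.
    apply/measurable_EFinP; apply: measurable_funM; last exact: measurable_dreg.
    rewrite (_ : (fun _ => _) = \1_(`]-oo, p[%classic : set R)); first exact: measurable_indic.
    by apply/funext => s; rewrite indicE mem_setE in_itv/=.
  rewrite integral_mkcond [RHS]integral_mkcond; apply: eq_integral => s _.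
  rewrite !patchE; have [s01|s01] := boolP (s \in `]0%R, 1%R[%classic).
    move: (s01); rewrite inE/= in_itv/= => /[dup] s01' /andP[s0 s1].
    rewrite dregE// mem_setE in_itv/= s0/=.
    by case: ifPn => _; rewrite ?mul1r ?mul0r.
  rewrite ifF//; apply: contraNF s01; rewrite !mem_setE !in_itv/= => /andP[-> sp].
  by rewrite (lt_le_trans sp).
have := rderiv_FTC hc ch iD p01; rewrite h0 subr0 /Rintegral => <-.
rewrite fineK//; apply: integrable_fin_num => //.
by apply: integrableS iD => //; apply: subset_itvl; rewrite bnd_simp.
Qed.

Lemma integral_dreg : (\int[unif]_s (dreg s)%:E = 0%:E)%E.
Proof.
have := @Rintegral_dreg 1; rewrite ler01 lexx h1 => /(_ isT) <-.
rewrite !integral_unif.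
- apply: eq_integral => s; rewrite inE/= in_itv/= => /andP[_ s1].
  by rewrite s1 mul1r.
- apply/measurable_EFinP; apply: measurable_funM; last exact: measurable_dreg.
  rewrite (_ : (fun _ => _) = \1_(`]-oo, 1%R[%classic : set R)); first exact: measurable_indic.
  by apply/funext => s; rewrite indicE mem_setE in_itv/=.
- by apply/measurable_EFinP; exact: measurable_dreg.
Qed.

(** Fubini for [kappa] times h'. The subtracted indicator of x < 0 is indispensable, as the
    indicator of s < G x alone has infinite integral in x near - oo. Integrability on the product
    reduces to that of Q (1 - s) h'(s), a product of two square integrable functions. *)
Lemma choquetE : finite_second_moment m ->
  choquet h m = \int[unif]_s (uquantile m s * dreg s).
Proof.
move=> /finite_second_momentE m2.
have iU := sqint_rintM measurableT m2 (sqint_dreg hc h2).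
pose k (z : measurableTypeR R * measurableTypeR R) : R := kappa z * dreg z.2.
have mk : measurable_fun setT k.
  apply: measurable_funM; first exact: measurable_kappa.
  exact: (measurableT_comp (measurable_dreg hc)).
have dreg0 s : ~ (0 < s < 1) -> dreg s = 0.
  by move=> s01; rewrite /dreg patchE ifF//; apply/negbTE/negP; rewrite inE/= in_itv.
have ik : (mu \x unif)%E.-integrable setT (EFin \o k).
  apply/integrable21ltyP; first exact/measurable_EFinP.
  rewrite (_ : integral _ _ _ =
    \int[unif]_s (`|uquantile m s * dreg s|)%:E)%E; last first.
    apply: eq_integral => s _.
    rewrite (_ : (fun x => _) = fun x : measurableTypeR R =>
      ((`|dreg s|)%:E * (`|kappa (x, s)|)%:E)%E); last first.
      by apply/funext => x; rewrite /k/= normrM mulrC.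
    rewrite ge0_integralZl//; last first.
      apply/measurable_EFinP; apply: measurableT_comp => //.
      exact: (measurableT_comp measurable_kappa (pair2_measurable _)).
    have [s01|s01] := pselect (0 < s < 1).
      by rewrite (integral_kappa s01).2 -EFinM -normrM mulrC.
    by rewrite dreg0// normr0 mul0e mulr0 normr0.
  by have /integrableP[_] := iU.
have E := @Fubini _ _ _ _ _ mu unif (EFin \o k) ik.
rewrite /choquet /Rintegral; congr fine.
transitivity (\int[mu]_x \int[unif]_s (k (x, s))%:E)%E.
  apply: eq_integral => x _; rewrite -/(G x) -(Rintegral_dreg (survival01 x)).
  rewrite (_ : (fun s => (k (x, s))%:E) = fun s : measurableTypeR R =>
    (((s : R) < G x)%R%:R * dreg s)%:E - ((x < 0)%R%:R%:E * (dreg s)%:E))%E; last first.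
    by apply/funext => s; rewrite /k /kappa/= mulrBl EFinB.
  have ind : measurable_fun [set: measurableTypeR R]
      (fun s : measurableTypeR R => ((s : R) < G x)%R%:R : R).
    rewrite (_ : (fun _ => _) = \1_(`]-oo, G x[%classic : set R)); first exact: measurable_indic.
    by apply/funext => s; rewrite indicE mem_setE in_itv/=.
  have id : unif.-integrable setT (EFin \o dreg) := rint_dreg.
  rewrite integralB//.
  - rewrite integralZl//.
    by rewrite integral_dreg mule0 sube0.
  - apply: (rint_le measurableT (fun s => `|dreg s|)).
    + by apply: measurable_funM => //; exact: measurable_dreg.
    + exact: rint_norm.
    + by move=> s _; case: ltP => _; rewrite ?mul1r ?mul0r ?normr0.
  - exact: integrableZl.
rewrite E; apply: eq_integral => s _.
rewrite (_ : (fun x => _) = fun x : measurableTypeR R =>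
  ((dreg s)%:E * (kappa (x, s))%:E)%E); last first.
  by apply/funext => x; rewrite /k/= mulrC.
have [s01|s01] := pselect (0 < s < 1); last first.
  rewrite dreg0// mulr0; apply: integral0_eq => x _; by rewrite mul0e.
rewrite integralZl//.
  by rewrite (integral_kappa s01).1 -EFinM mulrC.
apply/integrableP; split.
  apply/measurable_EFinP.
  exact: (measurableT_comp measurable_kappa (pair2_measurable _)).
by rewrite (integral_kappa s01).2 ltry.
Qed.

End representation.
End choquet_quantile.

(** * Maximization of the regularized mean-variance functional *)

Section right_continuous_nonincreasing.
Context {R : realType}.
Local Notation unif := (@unif R).
Local Notation mu := (@lebesgue_measure R).
Implicit Types (W : measurableTypeR R -> measurableTypeR R) (s q x y : R).

(** The shape shared by decreasing rearrangements and by c + theta h': nonincreasing and right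
    continuous on ]0, 1[. Such a function is the rearrangement of some law and is determined
    everywhere by its values almost everywhere. *)
Definition rc_nonincr W : Prop :=
  (forall s q, 0 < s -> s <= q -> q < 1 -> W q <= W s) /\
  (forall s y, 0 < s < 1 -> y < W s -> exists2 q, s < q < 1 & y < W q).

Lemma rc_nonincr_uquantile (m : distr R) : rc_nonincr (uquantile m).
Proof.
split=> [s q s0 sq q1|s y s01].
  rewrite !uquantileE; [|lra..].
  by apply: quantile_nondecreasing; lra.
rewrite uquantileE// => /quantile_left_cont[|q q01 yq]; first lra.
exists (1 - q); first lra.
by rewrite uquantileE; [rewrite opprB addrCA subrr addr0|lra].
Qed.

Lemma rc_nonincr_dreg (h : R -> R) c theta : chord_concave h ->
  {within `[0, 1], continuous h} -> 0 <= theta ->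
  rc_nonincr (fun s => c + theta * dreg h s).
Proof.
move=> hc ch theta0; split=> [s q s0 sq q1|s y s01].
  rewrite lerD2l ler_wpM2l// !dregE; [|lra..].
  exact: rderiv_nincr.
have s1 : (s + 1) / 2 < 1 by lra.
rewrite dregE//; have [->|tn0] := eqVneq theta 0.
  rewrite mul0r => yc; exists ((s + 1) / 2); first by lra.
  by rewrite mul0r.
have tp : 0 < theta by rewrite lt_neqAle eq_sym tn0.
rewrite -ltrBlDl mulrC -ltr_pdivrMr// => H.
have [q sq yq] := rderiv_right_cont hc ch s01 H.
exists q => //; rewrite dregE; last lra.
by rewrite -ltrBlDl mulrC -ltr_pdivrMr.
Qed.

(** Inside ]0, 1[ the event W <= x is an interval ending at 1. If W s <= x it contains [s, 1[;
    otherwise right continuity gives q > s with W q > x, and the event lies in ]q, 1[, of length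
    less than 1 - s. *)
Lemma unif_le_rc W s x : measurable_fun setT W -> rc_nonincr W -> 0 < s < 1 ->
  ((1 - s)%:E <= unif (W @^-1` `]-oo, x]%classic))%E = (W s <= x).
Proof.
move=> mW [Wd Wrc] s01; have /andP[s0 s1] := s01.
have mpre : measurable (W @^-1` `]-oo, x]%classic).
  by rewrite -[X in measurable X]setTI; exact: mW.
rewrite unifE//; apply/idP/idP => [|Wsx].
- apply: contraLR; rewrite -!ltNge => /(Wrc _ _ s01)[q /andP[sq q1] xq].
  apply: (@le_lt_trans _ _ (mu `]q, 1[%classic)).
    apply: le_measure; rewrite ?inE//; first exact: measurableI.
    move=> r /=; rewrite !in_itv/= => -[Wrx /andP[r0 r1]]; rewrite r1 andbT.
    rewrite ltNge; apply/negP => rq.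
    by have := Wd _ _ r0 rq q1; rewrite leNgt (le_lt_trans Wrx).
  rewrite lebesgue_measure_itv/= lte_fin q1 -EFinD lte_fin; lra.
- apply: (@le_trans _ _ (mu `[s, 1[%classic)).
    by rewrite lebesgue_measure_itv/= lte_fin s1 -EFinD.
  apply: le_measure; rewrite ?inE//; first exact: measurableI.
  move=> r /=; rewrite !in_itv/= => /andP[sr r1].
  rewrite r1 (lt_le_trans s0 sr); split => //.
  by apply: le_trans Wsx; exact: Wd.
Qed.

(** The pointwise optimizer has to come from an actual probability measure: the image of the uniform
    law under W, whose rearrangement is W because W is already arranged decreasingly. *)
Lemma uquantile_law W : measurable_fun setT W -> rc_nonincr W ->
  exists m : distr R, forall s, 0 < s < 1 -> uquantile m s = W s.
Proof.
move=> mW Wrc.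
pose Wf : {mfun measurableTypeR R >-> measurableTypeR R} := mfun_Sub (mem_set mW).
pose m : distr R := distribution unif Wf.
exists m => s s01.
have H x : (uquantile m s <= x) = (W s <= x).
  rewrite -(unif_le_rc _ mW Wrc s01) uquantileE// quantile_le//; last lra.
by apply/le_anti; rewrite H lexx/= -H.
Qed.

(** If W s > W' s, right continuity gives q > s with W q > W' s, and by monotonicity W > W' on all
    of ]s, q[, a set of positive measure. *)
Lemma rc_nonincr_ae_eq W1 W2 : rc_nonincr W1 -> rc_nonincr W2 ->
  {ae unif, forall z, W1 z = W2 z} ->
  forall s, 0 < s < 1 -> W1 s = W2 s.
Proof.
move=> r1 r2 aeq s s01.
suff H W W' : rc_nonincr W -> rc_nonincr W' -> {ae unif, forall z, W z = W' z} ->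
    W s <= W' s.
  apply/le_anti; rewrite !H//.
  by apply: filterS aeq => z ->.
move=> {r1 r2 aeq W1 W2} [Wd Wrc] [Wd' Wrc'] aeq.
rewrite leNgt; apply/negP => /(Wrc _ _ s01)[q /andP[sq q1] Wq].
have /andP[s0 s1] := s01.
case: aeq => N [mN N0 sub].
have sN : `]s, q[%classic `<=` N.
  move=> r /=; rewrite in_itv/= => /andP[sr rq]; apply: sub => /= WW'.
  have := Wd _ _ (lt_trans s0 sr) (ltW rq) q1.
  have := Wd' _ _ s0 (ltW sr) (lt_trans rq q1).
  rewrite -WW' => H1 H2.
  by have := lt_le_trans Wq (le_trans H2 H1); rewrite ltxx.
have : (unif `]s, q[%classic <= unif N)%E by apply: le_measure; rewrite ?inE.
rewrite N0 unifE// setIidl; last by apply: subset_itv; rewrite bnd_simp ltW.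
by rewrite lebesgue_measure_itv/= lte_fin sq -EFinD lee_fin; lra.
Qed.

Lemma eq_Rintegral_unif (f g : measurableTypeR R -> R) :
  measurable_fun setT f -> measurable_fun setT g ->
  (forall s, 0 < s < 1 -> f s = g s) ->
  \int[unif]_s f s = \int[unif]_s g s.
Proof.
move=> mf mg fg; rewrite /Rintegral !integral_unif; [|exact/measurable_EFinP..].
congr fine; apply: eq_integral => s; rewrite inE/= in_itv/= => s01.
by rewrite fg.
Qed.

End right_continuous_nonincreasing.

Section regularized_argmax.
Context {R : realType} (h : R -> R).
Local Notation unif := (@unif R).
Local Notation mu := (@lebesgue_measure R).
Context (hc : chord_concave h) (ch : {within `[0, 1], continuous h})
  (h0 : h 0 = 0) (h1 : h 1 = 0)
  (h2 : (\int[mu]_(p in `]0%R, 1%R[) ((rderiv h p) ^+ 2)%:E < +oo)%E).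

Let unif_lty : (unif setT < +oo)%E.
Proof. by rewrite probability_setT ltry. Qed.

Lemma Rintegral_dreg0 : \int[unif]_s dreg h s = 0.
Proof. by rewrite /Rintegral integral_dreg. Qed.

Lemma sqint_affine c theta : sqint unif setT (fun s => c + theta * dreg h s).
Proof.
apply: sqintD => //; first exact: (sqint_cst measurableT c unif_lty).
by apply: sqintZ => //; exact: sqint_dreg.
Qed.

(** The mean does not see theta because the integral of h' is h 1 - h 0 = 0. This serves the initial
    policy, the updated ones and the optimal candidate alike. *)
Lemma uquantile_affine (m : distr R) c theta :
  (forall s, 0 < s < 1 -> uquantile m s = c + theta * rderiv h s) ->
  finite_second_moment m /\ mean m = c.
Proof.
move=> mE.
have mE' s : 0 < s < 1 -> uquantile m s = c + theta * dreg h s.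
  by move=> s01; rewrite mE// dregE.
have [mW W2] := sqint_affine c theta.
have mU := @measurable_uquantile _ m.
split.
  rewrite finite_second_momentE; split => //.
  have /integrableP[_ W2'] := W2.
  apply/integrableP; split; first by apply/measurable_EFinP; exact: measurable_funX.
  apply: le_lt_trans W2'; rewrite !integral_unif; last 2 first.
  - by apply: measurableT_comp => //; apply/measurable_EFinP; exact: measurable_funX.
  - by apply: measurableT_comp => //; apply/measurable_EFinP; exact: measurable_funX.
  rewrite le_eqVlt; apply/orP; left; apply/eqP; apply: eq_integral => s.
  by rewrite inE/= in_itv/= => /mE' ->.
rewrite meanE (eq_Rintegral_unif mU mW)//.
rewrite RintegralDf//; [|exact: (rint_cst measurableT c unif_lty)|].
  rewrite Rintegral_cst_prob.
  by rewrite RintegralZl ?Rintegral_dreg0 ?mulr0 ?addr0//; exact: rint_dreg.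
by apply: rintZ => //; exact: rint_dreg.
Qed.

Lemma objective_square (m : distr R) (a b l : R) : b != 0 ->
  finite_second_moment m ->
  a * mean m - b / 2 * (mean m) ^+ 2 - b / 2 * var m + l * choquet h m =
  a ^+ 2 / b / 2 + l ^+ 2 / b / 2 * (\int[unif]_s (dreg h s) ^+ 2)
  - b / 2 * \int[unif]_s (uquantile m s - (a / b + l / b * dreg h s)) ^+ 2.
Proof.
move=> b0 m2; rewrite choquetE// varE.
move/finite_second_momentE : m2 => sU.
have sD : sqint unif setT (dreg h) by exact: sqint_dreg.
set M := mean m; set c := a / b; set th := l / b.
have iU : unif.-integrable setT (EFin \o uquantile m) by exact: (sqint_rint measurableT unif_lty).
have iD : unif.-integrable setT (EFin \o dreg h) by exact: rint_dreg.
have scst k : sqint unif setT (cst k) by exact: (sqint_cst measurableT k unif_lty).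
have icst k : unif.-integrable setT (EFin \o cst k) by exact: (rint_cst measurableT k unif_lty).
have iUM : unif.-integrable setT (EFin \o (fun s => (uquantile m s - M) ^+ 2)).
  by have [] := sqintB measurableT sU (scst M).
have iUD := sqint_rintM measurableT sU sD.
have iD2 := sD.2.
(* The square is expanded around the mean M, so that the variance appears as it stands; what remains
   is a combination of the integrals of U, U h', h'^2, h' and constants. *)
have -> : \int[unif]_s (uquantile m s - (c + th * dreg h s)) ^+ 2 =
  \int[unif]_s ((uquantile m s - M) ^+ 2 + (2 * (M - c) * uquantile m s +
    (((M - c) ^+ 2 - 2 * (M - c) * M) + (th ^+ 2 * dreg h s ^+ 2 +
    (- (2 * th) * (uquantile m s * dreg h s) + (2 * th * c) * dreg h s))))).
  by apply: eq_Rintegral => s _; ring.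
have i1 := rintZ measurableT (2 * th * c) iD.
have i2 := rintZ measurableT (- (2 * th)) iUD.
have i3 := rintZ measurableT (th ^+ 2) iD2.
have i4 := icst ((M - c) ^+ 2 - 2 * (M - c) * M).
have i5 := rintZ measurableT (2 * (M - c)) iU.
have i12 := rintD measurableT i2 i1.
have i123 := rintD measurableT i3 i12.
have i1234 := rintD measurableT i4 i123.
have i12345 := rintD measurableT i5 i1234.
rewrite (RintegralDf measurableT iUM i12345) (RintegralDf measurableT i5 i1234).
rewrite (RintegralDf measurableT i4 i123) (RintegralDf measurableT i3 i12).
rewrite (RintegralDf measurableT i2 i1) !RintegralZl// -meanE Rintegral_dreg0.
rewrite Rintegral_cst_prob -/M.
by rewrite /c /th; field.
Qed.

(** The law [ms] with rearrangement [W] is an admissible competitor that makes the square vanish.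
    Optimality of m then forces its own square to have integral at most 0, so the argmax is
    unique. *)
Theorem argmax_quantile (J : distr R -> R) (K a b l : R) (m : distr R) :
  0 < b -> 0 <= l ->
  (forall m', finite_second_moment m' ->
    J m' = K + (a * mean m' - b / 2 * (mean m') ^+ 2 - b / 2 * var m'
      + l * choquet h m')) ->
  is_argmax J m ->
  forall s, 0 < s < 1 -> uquantile m s = a / b + l / b * rderiv h s.
Proof.
move=> b0 l0 JE [m2 Jm].
have b_neq0 : b != 0 by rewrite gt_eqF.
pose W s := a / b + l / b * dreg h s.
have sW : sqint unif setT W := sqint_affine _ _.
have rW : rc_nonincr W by apply: rc_nonincr_dreg => //; rewrite divr_ge0// ltW.
have [ms msE] := uquantile_law sW.1 rW.
have [ms2 _] : finite_second_moment ms /\ mean ms = a / b.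
  by apply: (@uquantile_affine _ _ (l / b)) => s s01; rewrite msE// /W dregE.
have := Jm _ ms2; rewrite !JE// !objective_square//.
rewrite -/(W _) lerD2l lerD2l lerN2.
have -> : \int[unif]_s (uquantile ms s - W s) ^+ 2 = 0.
  transitivity (\int[unif]_s (cst 0 s : R)).
    apply: eq_Rintegral_unif => //.
      apply: measurable_funX; apply: measurable_funB; last exact: sW.1.
      exact: measurable_uquantile.
    by move=> s s01; rewrite msE// subrr expr0n.
  by rewrite Rintegral_cst// mul0r.
rewrite mulr0 pmulr_rle0 ?divr_gt0// => H.
have sU : sqint unif setT (fun s => uquantile m s - W s).
  by apply: sqintB => //; exact/finite_second_momentE.
have := Rintegral_sqr0 sU H => ae0 s s01; rewrite -dregE// -/(W s).
apply: rc_nonincr_ae_eq s01 => //; first exact: rc_nonincr_uquantile.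
by apply: filterS ae0 => x /eqP; rewrite subr_eq0 => /eqP.
Qed.

End regularized_argmax.

(** * The first absolute moment of a centred Gaussian *)

Section normal_mean.
Context {R : realType} (s : R) (s0 : 0 < s).
Local Notation mu := (@lebesgue_measure R).
Local Notation N := (normal_prob 0 s : probability (measurableTypeR R) R).

(** The Radon-Nikodym derivative and the density give the same measure to every set, so they agree
    almost everywhere, and the change of variables applies to the density. *)
Lemma ge0_integral_normal (f : measurableTypeR R -> R) :
  measurable_fun setT f -> (forall x, 0 <= f x) ->
  (\int[normal_prob 0%R s]_x (f x)%:E = \int[mu]_x (f x * normal_pdf 0%R s x)%:E)%E.
Proof.
move=> mf f0.
have dom := normal_prob_dominates 0 s.
pose RN := Radon_Nikodym_SigmaFinite.f (normal_prob 0 s) mu.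
have iRN : mu.-integrable setT RN by exact: Radon_Nikodym_SigmaFinite.f_integrable.
have mp : measurable_fun setT (normal_pdf 0 s) := measurable_normal_pdf 0 s.
have ae : ae_eq mu setT RN (EFin \o normal_pdf 0 s).
  apply: integral_ae_eq => //.
    by apply/measurable_EFinP.
  move=> A _ mA; rewrite -Radon_Nikodym_SigmaFinite.f_integral//.
rewrite -(Radon_Nikodym_SigmaFinite.change_of_variables dom)//; last exact/measurable_EFinP.
apply: ae_eq_integral => //.
- apply: emeasurable_funM; first exact/measurable_EFinP.
  exact: (measurable_int mu iRN).
- by apply/measurable_EFinP; apply: measurable_funM.
- by apply: filterS ae => x /(_ I) fx _; rewrite EFinM; congr (_ * _)%E.
Qed.

(* Comparing with the density of twice the standard deviation: with u = |x| / s
   the quotient of the densities is a multiple of e^{3 u^2 / 8}, which is at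
   least 1 + 3 u^2 / 8 >= 3 u / 4. *)
Lemma normal_abs_pdf_le x : `|x| * normal_pdf 0 s x <=
  s * (4 / 3) * (normal_peak s / normal_peak (2 * s)) * normal_pdf 0 (2 * s) x.
Proof.
have s20 : 2 * s != 0 by rewrite mulf_neq0// gt_eqF.
rewrite !normal_pdfE// ?gt_eqF//.
have p2 := normal_peak_gt0 s20.
have p1 : 0 < normal_peak s by rewrite normal_peak_gt0// gt_eqF.
set pk := normal_peak s; set pk2 := normal_peak (2 * s).
have -> : s * (4 / 3) * (pk / pk2) * (pk2 * normal_fun 0 (2 * s) x) =
   pk * (s * (4 / 3) * normal_fun 0 (2 * s) x) by field; rewrite gt_eqF.
rewrite mulrCA ler_pM2l//.
rewrite /normal_fun !subr0.
pose a := 3 / 8 * (x / s) ^+ 2.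
have -> : - x ^+ 2 / ((2 * s) ^+ 2 *+ 2) = a + (- x ^+ 2 / (s ^+ 2 *+ 2)).
  by rewrite /a; field; rewrite ?gt_eqF.
rewrite expRD mulrA ler_pM2r ?expR_gt0//.
have ea := expR_ge1Dx a.
have xs : `|x| = s * `|x / s|.
  by rewrite normrM normfV (gtr0_norm s0); field; rewrite gt_eqF.
rewrite xs -mulrA ler_pM2l//.
rewrite /a -[(x / s) ^+ 2]real_normK ?num_real// in ea *.
move: (normr_ge0 (x / s)) ea; move: (`|x / s| : R) => u u0.
move: (expR _) => E ea.
by have := sqr_ge0 (u - 1); nra.
Qed.

Lemma integrable_normal_abs :
  mu.-integrable setT (EFin \o (fun x => `|x| * normal_pdf 0 s x)).
Proof.
apply: (rint_le measurableT _ _ (rintZ measurableT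
   (s * (4 / 3) * (normal_peak s / normal_peak (2 * s)))
   (integrable_normal_pdf 0 (2 * s)))).
  by apply: measurable_funM; [exact: normr_measurable|exact: measurable_normal_pdf].
move=> x _; rewrite ger0_norm; first exact: normal_abs_pdf_le.
by rewrite mulr_ge0// normal_pdf_ge0.
Qed.

Lemma integrable_normal_id :
  (normal_prob 0 s).-integrable setT (EFin \o (fun x : measurableTypeR R => x)).
Proof.
apply/integrableP; split; first exact/measurable_EFinP.
rewrite (@ge0_integral_normal (fun x => `|x|))//; last exact: normr_measurable.
have /integrableP[_] := integrable_normal_abs.
by under eq_integral => x _ do rewrite /= ger0_norm ?mulr_ge0 ?normal_pdf_ge0//.
Qed.

(** The positive and negative parts have equal integrals under x -> - x, and these are finite by
    [integrable_normal_abs], so their difference is 0 and not an indeterminate form. *)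
Lemma integral_normal_id : (\int[normal_prob 0%R s]_x x%:E = 0)%E.
Proof.
have sn0 : s != 0 by rewrite gt_eqF.
pose f x := `|x| * normal_pdf 0 s x.
have mf : measurable_fun setT f.
  by apply: measurable_funM; [exact: normr_measurable|exact: measurable_normal_pdf].
rewrite integralE.
have -> : (\int[normal_prob 0%R s]_x (fun x => x%:E)^\+ x =
    \int[mu]_(x in `[0%R, +oo[) (f x)%:E)%E.
  rewrite (_ : (fun x : R => x%:E)^\+%E = fun x => (Order.max x 0)%:E); last first.
    by apply/funext => x; rewrite funeposE EFin_max.
  rewrite (@ge0_integral_normal (fun x => Order.max x 0))//; last 2 first.
  - exact: measurable_maxr.
  - by move=> x; rewrite le_max lexx orbT.
  rewrite [RHS]integral_mkcond; apply: eq_integral => x _.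
  rewrite patchE mem_setE in_itv/= andbT; case: leP => x0; rewrite /f ?mul0r//.
  by rewrite ger0_norm.
have -> : (\int[normal_prob 0%R s]_x (fun x => x%:E)^\- x =
    \int[mu]_(x in `]-oo, (-0)%R]) (f x)%:E)%E.
  rewrite (_ : (fun x : R => x%:E)^\-%E = fun x => (Order.max (- x) 0)%:E); last first.
    by apply/funext => x; rewrite funenegE EFin_max EFinN.
  rewrite (@ge0_integral_normal (fun x => Order.max (- x) 0))//; last 2 first.
  - by apply: measurable_maxr => //; exact: measurable_oppr.
  - by move=> x; rewrite le_max lexx orbT.
  rewrite [RHS]integral_mkcond; apply: eq_integral => x _.
  rewrite patchE mem_setE in_itv/= oppr0 -oppr_ge0; case: leP => x0; rewrite /f ?mul0r//.
  by rewrite -normrN ger0_norm.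
have fi : mu.-integrable `[0, +oo[ (EFin \o f).
  by apply: integrableS integrable_normal_abs.
have cf : continuous f.
  move=> x; apply: cvgM; first exact: norm_continuous.
  exact: continuous_normal_pdf.
rewrite ge0_integration_by_substitutionNy; last 2 first.
- exact: continuous_subspaceT.
- by move=> x _; rewrite /f mulr_ge0// normal_pdf_ge0.
rewrite (_ : (fun x => ((f \o -%R) x)%:E) = EFin \o f); last first.
  apply/funext => x/=; rewrite /f normrN !normal_pdfE//.
  by rewrite /normal_fun !subr0 sqrrN.
rewrite subee//; exact: integrable_fin_num.
Qed.

End normal_mean.

(** * Elementary and Ito integrals have zero mean *)

Section brownian_increments.
Context {R : realType} {d : measure_display} {Omega : measurableType d}.
Context (P : probability Omega R) (T : R) (F : R -> set (set Omega)).
Context (hF : filtration_upto T F).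
Local Notation rint f := (P.-integrable setT (EFin \o f)).

(** What a single noise retains of [independent_brownian]. Only means of stochastic integrals are
    computed below, one noise at a time. *)
Definition brownian_wrt (W : R -> Omega -> R) : Prop :=
  (forall s : R, s \in `[0, T] -> measurable_wrt (F s) (W s)) /\
  (forall (s u : R) (A : set Omega) (U : set (measurableTypeR R)),
     0 <= s -> s < u -> u <= T -> F s A -> measurable U ->
     P (A `&` [set w | U (W u w - W s w)]) =
     (P A * normal_prob 0 (Num.sqrt (u - s)) U)%E).

Lemma independent_brownian_wrt (J : finType) (W : J -> R -> Omega -> R) (k : J) :
  independent_brownian P T F W -> brownian_wrt (W k).
Proof.
move=> [mW _ _ ind]; split=> [s sT|s u A U s0 su uT FA mU]; first exact: mW.
have := ind s u A (fun i => if i == k then U else setT) s0 su uT FA.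
have mU' i : measurable (if i == k then U else setT) by case: ifP.
move=> /(_ mU').
have -> : \bigcap_(i in [set: J])
   [set w | (if i == k then U else setT) (W i u w - W i s w)] =
   [set w | U (W k u w - W k s w)].
  apply/seteqP; split => [w /(_ k I)|w Uw i _] /=; first by rewrite eqxx.
  by case: eqP => // ->.
move=> ->; congr (_ * _)%E; rewrite (bigD1 k)//= eqxx.
rewrite big1 ?mule1// => i ik; rewrite (negbTE ik).
exact: (@probability_setT _ _ _ (normal_prob 0 (Num.sqrt (u - s)))).
Qed.

Lemma measurable_wrt_fun s (X : Omega -> R) : s \in `[0, T] ->
  measurable_wrt (F s) X -> measurable_fun setT X.
Proof.
move=> sT mX _ U mU; rewrite setTI; apply: (hF.1 s sT).2.
exact: mX.
Qed.

Section increment.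
Context (W : R -> Omega -> R) (hW : brownian_wrt W).
Context (s u : R) (s0 : 0 <= s) (su : s < u) (uT : u <= T).
Context (H : Omega -> R) (mH : measurable_wrt (F s) H) (iH : rint H).
Local Notation dW := (fun w => W u w - W s w).

Let sT : s \in `[0, T].
Proof. by rewrite in_itv/= s0 (le_trans (ltW su)). Qed.

Let uT' : u \in `[0, T].
Proof. by rewrite in_itv/= uT (le_trans s0)// ltW. Qed.

Let mdW : measurable_fun [set: Omega] (dW : Omega -> measurableTypeR R).
Proof.
by apply: measurable_funB; [exact: measurable_wrt_fun (hW.1 _ uT')|
  exact: measurable_wrt_fun (hW.1 _ sT)].
Qed.

Let H' : Omega -> measurableTypeR R := H.

Let mH' : measurable_fun [set: Omega] H'.
Proof. exact: measurable_wrt_fun mH. Qed.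

Let pairf : Omega -> measurableTypeR R * measurableTypeR R := fun w => (H w, dW w).

Let mpair : measurable_fun setT pairf.
Proof. exact: measurable_fun_pair. Qed.

Let m1 : probability (measurableTypeR R) R :=
  distribution P (@mfun_Sub _ _ Omega (measurableTypeR R) H' (mem_set mH')).

Let m2 : probability (measurableTypeR R) R := normal_prob 0 (Num.sqrt (u - s)).

Let m' : probability (measurableTypeR R * measurableTypeR R)%type R :=
  distribution P (mfun_Sub (mem_set mpair)
     : {mfun Omega >-> (measurableTypeR R * measurableTypeR R)%type}).

(** Independence of H from the later increment: the joint law agrees with the product on rectangles,
    hence everywhere. The mean of H times the increment is then an iterated integral whose inner
    integral is a centred Gaussian mean. *)
Let prodE X : measurable X -> (m1 \x m2)%E X = m' X.
Proof.
move: X; apply: product_measure_unique => A B mA mB.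
transitivity (P (H @^-1` A `&` [set w | B (dW w)])); first by [].
by rewrite (hW.2 s u)//; exact: mH.
Qed.

Let s_gt0 : 0 < Num.sqrt (u - s).
Proof. by rewrite sqrtr_gt0 subr_gt0. Qed.

Let f (z : measurableTypeR R * measurableTypeR R) : R := z.1 * z.2.

Let mf : measurable_fun setT f.
Proof. exact: measurable_funM. Qed.

Let i2 : m2.-integrable setT (EFin \o (fun x : measurableTypeR R => x)).
Proof. exact: (integrable_normal_id s_gt0). Qed.

Let if12 : (m1 \x m2)%E.-integrable setT (EFin \o f).
Proof.
apply/integrable12ltyP; first exact/measurable_EFinP.
have /integrableP[mid i2'] := i2.
pose c := (\int[m2]_y (`|y : R|)%:E)%E.
have c0 : (0 <= c)%E by apply: integral_ge0 => y _; rewrite lee_fin.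
rewrite (_ : integral _ _ _ = \int[m1]_x (c * (`|x : R|)%:E))%E; last first.
  apply: eq_integral => x _.
  rewrite (_ : (fun y => _) = fun y : measurableTypeR R => ((`|x : R|)%:E * (`|y : R|)%:E)%E); last first.
    by apply/funext => y; rewrite /f/= normrM.
  rewrite ge0_integralZl//; first by rewrite muleC.
  by apply/measurable_EFinP; exact: normr_measurable.
rewrite ge0_integralZl//; last by apply/measurable_EFinP; exact: normr_measurable.
rewrite lte_mul_pinfty ?ge0_fin_numE//.
rewrite ge0_integral_distribution//; last by apply/measurable_EFinP; exact: normr_measurable.
by have /integrableP[_] := iH.
Qed.

Let if' : rint (fun w => H w * dW w).
Proof.
apply/integrableP; split.
  by apply/measurable_EFinP; apply: measurable_funM.
have /integrableP[_] := if12.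
rewrite (eq_measure_integral m'); last by move=> X mX _; exact: prodE.
rewrite ge0_integral_distribution//.
by apply: measurableT_comp => //; exact/measurable_EFinP.
Qed.

Lemma rint_mul_increment : rint (fun w => H w * (W u w - W s w)).
Proof. exact: if'. Qed.

Lemma integral_mul_increment : (\int[P]_w (H w * (W u w - W s w))%:E = 0)%E.
Proof.
transitivity (\int[m']_z (EFin \o f) z)%E.
  apply/esym; apply: integral_distribution; first exact/measurable_EFinP.
  exact: if'.
transitivity (\int[m1 \x m2]_z (EFin \o f) z)%E.
  by apply: eq_measure_integral => X mX _; exact/esym/prodE.
rewrite -integral12_prod_meas1//.
apply: integral0_eq => x _; rewrite /fubini_F/= /f/=.
under eq_integral do rewrite EFinM.
by rewrite integralZl// integral_normal_id// mule0.
Qed.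

End increment.

Definition zero_mean (f : Omega -> R) : Prop := rint f /\ \int[P]_w f w = 0.

Lemma zero_meanD f g : zero_mean f -> zero_mean g ->
  zero_mean (fun w => f w + g w).
Proof.
move=> [fi f0] [gi g0]; split; first exact: rintD.
by rewrite RintegralDf// f0 g0 addr0.
Qed.

Lemma zero_meanZ k f : zero_mean f -> zero_mean (fun w => k * f w).
Proof.
move=> [fi f0]; split; first exact: rintZ.
by rewrite RintegralZl// f0 mulr0.
Qed.

Lemma zero_mean_sum n (f : nat -> Omega -> R) :
  (forall k, (k < n)%N -> zero_mean (f k)) ->
  zero_mean (fun w => \sum_(k < n) f k w).
Proof.
elim: n => [_|n IHn nf].
  have E : (fun w => \sum_(k < 0) f k w) = (cst 0 : Omega -> R).
    by apply/funext => w; rewrite big_ord0.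
  rewrite E; split; last by rewrite Rintegral_cst// mul0r.
  by apply: rint_cst => //; exact: probability_lty.
have E : (fun w => \sum_(k < n.+1) f k w) =
    (fun w => \sum_(k < n) f k w + f n w).
  by apply/funext => w; rewrite big_ord_recr.
rewrite E; apply: zero_meanD; last exact: nf.
by apply: IHn => k kn; apply: nf; exact: ltnW.
Qed.

(** The case s = u is treated apart: the grid of a simple process may repeat a point, whereas the
    Gaussian law of increments is given for s < u. *)
Lemma zero_mean_increment (W : R -> Omega -> R) s u H : brownian_wrt W ->
  0 <= s -> s <= u -> u <= T -> measurable_wrt (F s) H -> rint H ->
  zero_mean (fun w => H w * (W u w - W s w)).
Proof.
move=> hW s0; rewrite le_eqVlt => /predU1P[<- _ mH iH|su uT mH iH].
  have E : (fun w => H w * (W s w - W s w)) = (cst 0 : Omega -> R).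
    by apply/funext => w; rewrite subrr mulr0.
  rewrite E; split; last by rewrite Rintegral_cst// mul0r.
  by apply: rint_cst => //; exact: probability_lty.
split; first exact: rint_mul_increment.
by rewrite /Rintegral integral_mul_increment.
Qed.

Section ito.
Context (t s : R) (t0 : 0 <= t) (ts : t <= s) (sT : s <= T).

Lemma sp_time_le (Hn : simple_process F t s) a b :
  (a <= b)%N -> (b <= sp_size Hn)%N -> sp_time Hn a <= sp_time Hn b.
Proof.
elim: b => [|b IHb]; first by rewrite leqn0 => /eqP ->.
rewrite leq_eqVlt => /predU1P[->//|]; rewrite ltnS => ab bs.
by apply: le_trans (IHb ab (ltnW bs)) _; exact: sp_time_mono.
Qed.

Lemma sp_time_itv (Hn : simple_process F t s) a : (a <= sp_size Hn)%N ->
  t <= sp_time Hn a <= s.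
Proof.
move=> an; apply/andP; split.
  by rewrite -[leLHS](sp_time0 Hn) sp_time_le.
by rewrite -[leRHS](sp_time_last Hn) sp_time_le.
Qed.

Lemma sp_time_domain (Hn : simple_process F t s) a : (a <= sp_size Hn)%N ->
  sp_time Hn a \in `[0, T].
Proof.
move=> /(sp_time_itv) /andP[ta as_]; rewrite in_itv/=.
by rewrite (le_trans t0 ta) (le_trans as_).
Qed.

Lemma measurable_sp_val (Hn : simple_process F t s) a : (a < sp_size Hn)%N ->
  measurable_fun setT (sp_val Hn a).
Proof.
move=> an; apply: (measurable_wrt_fun (sp_time_domain (ltnW an))).
exact: sp_val_adapted.
Qed.

Lemma zero_mean_simple_integral (W : R -> Omega -> R) (Hn : simple_process F t s) :
  brownian_wrt W -> zero_mean (simple_integral W Hn).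
Proof.
move=> hW; apply: (zero_mean_sum (f := fun k w =>
  sp_val Hn k w * (W (sp_time Hn k.+1) w - W (sp_time Hn k) w))) => k kn.
have := sp_time_domain (ltnW kn); have := sp_time_domain kn.
rewrite !in_itv/= => /andP[_ k1T] /andP[k0 _].
have mk := sp_val_adapted kn.
apply: zero_mean_increment => //; first exact: sp_time_mono.
have [C HC] := sp_val_bounded kn.
apply: (rint_le measurableT (cst C)).
- exact: measurable_sp_val.
- by apply: rint_cst => //; exact: probability_lty.
- by move=> w _; exact: HC.
Qed.

Lemma cvg_0_lt (a : nat -> \bar R) e : a @ \oo --> 0%E -> 0 < e ->
  exists n, (a n < e%:E)%E.
Proof.
move=> /fine_cvgP[afin a0] e0.
have : \forall n \near \oo, (a n < e%:E)%E.
  near=> n; have an : a n \is a fin_num by near: n.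
  rewrite -(fineK an) lte_fin; near: n.
  by apply: (cvgr_lt (0 : R)).
by move=> /filter_ex.
Unshelve. all: by end_near. Qed.

(* An L^2 limit of elementary integrals is an L^1 limit, and zero mean passes to
   it. *)
Lemma ito_zero_mean (W : R -> Omega -> R) H (J : Omega -> R) : brownian_wrt W ->
  is_ito P F W t s H J -> zero_mean J.
Proof.
move=> hW [_ mJ [Hn [_ cJ]]].
have S0 n := zero_mean_simple_integral (Hn n) hW.
pose S n := simple_integral W (Hn n).
have key e : 0 < e -> exists2 f, zero_mean f &
    [/\ rint (fun w => J w - f w) & \int[P]_w `|J w - f w| <= e].
  move=> e0.
  have [n an] := cvg_0_lt cJ (mulr_gt0 e0 e0).
  have [iS _] := S0 n; exists (S n); first exact: S0.
  have mD : measurable_fun setT (fun w => J w - S n w).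
    by apply: measurable_funB => //; exact: rint_measurable iS.
  have sD : sqint P setT (fun w => J w - S n w).
    by apply: sqint_lty => //; apply: (lt_trans an); exact: ltry.
  have iD : rint (fun w => J w - S n w).
    by apply: sqint_rint sD => //; exact: probability_lty.
  split=> //.
  have iD2 := sD.2.
  (* Young's inequality |z| <= e / 2 + z^2 / (2 e). As the integral of z^2 is below e^2, the two
     terms contribute e / 2 each. *)
  apply: (@le_trans _ _ (\int[P]_w (e / 2 + (e * 2)^-1 * (J w - S n w) ^+ 2))).
    apply: le_Rintegral => //; first exact: rint_norm.
      apply: rintD => //; last exact: rintZ.
      by apply: (rint_cst measurableT); exact: probability_lty.
    move=> w _; rewrite -(@ler_pM2r _ (e * 2)) ?mulr_gt0//.
    rewrite mulrDl [X in _ <= _ + X]mulrAC mulVf ?mul1r ?mulf_neq0 ?gt_eqF//.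
    rewrite -[X in _ <= _ + X]real_normK ?num_real//.
    move: (`|J w - S n w| : R) => z.
    have -> : e / 2 * (e * 2) = e ^+ 2 by field.
    by have := sqr_ge0 (z - e); nra.
  rewrite RintegralDf//; last exact: rintZ; last first.
    by apply: (rint_cst measurableT); exact: probability_lty.
  rewrite Rintegral_cst_prob RintegralZl//.
  have : \int[P]_w (J w - S n w) ^+ 2 <= e * e.
    by rewrite -lee_fin /Rintegral fineK; [exact: ltW|exact: integrable_fin_num].
  move=> H2; have : (e * 2)^-1 * \int[P]_w (J w - S n w) ^+ 2 <= (e * 2)^-1 * (e * e).
    by rewrite ler_wpM2l// invr_ge0 mulr_ge0// ltW.
  have -> : (e * 2)^-1 * (e * e) = e / 2 by field; rewrite gt_eqF.
  by lra.
have iJ : rint J.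
  have [f [fi _] [iJf _]] := key 1 ltr01.
  apply: rint_eq (rintD measurableT iJf fi) => // w _.
  by rewrite subrK.
split=> //; apply/eqP; rewrite -normr_eq0; apply/eqP/le_anti.
rewrite normr_ge0 andbT; apply/ler_addgt0Pr => e e0; rewrite add0r.
have [f [fi f0] [iJf He]] := key e e0.
have -> : \int[P]_w J w = \int[P]_w (J w - f w).
  by rewrite RintegralB// f0 subr0.
by apply: le_trans He; exact: le_normr_Rintegral.
Qed.

Lemma measurable_simple_eval (Hn : simple_process F t s) :
  measurable_fun setT (fun z : measurableTypeR R * Omega => simple_eval Hn z.1 z.2).
Proof.
rewrite /simple_eval; apply: measurable_sum => k.
apply: measurable_funM.
  by apply: (measurableT_comp (measurable_sp_val (ltn_ord k))).
have m1 : measurable_fun [set: measurableTypeR R]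
    (\1_(`]sp_time Hn k, sp_time Hn k.+1]%classic : set R) : measurableTypeR R -> R).
  exact: measurable_indic.
exact: (measurableT_comp m1 measurable_fst).
Qed.

Lemma simple_eval_bounded (Hn : simple_process F t s) :
  exists C : R, forall u w, `|simple_eval Hn u w| <= C.
Proof.
rewrite /simple_eval.
have H n : (n <= sp_size Hn)%N -> exists C : R, forall u w,
    `|\sum_(k < n) sp_val Hn k w * \1_(`]sp_time Hn k, sp_time Hn k.+1]%classic) u| <= C.
  elim: n => [_|n IHn nH].
    by exists 0 => u w; rewrite big_ord0 normr0.
  have [C HC] := IHn (ltnW nH); have [C' HC'] := sp_val_bounded nH.
  exists (C + C') => u w; rewrite big_ord_recr/=.
  apply: (le_trans (ler_normD _ _)); apply: lerD => //.
  rewrite normrM indicE; apply: le_trans (HC' w).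
  by case: (_ \in _) => /=; rewrite ?normr1 ?mulr1 ?normr0 ?mulr0.
exact: H.
Qed.

(** Processes are jointly measurable on [t, s] x Omega only; extended by 0 in time they become
    measurable on the whole product, where Tonelli and Fubini apply. *)
Lemma measurable_patch (H : R -> Omega -> R) :
  measurable_fun (`[t, s] `*` [set: Omega])
    (fun z : measurableTypeR R * Omega => H z.1 z.2) ->
  measurable_fun setT
    (fun z : measurableTypeR R * Omega => ((H ^~ z.2) \_ `[t, s]) z.1).
Proof.
move=> mH.
have mD : measurable (`[t, s]%classic `*` [set: Omega] : set (measurableTypeR R * Omega)).
  exact: measurableX.
have /(measurable_restrictT _ mD) := mH.
apply: eq_measurable_fun => z _; rewrite !patchE.
congr (if _ then _ else _); apply/idP/idP; rewrite !inE/=; first by case.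
by split.
Qed.

Lemma measurable_path (H : R -> Omega -> R) w :
  measurable_fun (`[t, s] `*` [set: Omega])
    (fun z : measurableTypeR R * Omega => H z.1 z.2) ->
  measurable_fun (`[t, s]%classic : set (measurableTypeR R)) (H ^~ w).
Proof.
move=> /measurable_patch mH; apply/(measurable_restrictT _ _) => //.
exact: (measurableT_comp mH (pair2_measurable w)).
Qed.

(** Some approximating simple process is at finite L^2 distance from H, so by Tonelli almost every
    path of the difference is square integrable, and the paths of a simple process are bounded. This
    makes the drift containing the other agent's mean pathwise integrable, hence additive. *)
Lemma ito_integrable_path (W H : R -> Omega -> R) : ito_integrable P F W t s H ->
  {ae P, forall w, sqint (@lebesgue_measure R) `[t, s] (H ^~ w)}.
Proof.
move=> [J [[mH _] mJ [Hn [cH _]]]].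
have [n Hfin] := cvg_0_lt cH ltr01.
have mS := measurable_simple_eval (Hn n).
pose f (z : measurableTypeR R * Omega) : \bar R :=
  (((fun u => (H u z.2 - simple_eval (Hn n) u z.2) ^+ 2) \_ `[t, s]) z.1)%:E.
have mf : measurable_fun setT f.
  apply/measurable_EFinP.
  apply: (measurable_patch (H := fun u w => (H u w - simple_eval (Hn n) u w) ^+ 2)).
  apply: measurable_funX; apply: measurable_funB => //.
  exact: measurable_funTS.
have f0 z : (0 <= f z)%E.
  by rewrite lee_fin patchE; case: ifP => // _; rewrite sqr_ge0.
have mG := measurable_fun_fubini_tonelli_G (m1 := lebesgue_measure) _ mf f0.
have GE w : fubini_G (@lebesgue_measure R) f w =
    (\int[lebesgue_measure]_(u in `[t, s]) ((H u w - simple_eval (Hn n) u w) ^+ 2)%:E)%E.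
  rewrite /fubini_G [RHS]integral_mkcond; apply: eq_integral => u _.
  by rewrite /f/= !patchE; case: ifP.
have iG : P.-integrable setT (fubini_G (@lebesgue_measure R) f).
  apply/integrableP; split => //.
  under eq_integral => w _.
    rewrite gee0_abs; last by apply: integral_ge0 => u _; exact: f0.
    rewrite GE; over.
  by apply: lt_trans Hfin _; rewrite ltry.
have := integrable_ae measurableT iG.
apply: filterS => w /(_ Logic.I); rewrite GE => Gfin.
have mHw := measurable_path w mH.
have mSw : measurable_fun (`[t, s]%classic : set (measurableTypeR R)) (simple_eval (Hn n) ^~ w).
  by apply: measurable_path; exact: measurable_funTS.
have lebts : (lebesgue_measure (`[t, s]%classic : set R) < +oo)%E.
  by rewrite lebesgue_measure_itv/=; case: ifP => _; rewrite ?ltry// -EFinD ltry.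
have sD : sqint (@lebesgue_measure R) `[t, s] (fun u => H u w - simple_eval (Hn n) u w).
  apply: sqint_lty => //; first exact: measurable_funB.
  by move: Gfin; rewrite fin_numElt => /andP[].
have [C HC] := simple_eval_bounded (Hn n).
have sS : sqint (@lebesgue_measure R) `[t, s] (simple_eval (Hn n) ^~ w).
  split => //; apply: (rint_le _ (cst (C ^+ 2))) => //.
  - exact: measurable_funX.
  - exact: rint_cst.
  - move=> u _ /=; rewrite ger0_norm ?sqr_ge0// -real_normK ?num_real//.
    by rewrite lerXn2r ?nnegrE// (le_trans _ (HC u w)).
have := sqintD _ sD sS => /(_ (measurable_itv _)).
by rewrite (_ : (fun u => _) = H ^~ w)//; apply/funext => u; rewrite subrK.
Qed.

End ito.
End brownian_increments.

(** * One-variable calculus on a closed interval *)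

Section one_variable.
Context {R : realType}.
Implicit Types (f g df dg y : R -> R) (a b c t T l : R).
Local Notation mu := (@lebesgue_measure R).

(** A derivative inside and continuity up to the ends is what the mean value theorem and the
    fundamental theorem ask for. The derivative is an explicit parameter, so that product rules can
    be simplified by [ring] afterwards. *)
Definition C1oo f df a b : Prop :=
  (forall x, x \in `]a, b[ -> is_derive x (1 : R) f (df x)) /\
  {within `[a, b], continuous f}.

Lemma C1oo_LRcontinuous f df a b : a < b -> C1oo f df a b ->
  derivable_oo_LRcontinuous f a b /\ {in `]a, b[, derive1 f =1 df}.
Proof.
move=> ab [fd cf]; have [_ fa fb] := (continuous_within_itvP f ab).1 cf.
split; last by move=> x xab; have := fd x xab => fdx; rewrite derive1E derive_val.
by split=> // x xab; have := fd x xab => fdx; exact: ex_derive.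
Qed.

Lemma C1ooW f df a b a' b' : a <= a' -> b' <= b -> C1oo f df a b -> C1oo f df a' b'.
Proof.
move=> aa bb [fd cf]; split.
  move=> x; rewrite in_itv/= => /andP[ax xb]; apply: fd.
  by rewrite in_itv/= (le_lt_trans aa)// (lt_le_trans xb).
by apply: continuous_subspaceW cf; apply: subset_itv; rewrite bnd_simp.
Qed.

Lemma C1oo_eq f df dg a b : (forall x, a < x < b -> df x = dg x) ->
  C1oo f df a b -> C1oo f dg a b.
Proof.
move=> e [fd cf]; split=> // x xab; rewrite -e; last by move: xab; rewrite in_itv.
exact: fd.
Qed.

Lemma C1ooM f df g dg a b : C1oo f df a b -> C1oo g dg a b ->
  C1oo (fun x => f x * g x) (fun x => f x * dg x + g x * df x) a b.
Proof.
move=> [fd cf] [gd cg]; split=> [x xab|x].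
  by have := is_deriveM (fd x xab) (gd x xab).
by apply: cvgM; [exact: cf|exact: cg].
Qed.

Lemma C1ooD f df g dg a b : C1oo f df a b -> C1oo g dg a b ->
  C1oo (fun x => f x + g x) (fun x => df x + dg x) a b.
Proof.
move=> [fd cf] [gd cg]; split=> [x xab|x].
  by have := is_deriveD (fd x xab) (gd x xab).
by apply: cvgD; [exact: cf|exact: cg].
Qed.

Lemma C1ooZ k f df a b : C1oo f df a b ->
  C1oo (fun x => k * f x) (fun x => k * df x) a b.
Proof.
move=> [fd cf]; split=> [x xab|x].
  by have := is_deriveZ k (fd x xab).
by apply: cvgM; [exact: cvg_cst|exact: cf].
Qed.

Lemma C1ooB f df g dg a b : C1oo f df a b -> C1oo g dg a b ->
  C1oo (fun x => f x - g x) (fun x => df x - dg x) a b.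
Proof.
move=> fd /(C1ooZ (-1)) gd; have [hd ch] := C1ooD fd gd.
split=> [x xab|x].
  have := hd x xab; rewrite mulN1r.
  by rewrite (_ : (fun x => f x + -1 * g x) = (fun x => f x - g x))//; apply/funext => z; rewrite mulN1r.
have := ch x.
by rewrite (_ : (fun x => f x + -1 * g x) = (fun x => f x - g x))//; apply/funext => z; rewrite mulN1r.
Qed.

Lemma C1oo_const_eq f df a b : a <= b -> C1oo f df a b ->
  (forall x, a < x < b -> df x = 0) -> f b = f a.
Proof.
move=> ab fC df0; have [fd cf] := C1oo_eq df0 fC.
have [c _ E] := MVT_segment ab fd cf.
by apply/eqP; rewrite -subr_eq0 E mul0r.
Qed.

Lemma C1oo_ge f df a b : a <= b -> C1oo f df a b ->
  (forall x, a < x < b -> df x <= 0) -> f b <= f a.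
Proof.
rewrite le_eqVlt => /predU1P[->//|ab] [fd cf] df0.
have [c] := MVT ab fd cf; rewrite in_itv/= => /df0 dc0 E.
by rewrite -subr_le0 E mulr_le0_ge0// subr_ge0 ltW.
Qed.

Lemma C1oo_integral f df a b : a <= b -> C1oo f df a b ->
  {within `[a, b], continuous df} ->
  \int[mu]_(x in `[a, b]) df x = f b - f a.
Proof.
rewrite le_eqVlt => /predU1P[<- _ _|ab fC cdf].
  by rewrite set_itv1 Rintegral_set1 subrr.
have [fLR fd] := C1oo_LRcontinuous ab fC.
by rewrite /Rintegral (continuous_FTC2 ab cdf fLR fd).
Qed.

Lemma C1oo_primitive y a b : a <= b -> {within `[a, b], continuous y} ->
  C1oo (fun x => \int[mu]_(u in `[a, x]) y u) y a b.
Proof.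
rewrite le_eqVlt => /predU1P[<- _|ab cy].
  split; last by rewrite set_itv1; exact: continuous_subspace1.
  by move=> x; rewrite in_itv/= => /andP[/lt_trans/[apply]]; rewrite ltxx.
have iy := continuous_integrable_cc cy.
split; last exact: parameterized_integral_continuous (ltW ab) iy.
have [cyoo _ _] := (continuous_within_itvP y ab).1 cy.
move=> x xab; have := cyoo x xab.
move: xab; rewrite in_itv/= => /andP[ax xb] cx.
have [dx dE] := continuous_FTC1_closed xb iy ax cx.
have E : 'D_1 (fun x0 : R => \int[mu]_(u in `[a, x0]) y u) x = y x.
  by rewrite -derive1E; exact: dE.
exact: (DeriveDef dx E).
Qed.

Lemma near_within_dnbhs (D : set R) t (Q : R -> Prop) :
  (\forall s \near within D t^', Q s) <->
  (\forall s \near t, s != t -> D s -> Q s).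
Proof. by split. Qed.

Lemma is_derive_slope f t l : is_derive t (1 : R) f l ->
  (f s - f t) / (s - t) @[s --> t^'] --> l.
Proof.
move=> [fd fl].
have H : h^-1 *: (f (h *: (1 : R) + t) - f t) @[h --> 0^'] --> l.
  by rewrite -fl; exact: fd.
have S : (s - t) @[s --> t^'] --> (0 : R)^'.
  move=> U U0.
  have C : (s - t) @[s --> t] --> (0 : R).
    rewrite -(subrr t); apply: cvgB; [exact: cvg_id|exact: cvg_cst].
  have V : \forall s \near t, s - t != 0 -> U (s - t) by exact: C _ U0.
  have V' : \forall s \near t, s != t -> U (s - t).
    by apply: filterS V => s H1 st; apply: H1; rewrite subr_eq0.
  exact: V'.
have := cvg_comp _ _ S H.
apply: cvg_trans; apply: near_eq_cvg; near=> s => /=.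
by rewrite /GRing.scale/= mulr1 subrK mulrC.
Unshelve. all: by end_near. Qed.

Lemma is_tderiv_derive T f g t l : (forall s, s \in `[0, T] -> f s = g s) ->
  t \in `[0, T] -> is_derive t (1 : R) g l -> is_tderiv T f t l.
Proof.
move=> fg tT /is_derive_slope H; rewrite /is_tderiv.
have H2 : (g s - g t) / (s - t) @[s --> within `[0, T] t^'] --> l.
  by apply: cvg_trans H; apply: cvg_app; exact: cvg_within.
apply: cvg_trans H2; apply: near_eq_cvg.
apply/near_within_dnbhs; near=> s => _ sT.
by rewrite !fg.
Unshelve. all: by end_near. Qed.

Lemma is_tderiv_is_derive T f t l : 0 < t < T -> is_tderiv T f t l ->
  is_derive t (1 : R) f l.
Proof.
move=> /andP[t0 tT]; rewrite /is_tderiv => H.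
have S : (h + t) @[h --> (0 : R)^'] --> within `[0, T] t^'.
  move=> U Ut.
  have C : (h + t) @[h --> (0 : R)] --> t.
    rewrite -[X in _ --> X]add0r; apply: cvgD; [exact: cvg_id|exact: cvg_cst].
  have Ht : \forall x \near t, x != t -> U x.
    have Ut' : \forall s \near t, s != t -> `[0, T]%classic s -> U s by exact: Ut.
    near=> x => xt; have : x != t -> `[0, T]%classic x -> U x by near: x.
    apply=> //=; rewrite in_itv/=; apply/andP; split; apply: ltW.
      by near: x; exact: lt_nbhsr.
    by near: x; exact: lt_nbhsl.
  have V : \forall h \near (0 : R), h + t != t -> U (h + t) by exact: C _ Ht.
  have V' : \forall h \near (0 : R), h != 0 -> U (h + t).
    by apply: filterS V => h H1 h0; apply: H1; rewrite -subr_eq0 addrK.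
  exact: V'.
have K : h^-1 *: (f (h *: (1 : R) + t) - f t) @[h --> 0^'] --> l.
  have := cvg_comp _ _ S H.
  apply: cvg_trans; apply: near_eq_cvg; near=> h => /=.
  by rewrite /GRing.scale/= mulr1 addrK mulrC.
apply: DeriveDef; first by apply/cvg_ex; exists l.
by apply/cvg_lim.
Unshelve. all: by end_near. Qed.

Lemma is_tderiv_cvg T f t l : is_tderiv T f t l ->
  f s @[s --> within `[0, T] t^'] --> f t.
Proof.
rewrite /is_tderiv => H.
have S : (s - t) @[s --> within `[0, T] t^'] --> (0 : R).
  have C : (s - t) @[s --> t] --> (0 : R).
    rewrite -(subrr t); apply: cvgB; [exact: cvg_id|exact: cvg_cst].
  apply: cvg_trans C; apply: cvg_app.
  apply: (@cvg_trans _ t^'); first exact: cvg_within.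
  exact: cvg_within.
have K : (f s - f t) / (s - t) * (s - t) + f t @[s --> within `[0, T] t^'] --> f t.
  rewrite -[X in _ --> X]add0r -[X in _ --> X + _](mulr0 l).
  by apply: cvgD; [exact: cvgM|exact: cvg_cst].
apply: cvg_trans K; apply: near_eq_cvg.
apply/near_within_dnbhs; near=> s => st _.
by rewrite divfK ?subrK// subr_eq0.
Unshelve. all: by end_near. Qed.

Lemma is_tderiv_C1oo T f df : 0 < T ->
  (forall t, t \in `[0, T] -> is_tderiv T f t (df t)) -> C1oo f df 0 T.
Proof.
move=> T0 fd; split.
  move=> x; rewrite in_itv/= => /[dup] /andP[x0 xT] x0T.
  by apply: is_tderiv_is_derive x0T (fd _ _); rewrite in_itv/= !ltW.
apply/(continuous_within_itvP _ T0); split.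
- move=> x; rewrite in_itv/= => /[dup] /andP[x0 xT] x0T.
  apply: differentiable_continuous; apply/derivable1_diffP.
  have := is_tderiv_is_derive x0T (fd _ _); rewrite in_itv/= !ltW// => /(_ isT) ?.
  exact: ex_derive.
- have := is_tderiv_cvg (fd 0 _); rewrite in_itv/= lexx ltW// => /(_ isT).
  apply: cvg_trans; apply: cvg_app => U UH.
  have H : \forall s \near (0 : R), s != 0 -> `[0, T]%classic s -> U s by exact: UH.
  have V : \forall s \near (0 : R), 0 < s -> U s.
    near=> s => s0.
    have sT : s < T by near: s; exact: lt_nbhsl.
    have : s != 0 -> `[0, T]%classic s -> U s by near: s.
    by apply; rewrite ?gt_eqF//= in_itv/= !ltW.
  exact: V.
- have := is_tderiv_cvg (fd T _); rewrite in_itv/= lexx ltW// => /(_ isT).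
  apply: cvg_trans; apply: cvg_app => U UH.
  have H : \forall s \near T, s != T -> `[0, T]%classic s -> U s by exact: UH.
  have V : \forall s \near T, s < T -> U s.
    near=> s => sT.
    have s0 : 0 < s by near: s; exact: lt_nbhsr.
    have : s != T -> `[0, T]%classic s -> U s by near: s.
    by apply; rewrite ?lt_eqF//= in_itv/= !ltW.
  exact: V.
Unshelve. all: by end_near. Qed.

End one_variable.

(** * The backward linear recursion and its limit *)

Lemma is_derive_expRM {R : realType} (k t : R) :
  is_derive t (1 : R) (fun t => expR (k * t)) (expR (k * t) * k).
Proof.
have H : is_derive t (1 : R) (fun t : R => k * t) (k *: (1 : R)).
  exact: is_deriveZ.
rewrite /GRing.scale/= mulr1 in H.
exact: (@is_derive1_comp R expR (fun t => k * t) t _ _ (is_derive_expR _) H).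
Qed.

Section clamp.
Context {R : realType} (T : R) (T0 : 0 < T).

Definition clamp (t : R) : R := Order.max 0 (Order.min t T).

Lemma clamp_itv t : 0 <= clamp t <= T.
Proof. by rewrite /clamp le_max lexx/= ge_max ge_min lexx orbT ltW. Qed.

Lemma clamp_id t : t \in `[0, T] -> clamp t = t.
Proof. by rewrite in_itv/= /clamp => /andP[t0 tT]; rewrite min_l// max_r. Qed.

Lemma clamp_dist s t : `|clamp s - clamp t| <= `|s - t|.
Proof.
rewrite /clamp.
have H1 := ler_norm (s - t); have := ler_norm (- (s - t)); rewrite normrN => H2.
by case: (leP s T) => ?; case: (leP t T) => ?; rewrite ?maxEle;
  do ?[case: ifPn; rewrite -?ltNge => ?]; rewrite ler_norml; apply/andP; split; lra.
Qed.

Lemma clamp_continuous : continuous clamp.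
Proof.
move=> t; apply/cvgrPdist_lt => e e0; near=> s.
apply: (le_lt_trans (clamp_dist _ _)).
by near: s; apply/nbhs_ballP; exists e.
Unshelve. all: by end_near. Qed.

Lemma continuous_comp_clamp (f : R -> R) : {within `[0, T], continuous f} ->
  continuous (f \o clamp).
Proof.
move=> /subspace_continuousP cf t.
have ct : `[0, T]%classic (clamp t) by rewrite /= in_itv/=; exact: clamp_itv.
have S : clamp s @[s --> t] --> within `[0, T] (nbhs (clamp t)).
  move=> U HU; have HU' : \forall x \near clamp t, `[0, T]%classic x -> U x by exact: HU.
  have V : \forall s \near t, `[0, T]%classic (clamp s) -> U (clamp s).
    exact: (clamp_continuous HU').
  have V' : \forall s \near t, U (clamp s).
    by apply: filterS V => s; apply; rewrite /= in_itv/=; exact: clamp_itv.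
  exact: V'.
exact: (cvg_comp _ _ S (cf _ ct)).
Qed.

(** Variation of constants for f' = c f + r with f T = 0: on [0, T] it equals minus the integral
    over [t, T] of e^{c (t - u)} r u. The lower limit -1 makes 0 an interior point for the
    fundamental theorem; [clamp] makes the result continuous on the whole line, as the next
    iteration requires. *)
Definition bwd (c : R) (r : R -> R) (t : R) : R :=
  expR (c * clamp t) *
  (\int[lebesgue_measure]_(u in `[- 1, clamp t]) (expR (- c * u) * r u)
   - \int[lebesgue_measure]_(u in `[- 1, T]) (expR (- c * u) * r u)).

Section bwd.
Context (c : R) (r : R -> R) (cr : continuous r).
Let g u := expR (- c * u) * r u.
Let f t := expR (c * t) * (\int[lebesgue_measure]_(u in `[- 1, t]) g u
   - \int[lebesgue_measure]_(u in `[- 1, T]) g u).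

Let cg : continuous g.
Proof.
move=> u; apply: cvgM; last exact: cr.
apply: (cvg_comp (fun u => - c * u) expR); last exact: continuous_expR.
by apply: cvgM; [exact: cvg_cst|exact: cvg_id].
Qed.

Let f_derive (t : R) : - 1 < t -> is_derive t (1 : R) f (c * f t + r t).
Proof.
move=> t1.
have tt : t < t + 1 by rewrite ltrDl.
have ig : lebesgue_measure.-integrable `[- 1, t + 1] (EFin \o g).
  by apply: continuous_integrable_cc; exact: continuous_subspaceT.
have cgt : {for t, continuous g} by exact: cg.
have [dG G'] := continuous_FTC1_closed tt ig t1 cgt.
have dG' : is_derive t (1 : R)
  (fun x => \int[lebesgue_measure]_(u in `[- 1, x]) g u) (g t).
  by rewrite derive1E in G'; exact: (DeriveDef dG G').
set K := \int[lebesgue_measure]_(u in `[- 1, T]) g u.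
have dGK : is_derive t (1 : R)
  (fun x => \int[lebesgue_measure]_(u in `[- 1, x]) g u - K) (g t).
  have := is_deriveB dG' (is_derive_cst K t 1).
  by rewrite subr0.
have := is_deriveM (is_derive_expRM c t) dGK.
congr (is_derive _ _ _ _); rewrite /f /g /GRing.scale/=.
have -> : expR (c * t) * (expR (- c * t) * r t) = r t.
  by rewrite mulrA -expRD -mulrDl subrr mul0r expR0 mul1r.
rewrite /K /g; set A := Rintegral _ _ _; set B := Rintegral _ _ _.
by ring.
Qed.

Lemma bwd_continuous : continuous (bwd c r).
Proof.
move=> t; have C : {for clamp t, continuous f}.
  apply: differentiable_continuous; apply/derivable1_diffP.
  have /andP[ct _] := clamp_itv t.
  have := f_derive (lt_le_trans (ltrN10 R) ct) => H.
  exact: ex_derive.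
exact: (continuous_comp (clamp_continuous (x:=t)) C).
Qed.

Lemma bwdT : bwd c r T = 0.
Proof.
by rewrite /bwd clamp_id ?subrr ?mulr0// in_itv/= lexx ltW.
Qed.

Lemma bwd_tderiv t : t \in `[0, T] ->
  is_tderiv T (bwd c r) t (c * bwd c r t + r t).
Proof.
move=> tT.
have bf s : s \in `[0, T] -> bwd c r s = f s by move=> sT; rewrite /bwd clamp_id.
apply: (is_tderiv_derive bf tT); rewrite bf//; apply: f_derive.
by move: tT; rewrite in_itv/= => /andP[t0 _]; apply: lt_le_trans t0; exact: ltrN10.
Qed.

End bwd.

Lemma C1oo_expR (k a b : R) :
  C1oo (fun t => expR (k * t)) (fun t => expR (k * t) * k) a b.
Proof.
split=> [x _|]; first exact: is_derive_expRM.
apply: continuous_subspaceT => x.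
apply: differentiable_continuous; apply/derivable1_diffP.
have := is_derive_expRM k x => ?; exact: ex_derive.
Qed.

(* Compares f with the supersolutions A e^{L (T - t)} and - A e^{L (T - t)}. *)
Lemma backward_comparison (c A L : R) (f r : R -> R) :
  0 < L -> 0 <= A -> 0 <= c ->
  C1oo f (fun t => c * f t + r t) 0 T -> f T = 0 ->
  (forall t, 0 <= t <= T -> `|r t| <= A * L * expR (L * (T - t))) ->
  forall t, 0 <= t <= T -> `|f t| <= A * expR (L * (T - t)).
Proof.
move=> L0 A0 c0 fC fT rb t /andP[t0 tT].
have key (e : R) : e = 1 \/ e = -1 -> 0 <= A * expR (L * (T - t)) + e * f t.
  move=> e1.
  have EL (x : R) : expR (L * (T - x)) = expR (L * T) * expR (- L * x).
    by rewrite -expRD; congr expR; ring.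
  (* The sum of the barrier and of e f, with e = 1 or -1, is multiplied by e^{- c t}: the term c f
     disappears and the product is nonincreasing, so its nonnegative value at T bounds it below at
     t. *)
  have C1 := C1ooM (C1oo_expR (- c) t T)
    (C1ooD (C1ooZ (A * expR (L * T)) (C1oo_expR (- L) t T))
           (C1ooZ e (C1ooW t0 (lexx T) fC))).
  have := C1oo_ge tT C1.
  rewrite fT mulr0 addr0 => H.
  have {H} : expR (- c * T) * (A * expR (L * T) * expR (- L * T)) <=
    expR (- c * t) * (A * expR (L * T) * expR (- L * t) + e * f t).
    apply: H => x /andP[tx xT].
    have x0T : 0 <= x <= T by rewrite (le_trans t0 (ltW tx)) ltW.
    have := rb _ x0T; rewrite EL => rx.
    have -> : expR (- c * x) * (A * expR (L * T) * (expR (- L * x) * - L) +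
        e * (c * f x + r x)) +
      (A * expR (L * T) * expR (- L * x) + e * f x) * (expR (- c * x) * - c) =
      expR (- c * x) * (e * r x - A * L * (expR (L * T) * expR (- L * x))
        - c * (A * (expR (L * T) * expR (- L * x)))) by ring.
    rewrite pmulr_rle0 ?expR_gt0//.
    have cA : 0 <= c * (A * (expR (L * T) * expR (- L * x))).
      by rewrite !mulr_ge0 ?expR_ge0.
    have er : e * r x <= `|r x|.
      by case: e1 => ->; [rewrite mul1r ler_norm|rewrite mulN1r -normrN ler_norm].
    by lra.
  rewrite EL (mulrA A) => H.
  have {H} : 0 <= expR (- c * t) * (A * expR (L * T) * expR (- L * t) + e * f t).
    by apply: le_trans H; rewrite !mulr_ge0 ?expR_ge0.
  by rewrite pmulr_rge0 ?expR_gt0.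
have k1 := key 1 (or_introl erefl); have k2 := key (-1) (or_intror erefl).
by rewrite ler_norml; apply/andP; split; lra.
Qed.

End clamp.

Section bwd_sequence.
Context {R : realType} (T iota rv gamma ybar : R) (a10 a20 : R -> R).
Context (T0 : 0 < T) (iota0 : 0 < iota) (rv0 : 0 <= rv) (gamma0 : 0 < gamma)
  (ybar0 : 0 < ybar).
Context (ca1 : {within `[0, T], continuous a10})
  (ca2 : {within `[0, T], continuous a20}).

(* Composing with [clamp T] makes the initial data continuous on the whole line
   without changing them on [0, T]. *)
Fixpoint a2seq (n : nat) : R -> R :=
  if n is m.+1 then bwd T (2 * iota) (fun t => 2 * rv * a2seq m t - 2 / gamma)
  else a20 \o clamp T.

Fixpoint a1seq (n : nat) : R -> R :=
  if n is m.+1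
  then bwd T iota (fun t => rv * a1seq m t - iota * ybar * a2seq m.+1 t)
  else a10 \o clamp T.

Lemma a2seq_continuous n : continuous (a2seq n).
Proof.
elim: n => [|n IHn]; first exact: continuous_comp_clamp.
apply: bwd_continuous => // t.
apply: cvgB; last exact: cvg_cst.
by apply: cvgM; [exact: cvg_cst|exact: IHn].
Qed.

Lemma a1seq_continuous n : continuous (a1seq n).
Proof.
elim: n => [|n IHn]; first exact: continuous_comp_clamp.
apply: bwd_continuous => // t.
apply: cvgB; first by apply: cvgM; [exact: cvg_cst|exact: IHn].
by apply: cvgM; [exact: cvg_cst|exact: (@a2seq_continuous n.+1)].
Qed.

Lemma a2seq_tderiv n t : t \in `[0, T] ->
  is_tderiv T (a2seq n.+1) t
    (2 * iota * a2seq n.+1 t + (2 * rv * a2seq n t - 2 / gamma)).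
Proof.
apply: bwd_tderiv => // {}t; apply: cvgB; last exact: cvg_cst.
by apply: cvgM; [exact: cvg_cst|exact: a2seq_continuous].
Qed.

Lemma a1seq_tderiv n t : t \in `[0, T] ->
  is_tderiv T (a1seq n.+1) t
    (iota * a1seq n.+1 t + (rv * a1seq n t - iota * ybar * a2seq n.+1 t)).
Proof.
apply: bwd_tderiv => // {}t.
apply: cvgB; first by apply: cvgM; [exact: cvg_cst|exact: a1seq_continuous].
by apply: cvgM; [exact: cvg_cst|exact: (@a2seq_continuous n.+1)].
Qed.

Lemma a2seqT n : a2seq n.+1 T = 0.
Proof. exact: bwdT. Qed.

Lemma a1seqT n : a1seq n.+1 T = 0.
Proof. exact: bwdT. Qed.

Let kappa := iota + rv.
Let kappa0 : 0 < kappa.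
Proof. by rewrite ltr_wpDr. Qed.

Definition a2lim (t : R) : R := (gamma * kappa)^-1 * (1 - expR (- 2 * kappa * (T - t))).
Definition a1lim (t : R) : R :=
  iota * ybar / (gamma * kappa ^+ 2) * (1 - expR (- kappa * (T - t))) ^+ 2.

Lemma a2limT : a2lim T = 0.
Proof. by rewrite /a2lim subrr mulr0 expR0 subrr mulr0. Qed.

Lemma a1limT : a1lim T = 0.
Proof. by rewrite /a1lim subrr mulr0 expR0 subrr expr0n mulr0. Qed.

Let expR_lim k (t : R) : expR (- k * (T - t)) = expR (- k * T) * expR (k * t).
Proof. by rewrite -expRD; congr expR; ring. Qed.

Let C1oo_cst (c : R) : C1oo (fun=> c) (fun=> 0) 0 T.
Proof.
split=> [x _|]; first exact: is_derive_cst.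
by apply: continuous_subspaceT => x; exact: cvg_cst.
Qed.

Let C1oo_exp (k : R) : C1oo (fun t => 1 - expR (- k * (T - t)))
  (fun t => - (k * expR (- k * (T - t)))) 0 T.
Proof.
have := C1ooB (C1oo_cst 1) (C1ooZ (expR (- k * T)) (C1oo_expR k 0 T)).
rewrite (_ : (fun x => 1 - expR (- k * T) * expR (k * x)) = (fun t => 1 - expR (- k * (T - t)))); last first.
  by apply/funext => t; rewrite expR_lim.
by apply: C1oo_eq => x _; rewrite expR_lim; ring.
Qed.

(** [a2lim] and [a1lim] are fixed points of the recursion, solving the equations in which old and
    new iterate coincide; subtracting leaves sources made of errors only. *)
Lemma a2lim_C1 : C1oo a2lim (fun t => 2 * iota * a2lim t + (2 * rv * a2lim t - 2 / gamma)) 0 T.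
Proof.
have := C1ooZ (gamma * kappa)^-1 (C1oo_exp (2 * kappa)).
rewrite (_ : (fun x => _) = a2lim); last by apply/funext => t; rewrite /a2lim mulNr.
apply: C1oo_eq => x _; rewrite /a2lim (mulNr 2 kappa).
move: (expR _) => E; rewrite /kappa; field.
by rewrite -/kappa !gt_eqF.
Qed.

Lemma a1lim_C1 : C1oo a1lim
  (fun t => iota * a1lim t + (rv * a1lim t - iota * ybar * a2lim t)) 0 T.
Proof.
have := C1ooZ (iota * ybar / (gamma * kappa ^+ 2)) (C1ooM (C1oo_exp kappa) (C1oo_exp kappa)).
rewrite (_ : (fun x => _ * ((1 - _) * (1 - _))) = a1lim); last first.
  by apply/funext => t; rewrite /a1lim expr2.
apply: C1oo_eq => x _; rewrite /a1lim /a2lim.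
have -> : expR (- 2 * kappa * (T - x)) = expR (- kappa * (T - x)) ^+ 2.
  by rewrite expr2 -expRD; congr expR; ring.
move: (expR _) => E; rewrite /kappa; field.
by rewrite -/kappa !gt_eqF.
Qed.

Lemma bounded_dist (f g : R -> R) : {within `[0, T], continuous f} ->
  {within `[0, T], continuous g} ->
  exists2 C : R, 0 <= C & forall t, 0 <= t <= T -> `|f t - g t| <= C.
Proof.
move=> cf cg.
have cd : {within `[0, T], continuous (fun t => `|f t - g t|)}.
  by move=> t; apply: cvg_norm; apply: cvgB; [exact: cf|exact: cg].
have [c _ H] := EVT_max (ltW T0) cd.
by exists `|f c - g c| => // t tT; apply: H; rewrite in_itv.
Qed.

(** If the stage n errors are at most q times the weight, halving requires 2 rv q <= (q / 2) L for
    a_2, and rv q + iota ybar q / 2 <= (q / 2) L for a_1; that is, L >= 4 rv and L >= 2 rv + iota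
    ybar. The 1 makes positivity immediate. *)
Let L := 4 * rv + iota * ybar + 1.

Let L0 : 0 < L.
Proof. by rewrite /L ltr_wpDl// !(addr_ge0, mulr_ge0)// ltW. Qed.

Lemma seq_geometric : exists2 C : R, 0 <= C & forall n t, 0 <= t <= T ->
  `|a2seq n t - a2lim t| <= C * 2 ^- n * expR (L * (T - t)) /\
  `|a1seq n t - a1lim t| <= C * 2 ^- n * expR (L * (T - t)).
Proof.
have iy0 := mulr_ge0 (ltW iota0) (ltW ybar0).
have [C2 C20 H2] := bounded_dist (continuous_subspaceT (@a2seq_continuous 0)) a2lim_C1.2.
have [C1 C10 H1] := bounded_dist (continuous_subspaceT (@a1seq_continuous 0)) a1lim_C1.2.
have C0 : 0 <= C1 + C2 by rewrite addr_ge0.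
exists (C1 + C2) => // n.
elim: n => [|n IHn] t tT.
  have E1 : 1 <= expR (L * (T - t)).
    by rewrite -expR0 ler_expR mulr_ge0 ?(ltW L0)// subr_ge0; case/andP: tT.
  rewrite expr0 invr1 mulr1; have := H2 t tT; have := H1 t tT.
  by move: (expR _) E1 => E E1 *; split; nra.
have q0 : 0 <= (C1 + C2) * 2 ^- n by rewrite mulr_ge0// invr_ge0 exprn_ge0.
have qS : (C1 + C2) * 2 ^- n.+1 = (C1 + C2) * 2 ^- n / 2.
  by rewrite exprS; field; rewrite expf_neq0.
(* Done before a_1, because the equation of the new a_1 contains the new a_2, whose error must
   already be halved. *)
have step2 : forall t, 0 <= t <= T ->
    `|a2seq n.+1 t - a2lim t| <= (C1 + C2) * 2 ^- n.+1 * expR (L * (T - t)).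
  rewrite qS; apply: (@backward_comparison _ _ (2 * iota) _ _ _
    (fun t => 2 * rv * (a2seq n t - a2lim t))) => //.
  - by rewrite divr_ge0.
  - by rewrite mulr_ge0// ltW.
  - have A := is_tderiv_C1oo T0 (@a2seq_tderiv n).
    by apply: C1oo_eq (C1ooB A a2lim_C1) => x _; ring.
  - by rewrite a2seqT a2limT subrr.
  - move=> x xT; have [IH _] := IHn x xT.
    rewrite normrM ger0_norm ?mulr_ge0//.
    have := expR_ge0 (L * (T - x)); move: (expR _) IH => E IH E0.
    have qE := mulr_ge0 q0 E0.
    move: (_ / _ : R) q0 IH qE => q q0 IH qE; rewrite /L.
    have := mulr_ge0 iy0 qE; have := mulr_ge0 rv0 qE.
    have : 2 * rv * `|a2seq n x - a2lim x| <= 2 * rv * (q * E).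
      by rewrite ler_wpM2l// mulr_ge0.
    by nra.
split; first exact: step2.
move: t tT; rewrite qS; apply: (@backward_comparison _ _ iota _ _ _
    (fun t => rv * (a1seq n t - a1lim t) - iota * ybar * (a2seq n.+1 t - a2lim t))) => //.
- by rewrite divr_ge0.
- by rewrite ltW.
- have A := is_tderiv_C1oo T0 (@a1seq_tderiv n).
  by apply: C1oo_eq (C1ooB A a1lim_C1) => x _; ring.
- by rewrite a1seqT a1limT subrr.
- move=> x xT; have [_ IH] := IHn x xT; have := step2 x xT; rewrite qS => IH2.
  apply: (le_trans (ler_normB _ _)).
  rewrite !normrM (ger0_norm rv0) (gtr0_norm iota0) (gtr0_norm ybar0).
  have := expR_ge0 (L * (T - x)); move: (expR _) IH IH2 => E IH IH2 E0.
  have qE := mulr_ge0 q0 E0.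
  move: (_ / 2 ^+ n : R) q0 IH IH2 qE => q q0 IH IH2 qE; rewrite /L.
  have := mulr_ge0 iy0 qE; have := mulr_ge0 rv0 qE.
  have := ler_wpM2l rv0 IH; have := ler_wpM2l iy0 IH2.
  by nra.
Qed.

Lemma uniform_cvg_geometric (f : nat -> R -> R) (g : R -> R) (C : R) : 0 <= C ->
  (forall n t, 0 <= t <= T -> `|f n t - g t| <= C * 2 ^- n) ->
  {uniform `[0, T], f @ \oo --> g}.
Proof.
move=> C0 H U /uniform_nbhs[E [entE EU]].
have [e e0 He] : exists2 e : R, 0 < e & forall x y : R, `|x - y| < e -> E (x, y).
  move: entE; rewrite -entourage_ballE => -[e /= e0 He]; exists e => // x y xy.
  exact: He.
have cv : C * 2 ^- n @[n --> \oo] --> (0 : R).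
  rewrite -[X in _ --> X](mulr0 C); apply: cvgM; first exact: cvg_cst.
  under eq_fun do rewrite -exprVn.
  by apply: cvg_expr; rewrite ger0_norm//; lra.
have V : \forall n \near \oo, C * 2 ^- n < e by exact: (cvgr_lt (0 : R)).
suff V' : \forall n \near \oo, U (f n) by exact: V'.
apply: filterS V => n Cn; apply: EU => t /=; rewrite in_itv/= => tT.
by apply: He; rewrite distrC; exact: le_lt_trans (H n t tT) Cn.
Qed.

Lemma seq_uniform_cvg :
  {uniform `[0, T], a1seq @ \oo --> a1lim} /\
  {uniform `[0, T], a2seq @ \oo --> a2lim}.
Proof.
have [C C0 H] := seq_geometric.
have CE0 : 0 <= C * expR (L * T) by rewrite mulr_ge0 ?expR_ge0.
(* The weight is at most e^{L T} on [0, T], so the weighted bound is a uniform one. *)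
have bnd n t : 0 <= t <= T ->
    C * 2 ^- n * expR (L * (T - t)) <= C * expR (L * T) * 2 ^- n.
  move=> /andP[t0 tT]; rewrite mulrAC ler_wpM2r ?invr_ge0 ?exprn_ge0//.
  rewrite ler_wpM2l// ler_expR ler_wpM2l ?(ltW L0)//; lra.
split; apply: (uniform_cvg_geometric CE0) => n t tT;
  by have [h2 h1] := H n t tT; apply: le_trans (bnd n t tT).
Qed.

End bwd_sequence.

(** * Pathwise identities for the Ornstein-Uhlenbeck equation *)

Section ornstein_uhlenbeck_path.
Context {R : realType} (t T iota : R) (tT : t <= T) (iota0 : 0 < iota).
Local Notation mu := (@lebesgue_measure R).
Local Notation cont f := {within `[t, T], continuous f}.

Lemma contM (f g : R -> R) : cont f -> cont g -> cont (fun x => f x * g x).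
Proof. by move=> cf cg x; apply: cvgM; [exact: cf|exact: cg]. Qed.

Lemma contD (f g : R -> R) : cont f -> cont g -> cont (fun x => f x + g x).
Proof. by move=> cf cg x; apply: cvgD; [exact: cf|exact: cg]. Qed.

Lemma contB (f g : R -> R) : cont f -> cont g -> cont (fun x => f x - g x).
Proof. by move=> cf cg x; apply: cvgB; [exact: cf|exact: cg]. Qed.

Lemma contN (f : R -> R) : cont f -> cont (fun x => - f x).
Proof. by move=> cf x; apply: cvgN; exact: cf. Qed.

Lemma cont_cst (k : R) : cont (fun=> k).
Proof. by apply: continuous_subspaceT => x; exact: cvg_cst. Qed.

Lemma cont_id : cont (fun x => x).
Proof. by apply: continuous_subspaceT => x; exact: cvg_id. Qed.

Lemma cont_rint (f : R -> R) : cont f -> mu.-integrable `[t, T] (EFin \o f).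
Proof. exact: continuous_integrable_cc. Qed.

Lemma C1oo_decay (k : R) : C1oo (fun u => expR (- k * (u - t)))
  (fun u => - k * expR (- k * (u - t))) t T.
Proof.
have E u : expR (- k * (u - t)) = expR (k * t) * expR (- k * u).
  by rewrite -expRD; congr expR; ring.
have := C1ooZ (expR (k * t)) (C1oo_expR (- k) t T).
rewrite (_ : (fun u => expR (k * t) * expR (- k * u)) =
  (fun u => expR (- k * (u - t)))); last by apply/funext => u; rewrite E.
by apply: C1oo_eq => u _; rewrite E; ring.
Qed.

(** Z is only continuous, so the argument bears on its primitive G, which satisfies G' = z0 - iota
    G: the function (G - z0 / iota) e^{iota (s - t)} has zero derivative, and Z is recovered from
    G. *)
Lemma linear_path_unique (Z : R -> R) (z0 : R) : cont Z ->
  (forall s, s \in `[t, T] -> Z s = z0 - iota * \int[mu]_(u in `[t, s]) Z u) ->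
  forall s, s \in `[t, T] -> Z s = z0 * expR (- iota * (s - t)).
Proof.
move=> cZ ZE s; rewrite in_itv/= => /andP[ts sT].
pose G x := \int[mu]_(u in `[t, x]) Z u.
have GC : C1oo G Z t T by exact: C1oo_primitive.
have GC' : C1oo G (fun u => z0 - iota * G u) t T.
  by apply: C1oo_eq GC => u /andP[tu uT]; rewrite ZE// in_itv/= !ltW.
have cstC : C1oo (fun=> z0 / iota) (fun=> 0) t T.
  by split=> [x _|]; [exact: is_derive_cst|exact: cont_cst].
have C := C1ooM (C1ooB GC' cstC) (C1oo_decay (- iota)).
have := C1oo_const_eq ts (C1ooW (lexx t) sT C).
have Gt : G t = 0 by rewrite /G set_itv1 Rintegral_set1.
rewrite Gt subrr mulr0 expR0 mulr1 sub0r opprK => H.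
have {}H : (G s - z0 / iota) * expR (iota * (s - t)) = - (z0 / iota).
  by apply: H => x _; field; rewrite gt_eqF.
 rewrite ZE; last by rewrite in_itv/= ts.
rewrite -/(G s) mulNr expRN; set E := expR _ in H *.
have E0 : E != 0 by rewrite gt_eqF// expR_gt0.
have i0 : iota != 0 by rewrite gt_eqF.
have -> : G s = z0 / iota + - (z0 / iota) / E by rewrite -H; field; rewrite E0.
by field; rewrite i0 E0.
Qed.

(* Moves the weight from the path to path + iota * primitive, which for the state
   process is explicit in the noise. *)
Lemma parts_duality (Psi dPsi y : R -> R) : C1oo Psi dPsi t T -> cont dPsi ->
  cont y -> Psi T = 0 ->
  \int[mu]_(u in `[t, T]) ((iota * Psi u - dPsi u) * y u) =
  \int[mu]_(u in `[t, T]) (- dPsi u * (y u + iota * \int[mu]_(r in `[t, u]) y r)).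
Proof.
move=> PC cd cy PT.
pose G x := \int[mu]_(u in `[t, x]) y u.
have GC : C1oo G y t T by exact: C1oo_primitive.
have cP := PC.2; have cG := GC.2.
have c1 : cont (fun u => Psi u * y u + G u * dPsi u).
  by apply: contD; apply: contM.
have := C1oo_integral tT (C1ooM PC GC) c1.
have Gt : G t = 0 by rewrite /G set_itv1 Rintegral_set1.
rewrite PT Gt mul0r mulr0 subrr => H.
apply/eqP; rewrite -subr_eq0 -RintegralB//; last 2 first.
- by apply: cont_rint; apply: contM => //; apply: contB => //; apply: contM => //; exact: cont_cst.
- apply: cont_rint; apply: contM; first exact: contN.
  by apply: contD => //; apply: contM => //; exact: cont_cst.
apply/eqP; transitivity
  (\int[mu]_(u in `[t, T]) (iota * (Psi u * y u + G u * dPsi u))).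
  by apply: eq_Rintegral => u _; rewrite /G; ring.
by rewrite RintegralZl// ?H ?mulr0//; exact: cont_rint.
Qed.

(** Integration by parts against k (u - t), the deterministic part of the path plus iota times its
    primitive; the boundary terms vanish at t and, by Psi T = 0, at T. *)
Lemma duality_drift (Psi dPsi : R -> R) (k : R) : C1oo Psi dPsi t T -> cont dPsi ->
  Psi T = 0 ->
  \int[mu]_(u in `[t, T]) (- dPsi u * (k * (u - t))) =
  k * \int[mu]_(u in `[t, T]) Psi u.
Proof.
move=> PC cd PT.
have lC : C1oo (fun u => k * (u - t)) (fun=> k) t T.
  split; last first.
    by apply: contM; [exact: cont_cst|apply: contB; [exact: cont_id|exact: cont_cst]].
  move=> x _.
  have := is_deriveZ k (is_deriveB (is_derive_id x (1 : R)) (is_derive_cst t x (1 : R))).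
  by rewrite subr0 /GRing.scale/= mulr1.
have cl := lC.2; have cP := PC.2.
have c1 : cont (fun u => Psi u * k + k * (u - t) * dPsi u).
  by apply: contD; apply: contM => //; exact: cont_cst.
have := C1oo_integral tT (C1ooM PC lC) c1.
rewrite PT mul0r subrr mulr0 mulr0 subrr => H.
rewrite -RintegralZl//; last exact: cont_rint.
apply/eqP; rewrite -subr_eq0 -RintegralB//; last 2 first.
- by apply: cont_rint; apply: contM => //; exact: contN.
- by apply: cont_rint; apply: contM => //; exact: cont_cst.
apply/eqP; transitivity
  (\int[mu]_(u in `[t, T]) (- 1 * (Psi u * k + k * (u - t) * dPsi u))).
  by apply: eq_Rintegral => u _; ring.
by rewrite RintegralZl// ?H ?mulr0//; exact: cont_rint.
Qed.

End ornstein_uhlenbeck_path.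

(** * The noise of the state process *)

(** The factor 8 / 3 is 4 / 3 times 2, the ratio of the peaks of the two densities compared. It is
    not sharp; a bound proportional to the standard deviation suffices for Fubini. *)
Lemma normal_abs_mean_le {R : realType} (s : R) : 0 < s ->
  (\int[normal_prob 0%R s]_x (`|x : R|)%:E <= (8 / 3 * s)%:E)%E.
Proof.
move=> s0; rewrite (@ge0_integral_normal R s (fun x => `|x|))//; last exact: normr_measurable.
have pk : normal_peak s / normal_peak (2 * s) = 2.
  have -> : normal_peak (2 * s) = (2 * Num.sqrt (s ^+ 2 * pi *+ 2))^-1.
    rewrite /normal_peak; congr (_^-1).
    have -> : (2 * s) ^+ 2 * pi *+ 2 = 2 ^+ 2 * (s ^+ 2 * pi *+ 2) by ring.
    by rewrite sqrtrM ?sqr_ge0// sqrtr_sqr ger0_norm.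
  rewrite /normal_peak invrK mulrCA mulVf ?mulr1//.
  by rewrite gt_eqF// sqrtr_gt0 mulrn_wgt0// mulr_gt0 ?pi_gt0// exprn_gt0.
apply: (@le_trans _ _
  (\int[lebesgue_measure]_x ((8 / 3 * s)%:E * (normal_pdf 0%R (2 * s) x)%:E))%E).
  apply: ge0_le_integral => //.
  - by move=> x _; rewrite lee_fin mulr_ge0// normal_pdf_ge0.
  - apply/measurable_EFinP; apply: measurable_funM; first exact: normr_measurable.
    exact: measurable_normal_pdf.
  - apply/measurable_EFinP; apply: measurable_funM => //; exact: measurable_normal_pdf.
  - move=> x _; rewrite -EFinM lee_fin.
    have := normal_abs_pdf_le s0 x; rewrite pk => /le_trans; apply.
    by rewrite le_eqVlt; apply/orP; left; apply/eqP; field.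
rewrite integralZl//; last exact: integrable_normal_pdf.
by rewrite integral_normal_pdf mule1.
Qed.

Section brownian_abs_increment.
Context {R : realType} {d : measure_display} {Omega : measurableType d}.
Context (P : probability Omega R) (T : R) (F : R -> set (set Omega)).
Context (hF : filtration_upto T F).

Lemma increment_abs_mean_le (W : R -> Omega -> R) s u : brownian_wrt P T F W ->
  0 <= s -> s <= u -> u <= T ->
  (\int[P]_w (`|W u w - W s w|)%:E <= (8 / 3 * Num.sqrt T)%:E)%E.
Proof.
move=> hW s0; rewrite le_eqVlt => /predU1P[<- _|su uT].
  under eq_integral do rewrite subrr normr0.
  by rewrite integral0 lee_fin mulr_ge0 ?sqrtr_ge0.
have sT : s \in `[0, T] by rewrite in_itv/= s0 (le_trans (ltW su)).
have uT' : u \in `[0, T] by rewrite in_itv/= uT (le_trans s0)// ltW.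
pose dW : Omega -> measurableTypeR R := fun w => W u w - W s w.
have mdW : measurable_fun [set: Omega] dW.
  by apply: measurable_funB; [exact: (measurable_wrt_fun hF uT' (hW.1 _ uT'))|
    exact: (measurable_wrt_fun hF sT (hW.1 _ sT))].
pose m1 : probability (measurableTypeR R) R :=
  distribution P (@mfun_Sub _ _ Omega (measurableTypeR R) dW (mem_set mdW)).
have mabs : measurable_fun setT (fun x : measurableTypeR R => (`|x : R|)%:E).
  by apply/measurable_EFinP; exact: normr_measurable.
have <- : (\int[m1]_x (`|x : R|)%:E = \int[P]_w (`|W u w - W s w|)%:E)%E.
  exact: ge0_integral_distribution.
rewrite (eq_measure_integral (normal_prob 0 (Num.sqrt (u - s)))); last first.
  move=> U mU _.
  have FT : F s setT.
    have [[F0 FC _] _] := hF.1 s sT.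
    by have := FC _ F0; rewrite setD0.
  have := hW.2 s u setT U s0 su uT FT mU.
  by rewrite setTI probability_setT mul1e.
apply: le_trans (normal_abs_mean_le _) _; first by rewrite sqrtr_gt0 subr_gt0.
rewrite lee_fin ler_pM2l// ler_sqrt; first lra.
by rewrite (le_trans (le_trans s0 (ltW su))).
Qed.

End brownian_abs_increment.

Section joint_measurability.
Context {R : realType} {d : measure_display} {Omega : measurableType d}.
Context (t T : R).
Local Notation mu := (@lebesgue_measure R).

(** The variable upper limit is moved into the integrand as an indicator. Tonelli then gives
    measurability of the integrals of the positive and negative parts, and [fine] of their
    difference is measurable even where they are infinite. *)
Lemma measurable_running_integral (H : R -> Omega -> R) :
  measurable_fun (`[t, T] `*` [set: Omega])
    (fun z : measurableTypeR R * Omega => H z.1 z.2) ->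
  measurable_fun setT (fun z : measurableTypeR R * Omega =>
    \int[mu]_(r in `[t, z.1]) ((H ^~ z.2) \_ `[t, T]) r).
Proof.
move=> mH; have mHp := measurable_patch mH.
pose f (z : (measurableTypeR R * Omega) * measurableTypeR R) : \bar R :=
  (if z.2 <= z.1.1 :> R then ((H ^~ z.1.2) \_ `[t, T]) z.2 else 0)%:E.
have mf : measurable_fun setT f.
  apply/measurable_EFinP; apply: measurable_fun_ifT => //.
    apply: measurable_fun_ler => //.
    exact: (measurableT_comp measurable_fst measurable_fst).
  pose q : (measurableTypeR R * Omega) * measurableTypeR R -> measurableTypeR R * Omega :=
    fun z => (z.2, z.1.2).
  have mq : measurable_fun setT q.
    apply: measurable_fun_pair => //.
    exact: (measurableT_comp measurable_snd measurable_fst).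
  exact: (measurableT_comp mHp mq).
have fE z : (\int[mu]_(r in `[t, z.1]) (((H ^~ z.2) \_ `[t, T]) r)%:E =
    \int[mu]_r f (z, r))%E.
  rewrite [LHS]integral_mkcond; apply: eq_integral => r _.
  rewrite /f/= !patchE !mem_setE !in_itv/=.
  by case: (leP t r) => //=; case: (leP r z.1).
have E z : \int[mu]_(r in `[t, z.1]) ((H ^~ z.2) \_ `[t, T]) r =
    fine (\int[mu]_r f^\+%E (z, r) - \int[mu]_r f^\-%E (z, r))%E.
  rewrite /Rintegral fE; congr fine.
  rewrite integralE; congr (_ - _)%E; apply: eq_integral => r _.
    by rewrite !funeposE.
  by rewrite !funenegE.
rewrite (_ : (fun z => _) = (fun z =>
    fine (\int[mu]_r f^\+%E (z, r) - \int[mu]_r f^\-%E (z, r))%E)); last exact/funext.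
apply: measurableT_comp => //; apply: emeasurable_funB.
  by apply: (measurable_fun_fubini_tonelli_F (m2 := mu) f^\+%E) => //; exact: measurable_funepos.
by apply: (measurable_fun_fubini_tonelli_F (m2 := mu) f^\-%E) => //; exact: measurable_funeneg.
Qed.

(** A uniform bound on the absolute means over a bounded time interval gives integrability on the
    product, so expectation and time integral can be exchanged. *)
Lemma zero_mean_fubini (P : probability Omega R) (C : R)
    (f : measurableTypeR R * Omega -> R) : 0 <= C -> measurable_fun setT f ->
  (forall u, zero_mean P (fun w => f (u, w))) ->
  (forall u, u \in `[t, T] -> (\int[P]_w (`|f (u, w)|)%:E <= C%:E)%E) ->
  (forall u w, u \notin `[t, T] -> f (u, w) = 0) ->
  zero_mean P (fun w => \int[mu]_u f (u, w)).
Proof.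
move=> C0 mf zm fC f0.
pose g (z : Omega * measurableTypeR R) : \bar R := (f (z.2, z.1))%:E.
have mg : measurable_fun setT g.
  by apply/measurable_EFinP; apply: (measurableT_comp mf); exact: measurable_swap.
have ig : (P \x mu)%E.-integrable setT g.
  apply/integrable21ltyP => //.
  apply: (@le_lt_trans _ _ (\int[mu]_(u in `[t, T]) (cst C%:E u))%E); last first.
    rewrite integral_cst//= lebesgue_measure_itv/=; case: ifP => _; last by rewrite mule0.
    by rewrite -EFinD -EFinM ltry.
  rewrite [leRHS]integral_mkcond; apply: ge0_le_integral => //.
  - by move=> u _; apply: integral_ge0.
  - apply: (measurable_fun_fubini_tonelli_G (m1 := P) (fun z => `|g z|)%E) => //.
    exact: measurableT_comp.
  - have mE : measurable (`[t, T]%classic : set (measurableTypeR R)) by [].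
    by apply/(measurable_restrictT _ mE).
  move=> u _; rewrite patchE; case: ifPn => [|]; first by rewrite inE; exact: fC.
  rewrite notin_setE/= => /negP uT; rewrite /g/=.
  by under eq_integral => w _ do rewrite f0// normr0; rewrite integral0.
have iF := integrable_fubini_F ig.
have finF : {ae P, forall w, fubini_F mu g w \is a fin_num}.
  by have := integrable_ae measurableT iF; apply: filterS => w /(_ Logic.I).
have E0 : (\int[P]_w fubini_F mu g w = 0)%E.
  rewrite (Fubini ig); apply: integral0_eq => u _; rewrite /g/=.
  rewrite -[LHS]fineK; first by have := (zm u).2; rewrite /Rintegral => ->.
  exact: integrable_fin_num (zm u).1.
have mF : measurable_fun setT (fun w => \int[mu]_u f (u, w)).
  exact: measurableT_comp (measurable_int _ iF).
have aeF : ae_eq P setT (fubini_F mu g) (EFin \o (fun w => \int[mu]_u f (u, w))).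
  by apply: filterS finF => w finw _ /=; rewrite /Rintegral fineK.
have iQ : P.-integrable setT (EFin \o (fun w => \int[mu]_u f (u, w))).
  apply/integrableP; split; first exact/measurable_EFinP.
  have /integrableP[mFF] := iF.
  congr (_ < _)%E; apply: ae_eq_integral => //.
  - exact: measurableT_comp.
  - by apply: measurableT_comp => //; exact/measurable_EFinP.
  - by apply: filterS aeF => w h wT; rewrite h.
split => //; rewrite /Rintegral.
have -> : (\int[P]_w (\int[mu]_u f (u, w))%:E = \int[P]_w fubini_F mu g w)%E.
  apply: ae_eq_integral => //.
  - exact/measurable_EFinP.
  - exact: measurable_int iF.
  - by apply: filterS aeF => w h wT; rewrite h.
by rewrite E0.
Qed.

End joint_measurability.

Section state_noise.
Context {R : realType} {d : measure_display} {Omega : measurableType d}.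
Context (P : probability Omega R) (M : market R) (F : R -> set (set Omega)).
Context (B Bt : R -> Omega -> R) (t y : R) (Y : R -> Omega -> R).
Context (hF : filtration_upto (horizon M) F).
Context (hB : brownian_wrt P (horizon M) F B) (hBt : brownian_wrt P (horizon M) F Bt).
Context (hY : state_process P M F B Bt t y Y).
Context (t0 : 0 <= t) (tT : t <= horizon M).
Local Notation T := (horizon M).
Local Notation mu := (@lebesgue_measure R).

(** Almost surely this is the Brownian term of the state equation. It is written through Y because
    joint measurability in time and sample point is given for Y, while the noises come with
    measurability at each fixed time. *)
Definition state_noise (u : R) (w : Omega) : R :=
  Y u w - y - \int[mu]_(r in `[t, u]) (speed M * (ybar M - Y r w)).

(** The factors 1 present each increment as an elementary integral with integrand 1. *)
Let N (u : R) (w : Omega) : R :=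
  yvol M * corr M * (1 * (B u w - B t w)) +
  yvol M * Num.sqrt (1 - corr M ^+ 2) * (1 * (Bt u w - Bt t w)).

Let zero_mean_incr (W : R -> Omega -> R) u : brownian_wrt P T F W ->
  u \in `[t, T] -> zero_mean P (fun w => 1 * (W u w - W t w)).
Proof.
move=> hW; rewrite in_itv/= => /andP[tu uT].
apply: (zero_mean_increment hF hW t0 tu uT).
  have t0T : t \in `[0, T] by rewrite in_itv/= t0.
  move=> U mU; have [[F0 FC _] _] := hF.1 t t0T.
  have [U1|U1] := pselect (U 1).
    by have := FC _ F0; rewrite setD0; congr (F t); apply/seteqP; split.
  by move: F0; congr (F t); apply/seteqP; split => w //= /U1.
by apply: rint_cst => //; exact: probability_lty.
Qed.

Let zero_mean_N u : u \in `[t, T] -> zero_mean P (N u).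
Proof. by move=> uT; apply: zero_meanD; apply: zero_meanZ; exact: zero_mean_incr. Qed.

Let N_abs_le u : u \in `[t, T] -> (\int[P]_w (`|N u w|)%:E <=
  ((yvol M * corr M + yvol M * Num.sqrt (1 - corr M ^+ 2)) * (8 / 3 * Num.sqrt T))%:E)%E.
Proof.
move=> uT; have [tu uT'] : t <= u /\ u <= T by move: uT; rewrite in_itv/= => /andP.
have k1 : 0 <= yvol M * corr M.
  by rewrite mulr_ge0 ?(ltW (yvol_gt0 M))//; have /andP[] := corr_itv M.
have k2 : 0 <= yvol M * Num.sqrt (1 - corr M ^+ 2).
  by rewrite mulr_ge0 ?(ltW (yvol_gt0 M))// sqrtr_ge0.
have m1 : measurable_fun setT (fun w => `|B u w - B t w|).
  apply: measurableT_comp => //.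
  by have := rint_measurable (zero_mean_incr hB uT).1;
    apply: eq_measurable_fun => w _; rewrite mul1r.
have m2 : measurable_fun setT (fun w => `|Bt u w - Bt t w|).
  apply: measurableT_comp => //.
  by have := rint_measurable (zero_mean_incr hBt uT).1;
    apply: eq_measurable_fun => w _; rewrite mul1r.
have mN := rint_measurable (zero_mean_N uT).1.
apply: (@le_trans _ _ (\int[P]_w ((yvol M * corr M)%:E * (`|B u w - B t w|)%:E +
    (yvol M * Num.sqrt (1 - corr M ^+ 2))%:E * (`|Bt u w - Bt t w|)%:E))%E).
  apply: ge0_le_integral => //.
  - by apply/measurable_EFinP; exact: measurableT_comp.
  - by apply: emeasurable_funD; apply: measurable_funeM; exact/measurable_EFinP.
  - move=> w _; rewrite -!EFinM -EFinD lee_fin /N (le_trans (ler_normD _ _))//.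
    by rewrite !mul1r (normrM (yvol M * corr M)) (ger0_norm k1) (normrM (_ * Num.sqrt _)) (ger0_norm k2).
rewrite ge0_integralD//; last 4 first.
- by move=> w _; rewrite -EFinM lee_fin mulr_ge0.
- by apply: measurable_funeM; exact/measurable_EFinP.
- by move=> w _; rewrite -EFinM lee_fin mulr_ge0.
- by apply: measurable_funeM; exact/measurable_EFinP.
rewrite !ge0_integralZl//; try exact/measurable_EFinP.
rewrite mulrDl EFinD; apply: leeD; rewrite [leRHS]EFinM;
  apply: lee_wpmul2l; rewrite ?lee_fin//.
  exact: (increment_abs_mean_le hF hB t0 tu uT').
exact: (increment_abs_mean_le hF hBt t0 tu uT').
Qed.

(** Fubini is applied to [f], a jointly measurable version of the integrand cut off outside [t, T],
    while zero mean and the absolute bound are checked on the Brownian expression. *)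
Lemma zero_mean_state_noise (psi : R -> R) : {within `[t, T], continuous psi} ->
  zero_mean P (fun w => \int[mu]_(u in `[t, T]) (psi u * state_noise u w)).
Proof.
move=> cpsi; have [[mY _] pY sY] := hY.
have [K K0 HK] : exists2 K, 0 <= K & forall u, u \in `[t, T] -> `|psi u| <= K.
  have [c cT Hc] := EVT_max tT (fun x => @cvg_norm _ _ _ _ _ _ _ (cpsi x)).
  by exists `|psi c|.
have mH : measurable_fun (`[t, T] `*` [set: Omega])
    (fun z : measurableTypeR R * Omega => speed M * (ybar M - Y z.1 z.2)).
  by apply: measurable_funM => //; apply: measurable_funB.
have mI := measurable_running_integral (H := fun r w => speed M * (ybar M - Y r w)) mH.
have mpsi : measurable_fun setT (fun z : measurableTypeR R * Omega => (psi \_ `[t, T]) z.1).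
  have m1 : measurable_fun (`[t, T]%classic : set (measurableTypeR R)) psi.
    exact: rint_measurable (cont_rint cpsi).
  have mE : measurable (`[t, T]%classic : set (measurableTypeR R)) by [].
  have /(measurable_restrictT _ mE) m2 := m1.
  exact: (measurableT_comp m2 measurable_fst).
pose f (z : measurableTypeR R * Omega) : R := (psi \_ `[t, T]) z.1 *
  (((Y ^~ z.2) \_ `[t, T]) z.1 - y -
   \int[mu]_(r in `[t, z.1]) (((fun r => speed M * (ybar M - Y r z.2)) \_ `[t, T]) r)).
have mf : measurable_fun setT f.
  apply: measurable_funM => //; apply: measurable_funB => //.
  by apply: measurable_funB => //; exact: measurable_patch.
have fE u w : u \in `[t, T] -> f (u, w) = psi u * state_noise u w.
  move=> uT; rewrite /f /state_noise/= !patchE !mem_setE uT; congr (_ * (_ - _)).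
  apply: eq_Rintegral => r; rewrite inE/= in_itv/= => /andP[tr ru].
  rewrite patchE mem_setE in_itv/= tr (le_trans ru)//.
  by move: uT; rewrite in_itv/= => /andP[].
have f0 u w : u \notin `[t, T] -> f (u, w) = 0.
  by move=> uT; rewrite /f/= patchE mem_setE (negbTE uT) mul0r.
(* The two expressions are compared at each fixed time, which is enough to transfer means. *)
have noiseE u : u \in `[t, T] -> {ae P, forall w, f (u, w) = psi u * N u w}.
  move=> uT; apply: filterS sY => w /(_ u uT) Yu.
  by rewrite fE// /state_noise Yu /N; ring.
have mfu u : measurable_fun setT (fun w => f (u, w)).
  exact: (measurableT_comp mf (pair1_measurable u)).
suff : zero_mean P (fun w => \int[mu]_u f (u, w)).
  congr (zero_mean P); apply/funext => w.
  rewrite [RHS]Rintegral_mkcond; apply: eq_Rintegral => u _.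
  rewrite patchE mem_setE; case: ifPn => uT; first by rewrite fE.
  by rewrite f0.
apply: (zero_mean_fubini (t := t) (T := T) (C := K *
   ((yvol M * corr M + yvol M * Num.sqrt (1 - corr M ^+ 2)) * (8 / 3 * Num.sqrt T)))) => //.
- have k1 : 0 <= corr M by have /andP[] := corr_itv M.
  by rewrite !mulr_ge0 ?addr_ge0 ?mulr_ge0 ?sqrtr_ge0 ?(ltW (yvol_gt0 M)).
- move=> u; have [uT|uT] := boolP (u \in `[t, T]); last first.
    rewrite (_ : (fun w => f (u, w)) = cst 0); last by apply/funext => w; rewrite f0.
    split; last exact: Rintegral_cst_prob.
    by apply: rint_cst => //; exact: probability_lty.
  have [iN N0] := zero_meanZ (psi u) (zero_mean_N uT).
  have mN := rint_measurable iN.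
  split.
    apply: (ae_rint _ iN) => //.
    by apply: filterS (noiseE u uT) => w h _; rewrite h.
  rewrite -N0; apply: ae_eq_Rintegral => //.
  by apply: filterS (noiseE u uT) => w h _; rewrite h.
- move=> u uT; have [iN _] := zero_mean_N uT.
  have mN := rint_measurable iN.
  apply: (@le_trans _ _ (\int[P]_w (K%:E * (`|N u w|)%:E))%E).
    apply: ae_ge0_le_integral => //.
    + by apply/measurable_EFinP; exact: measurableT_comp.
    + by move=> w _; rewrite -EFinM lee_fin mulr_ge0.
    + by apply: measurable_funeM; apply/measurable_EFinP; exact: measurableT_comp.
    apply: filterS (noiseE u uT) => w h _.
    by rewrite h -EFinM lee_fin normrM ler_wpM2r// HK.
  rewrite ge0_integralZl//; last by apply/measurable_EFinP; exact: measurableT_comp.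
  by rewrite EFinM lee_wpmul2l ?lee_fin// N_abs_le.
Qed.

End state_noise.

(** * One policy update *)

Section update.
Context {R : realType}.

Lemma derive1_val (f : R -> R) x l : is_derive x (1 : R) f l -> derive1 f x = l.
Proof. by move=> fl; rewrite derive1E; exact: derive_val. Qed.

Lemma is_derive_quadratic (c b a x : R) :
  is_derive x (1 : R) (fun z => c + b * z + a * z ^+ 2) (b + 2 * a * x).
Proof.
have := is_deriveD (is_deriveD (is_derive_cst c x (1 : R))
  (is_deriveZ b (is_derive_id x (1 : R)))) (is_deriveZ a (is_deriveM (is_derive_id x (1 : R)) (is_derive_id x (1 : R)))).
rewrite /GRing.scale/= => H; apply: (@is_derive_eq _ _ _ _ _ _ _ _ H); ring.
Qed.

Lemma derive1_quadratic (c b a : R) (f : R -> R) :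
  (forall z, f z = c + b * z + a * z ^+ 2) -> derive1 f = (fun x => b + 2 * a * x).
Proof.
move=> fE; have -> : f = (fun z => c + b * z + a * z ^+ 2) by exact/funext.
by apply/funext => x; apply: derive1_val; exact: is_derive_quadratic.
Qed.

Lemma derive1_affine (c b : R) (f : R -> R) :
  (forall z, f z = c + b * z) -> derive1 f = (fun=> b).
Proof.
move=> fE; rewrite (@derive1_quadratic c b 0); last by move=> z; rewrite fE; ring.
by apply/funext => x; ring.
Qed.

Lemma derive1n2_quadratic (c b a : R) (f : R -> R) x :
  (forall z, f z = c + b * z + a * z ^+ 2) -> derive1n 2 f x = 2 * a.
Proof.
move=> fE; rewrite /= (derive1_quadratic fE).
by rewrite (@derive1_affine b (2 * a)).
Qed.

(** The unknown function v is harmless: V_x = 1 and V_xx = V_xy = 0, and its other derivatives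
    multiply nothing that depends on the candidate. The first-order wealth terms of the square of g
    and of gamma g L g cancel; (g^2)_xx = 2 produces the penalty on the variance, and (g^2)_xy = 2
    (a2 y + a1) the hedging term. *)
Lemma update_quantile (M : market R) (A : agent (horizon M)) (mj m : distr R)
    (V g : R -> R -> R -> R) (t x y : R) (v : R -> R) (d0 a1 a2 : R) :
  t \in `[0, horizon M] ->
  (forall x' y', V t x' y' = x' + v y') ->
  (forall x' y', g t x' y' = x' + (d0 + a1 * y' + a2 / 2 * y' ^+ 2)) ->
  is_argmax (update_objective A mj V g t x y) m ->
  forall p, p \in `]0, 1[ ->
    quantile m p = y / (gam A * vol M) + relw A * mean mj
      - corr M * yvol M / vol M * (a2 * y + a1)
      + lam A t / (gam A * vol M ^+ 2) * rderiv (reg A) (1 - p).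
Proof.
move=> tT VE gE amax p; rewrite in_itv/= => p01.
have g0 := gam_gt0 A; have s0 := vol_gt0 M; have l0 := lam_gt0 A tT.
have hc := convex_chord_concave (reg_concave A).
set b := gam A * vol M ^+ 2.
(* The coefficient of the mean of the candidate: the drift of V, the mixed derivative of the square
   of g, and the cross term of the square of [mean m - k * mean mj]. *)
set a := vol M * y - gam A * corr M * yvol M * vol M * (a2 * y + a1)
   + b * relw A * mean mj.
have b0 : 0 < b by rewrite mulr_gt0// exprn_gt0.
have Vx y' : derive1 (fun x' => V t x' y') = (fun=> 1).
  by apply: (@derive1_affine (v y')) => z; rewrite VE; ring.
have Vxx : derive1n 2 (fun x' => V t x' y) x = 0.
  by rewrite (@derive1n2_quadratic (v y) 1 0) ?mulr0// => z; rewrite VE; ring.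
have Vxy : derive1 (fun y' => derive1 (fun x' => V t x' y') x) y = 0.
  by rewrite (@derive1_affine 1 0)// => z; rewrite Vx; ring.
pose D y' := d0 + a1 * y' + a2 / 2 * y' ^+ 2.
have gx y' : derive1 (fun x' => g t x' y') = (fun=> 1).
  by apply: (@derive1_affine (D y')) => z; rewrite gE /D; ring.
have gxx : derive1n 2 (fun x' => g t x' y) x = 0.
  by rewrite (@derive1n2_quadratic (D y) 1 0) ?mulr0// => z; rewrite gE /D; ring.
have gxy : derive1 (fun y' => derive1 (fun x' => g t x' y') x) y = 0.
  by rewrite (@derive1_affine 1 0)// => z; rewrite gx; ring.
have qx y' : derive1 (fun x' => g t x' y' ^+ 2) = (fun x' => 2 * D y' + 2 * x').
  rewrite (@derive1_quadratic (D y' ^+ 2) (2 * D y') 1).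
    by apply/funext => z; ring.
  by move=> z; rewrite gE /D; ring.
have qxx : derive1n 2 (fun x' => g t x' y ^+ 2) x = 2.
  rewrite (@derive1n2_quadratic (D y ^+ 2) (2 * D y) 1) ?mulr1//.
  by move=> z; rewrite gE /D; ring.
have qxy : derive1 (fun y' => derive1 (fun x' => g t x' y' ^+ 2) x) y = 2 * (a2 * y + a1).
  rewrite (@derive1_quadratic (2 * x + 2 * d0) (2 * a1) a2); first by ring.
  by move=> z; rewrite qx /D; field.
(* The part of the generator common to all candidates; it goes into the constant [K]. *)
pose Lc f := tderiv (horizon M) (fun s => f s x y) t
  + speed M * (ybar M - y) * derive1 (fun y' => f t x y') y
  + 2^-1 * yvol M ^+ 2 * derive1n 2 (fun y' => f t x y') y.
pose k := relw A; pose mu := mean mj.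
pose K := Lc V - gam A / 2 * Lc (fun t' x' y' => g t' x' y' ^+ 2) + gam A * g t x y * Lc g
  - vol M * y * k * mu - gam A / 2 * vol M ^+ 2 * (k ^+ 2 * mu ^+ 2 + k ^+ 2 * var mj)
  + gam A * corr M * yvol M * vol M * k * mu * (a2 * y + a1).
have JE m' : finite_second_moment m' -> update_objective A mj V g t x y m' =
    K + (a * mean m' - b / 2 * mean m' ^+ 2 - b / 2 * var m' + lam A t * choquet (reg A) m').
  move=> _; rewrite /update_objective /generator Vxx Vxy gxx gxy qxx qxy Vx gx qx.
  rewrite /K /Lc /a /b /k /mu (gE x y) -/(D y).
  (* The time and state derivatives become opaque atoms: the identity holds whatever values these
     limits have, even by default. *)
  set X1 := tderiv _ _ _; set X2 := derive1 _ _; set X3 := derive1n _ _ _.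
  set X4 := tderiv _ _ _; set X5 := derive1 _ _; set X6 := derive1n _ _ _.
  set X7 := tderiv _ _ _; set X8 := derive1 _ _; set X9 := derive1n _ _ _.
  by field.
have q01 : 0 < 1 - p < 1 by rewrite subr_gt0 gtrBl andbC.
have := argmax_quantile hc (@reg_cont _ _ A) (reg0 A) (reg1 A) (reg_L2 A) b0 (ltW l0) JE amax q01.
rewrite uquantileE// subKr => ->; congr (_ + _).
by rewrite /a /b; field; rewrite !gt_eqF.
Qed.

End update.

(** * Integrals of the state process *)

Section state_mean.
Context {R : realType} {d : measure_display} {Omega : measurableType d}.
Context (P : probability Omega R) (M : market R) (F : R -> set (set Omega)).
Context (B Bt : R -> Omega -> R) (t : R) (Y : R -> Omega -> R).
Context (hF : filtration_upto (horizon M) F).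
Context (hB : brownian_wrt P (horizon M) F B) (hBt : brownian_wrt P (horizon M) F Bt).
Context (hY : state_process P M F B Bt t 0 Y).
Context (t0 : 0 <= t) (tT : t <= horizon M).
Local Notation T := (horizon M).
Local Notation iota := (speed M).
Local Notation mu := (@lebesgue_measure R).
Local Notation cont f := {within `[t, T], continuous f}.

(** With the weight iota Psi - Psi', [parts_duality] replaces Y by Y + iota times its primitive,
    which is iota ybar (u - t) plus noise. The mean is obtained without computing the mean of Y at
    any time. *)
Lemma state_integral_mean (Psi dPsi : R -> R) : C1oo Psi dPsi t T -> cont dPsi ->
  Psi T = 0 ->
  exists2 Q, zero_mean P Q & {ae P, forall w,
    \int[mu]_(u in `[t, T]) ((iota * Psi u - dPsi u) * Y u w) =
    iota * ybar M * \int[mu]_(u in `[t, T]) Psi u + Q w}.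
Proof.
move=> PC cd PT; have cN := contN cd.
exists (fun w => \int[mu]_(u in `[t, T]) (- dPsi u * state_noise M t 0 Y u w)).
  exact: (zero_mean_state_noise hF hB hBt hY t0 tT cN).
have [_ cY _] := hY; apply: filterS cY => w cYw.
pose I u := \int[mu]_(r in `[t, u]) Y r w.
have cI : cont I := (C1oo_primitive tT cYw).2.
have nE u : u \in `[t, T] -> state_noise M t 0 Y u w =
    Y u w + iota * I u - iota * ybar M * (u - t).
  move=> uT; rewrite /state_noise subr0.
  have [tu uT'] : t <= u /\ u <= T by move: uT; rewrite in_itv/= => /andP.
  have iY : mu.-integrable `[t, u] (EFin \o (Y ^~ w)).
    apply: integrableS (cont_rint cYw) => //.
    by apply: subset_itvl; rewrite bnd_simp.
  have fin : (mu `[t, u]%classic < +oo)%E.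
    by rewrite lebesgue_measure_itv/=; case: ifP => _; rewrite ?ltry// -EFinD ltry.
  have mI : measurable (`[t, u]%classic : set R) by [].
  rewrite RintegralZl//; last by apply: rintB => //; exact: rint_cst.
  rewrite RintegralB//; last exact: rint_cst.
  rewrite -/(I u).
  have -> : \int[mu]_(x in `[t, u]) ybar M = ybar M * (u - t).
    rewrite Rintegral_cst//; congr (_ * _).
    transitivity (fine (mu (`[t, u]%classic : set R))); first by [].
    rewrite lebesgue_measure_itv/= lte_fin.
    case: ifPn => [//|]; rewrite -leNgt => ut.
    by rewrite (@le_anti _ _ t u) ?subrr// tu ut.
  by ring.
rewrite (parts_duality iota tT PC cd cYw PT) -(duality_drift tT (iota * ybar M) PC cd PT).
have c1 : cont (fun u => - dPsi u * (iota * ybar M * (u - t))).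
  apply: contM => //; apply: contM; first exact: cont_cst.
  by apply: contB; [exact: cont_id|exact: cont_cst].
have c2 : cont (fun u => - dPsi u * (Y u w + iota * I u)).
  by apply: contM => //; apply: contD => //; apply: contM => //; exact: cont_cst.
apply/eqP; rewrite addrC -subr_eq -RintegralB//; try exact: cont_rint.
apply/eqP; apply: eq_Rintegral => u; rewrite inE/= => uT.
by rewrite nE// -/(I u); move: (I u) => Iu; ring.
Qed.

Local Notation e := (fun u => expR (- iota * (u - t))).

Context (c1 c2 a1 a2 da1 da2 : R -> R).
Context (ca1 : C1oo a1 da1 t T) (ca2 : C1oo a2 da2 t T).
Context (cc1 : cont c1) (cc2 : cont c2).
Context (da2E : forall u, u \in `[t, T] -> da2 u = 2 * iota * a2 u - 2 * c2 u).
Context (da1E : forall u, u \in `[t, T] -> da1 u = iota * a1 u - c1 u - iota * ybar M * a2 u).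
Context (a1T : a1 T = 0) (a2T : a2 T = 0).

Let ce : cont e := (C1oo_decay t T iota).2.

Let inoo u : t < u < T -> u \in `[t, T].
Proof. by move=> /andP[tu uT]; rewrite in_itv/= !ltW. Qed.

Let e_t : e t = 1.
Proof. by rewrite /= subrr mulr0 expR0. Qed.

(** The equation for a2 says exactly that e^2 a2 has derivative - 2 c2 e^2; a2 T = 0 does the
    rest. *)
Lemma integral_c2 : \int[mu]_(u in `[t, T]) (c2 u * e u ^+ 2) = a2 t / 2.
Proof.
have C := C1ooM (C1ooM (C1oo_decay t T iota) (C1oo_decay t T iota)) ca2.
have {}C : C1oo (fun u => e u * e u * a2 u) (fun u => - 2 * (c2 u * e u ^+ 2)) t T.
  by apply: C1oo_eq C => u /inoo uT; rewrite (da2E uT); ring.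
have cI : cont (fun u => c2 u * e u ^+ 2).
  by apply: contM => // u; apply: cvgM; exact: ce.
have cI2 : cont (fun u => - 2 * (c2 u * e u ^+ 2)) by apply: contM => //; exact: cont_cst.
have := C1oo_integral tT C cI2.
rewrite RintegralZl//; last exact: cont_rint.
by rewrite a2T e_t => H; lra.
Qed.

(** Psi = e a2 is chosen because iota Psi - Psi' = 2 e c2, which reduces the Y term to iota ybar
    times the integral of e a2 up to zero mean. The equation for a1 says that e a1 has derivative -
    (e c1 + iota ybar e a2), so the total is a1 t. *)
Lemma integral_c1_mean : exists2 Q, zero_mean P Q & {ae P, forall w,
  \int[mu]_(u in `[t, T]) (e u * (2 * c2 u * Y u w + c1 u)) = a1 t + Q w}.
Proof.
have PsiC := C1ooM (C1oo_decay t T iota) ca2.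
pose dPsi u := e u * (iota * a2 u - 2 * c2 u).
have {}PsiC : C1oo (fun u => e u * a2 u) dPsi t T.
  by apply: C1oo_eq PsiC => u /inoo uT; rewrite /dPsi (da2E uT); ring.
have cdPsi : cont dPsi.
  apply: contM => //; apply: contB; apply: contM => //; try exact: cont_cst.
  exact: ca2.2.
have PsiT : e T * a2 T = 0 by rewrite a2T mulr0.
have [Q zQ QE] := state_integral_mean PsiC cdPsi PsiT.
exists Q => //; have [_ cY _] := hY; apply: filterS2 cY QE => w cYw.
have -> : \int[mu]_(u in `[t, T]) ((iota * (e u * a2 u) - dPsi u) * Y u w) =
    \int[mu]_(u in `[t, T]) (2 * (e u * c2 u * Y u w)).
  by apply: eq_Rintegral => u _; rewrite /dPsi; ring.
have cec2 : cont (fun u => 2 * (e u * c2 u * Y u w)).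
  by apply: contM; [exact: cont_cst|apply: contM => //; exact: contM].
have cec1 : cont (fun u => e u * c1 u) by exact: contM.
have cea2 : cont (fun u => e u * a2 u) by exact: PsiC.2.
have -> : \int[mu]_(u in `[t, T]) (e u * (2 * c2 u * Y u w + c1 u)) =
    \int[mu]_(u in `[t, T]) (2 * (e u * c2 u * Y u w)) + \int[mu]_(u in `[t, T]) (e u * c1 u).
  rewrite -RintegralDf//; try exact: cont_rint.
  by apply: eq_Rintegral => u _; ring.
move=> ->.
have C := C1ooM (C1oo_decay t T iota) ca1.
pose D1 u := - (e u * c1 u + iota * ybar M * (e u * a2 u)).
have {}C : C1oo (fun u => e u * a1 u) D1 t T.
  by apply: C1oo_eq C => u /inoo uT; rewrite /D1 (da1E uT); ring.
have cc : cont (fun u => iota * ybar M * (e u * a2 u)) by apply: contM => //; exact: cont_cst.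
have cD : cont D1 by apply: contN; exact: contD.
have := C1oo_integral tT C cD; rewrite a1T e_t.
have -> : \int[mu]_(u in `[t, T]) D1 u =
    - 1 * (\int[mu]_(u in `[t, T]) (e u * c1 u) + iota * ybar M * \int[mu]_(u in `[t, T]) (e u * a2 u)).
  rewrite -RintegralZl//; last exact: cont_rint.
  rewrite -RintegralDf//; try exact: cont_rint.
  rewrite -RintegralZl//; last by apply: cont_rint; exact: contD.
  by apply: eq_Rintegral => u _; rewrite /D1; ring.
by move=> H; lra.
Qed.

End state_mean.

(** * Dependence of the value functions on the wealth *)

(** Whatever a policy contributes to wealth and reward depends on its rearrangement alone. Policies
    with quantiles independent of the wealth may thus be evaluated at wealth 0. *)
Lemma uquantile_functionals {R : realType} (m m' : distr R) :
  uquantile m = uquantile m' ->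
  [/\ mean m = mean m', var m = var m' & forall h, choquet h m = choquet h m'].
Proof.
move=> mm'; have mE : mean m = mean m' by rewrite !meanE mm'.
split => //; first by rewrite !varE mE mm'.
move=> h; apply: eq_Rintegral => x _; congr (h (fine _)).
transitivity (@unif R (uquantile m @^-1` `[x, +oo[%classic)); first exact: law_uquantile.
by rewrite mm'; apply/esym; exact: law_uquantile.
Qed.

Section ito_ext.
Context {R : realType} {d : measure_display} {Omega : measurableType d}.
Context (P : probability Omega R) (F : R -> set (set Omega)).
Context (W : R -> Omega -> R) (t s : R).

Lemma is_ito_ext (H H' : R -> Omega -> R) :
  (forall u w, u \in `[t, s] -> H u w = H' u w) ->
  is_ito P F W t s H `<=` is_ito P F W t s H'.
Proof.
move=> HH I [[mH aH] mI [Hn [cH cI]]]; apply: And3; [|exact: mI|].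
  apply: conj => [|u uts]; last first.
    by rewrite -(_ : H u = H' u); [exact: aH|apply/funext => w; exact: HH].
  apply: eq_measurable_fun mH => z; rewrite inE => -[/= z1 _].
  exact: HH.
exists Hn; apply: conj; last exact: cI.
rewrite (_ : (fun n => _) = (fun n => \int[P]_w \int[lebesgue_measure]_(u in `[t, s])
  ((H u w - simple_eval (Hn n) u w) ^+ 2)%:E)%E); first exact: cH.
apply/funext => n; apply: eq_integral => w _; apply: eq_integral => u; rewrite inE/= => uts.
by rewrite HH.
Qed.

(** [ito] chooses from the set of versions, so equal sets yield literally the same version;
    agreement of the integrands is asked on [t, s] only, where the policies are known. *)
Lemma ito_ext (H H' : R -> Omega -> R) :
  (forall u w, u \in `[t, s] -> H u w = H' u w) ->
  ito P F W t s H = ito P F W t s H'.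
Proof.
move=> HH; have E : is_ito P F W t s H = is_ito P F W t s H'.
  apply/funext => I; apply/propext; apply: conj; first exact: (is_ito_ext HH).
  by apply: (is_ito_ext (H := H')) => u w uts; rewrite HH.
by rewrite /ito E.
Qed.

Lemma itoP (H : R -> Omega -> R) : ito_integrable P F W t s H ->
  is_ito P F W t s H (ito P F W t s H).
Proof. by move=> [I HI]; exact: (xgetPex (fun=> 0) (ex_intro _ I HI)). Qed.

End ito_ext.

Section value_structure.
Context {R : realType} {d : measure_display} {Omega : measurableType d}.
Context (P : probability Omega R) (M : market R) (F : R -> set (set Omega)).
Context (B : R -> Omega -> R) (A : agent (horizon M)) (Bi Bj : R -> Omega -> R).
Context (Y : R -> R -> R -> Omega -> R) (Pij : R -> R -> distr R).
Context (Pi : R -> R -> R -> distr R) (V g : R -> R -> R -> R).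
Context (hVg : value_functions P F B A Bi Bj Y Pij Pi V g).
Context (PiE : forall s x x' y, s \in `[0, horizon M] ->
  uquantile (Pi s x y) = uquantile (Pi s x' y)).
Local Notation T := (horizon M).
Local Notation mu := (@lebesgue_measure R).
Local Notation k := (relw A).

(** The wealth argument 0 is a reference point, harmless by [PiE]; it removes the feedback of the
    wealth on itself. *)
Definition policy_mean t y s w := mean (Pi s 0 (Y t y s w)).
Definition policy_sd t y s w := Num.sqrt (var (Pi s 0 (Y t y s w))).
Definition other_mean t y s w := mean (Pij s (Y t y s w)).
Definition other_sd t y s w := Num.sqrt (var (Pij s (Y t y s w))).
Definition running_reward t y w :=
  \int[mu]_(s in `[t, T]) (lam A s * choquet (reg A) (Pi s 0 (Y t y s w))).

Definition relative_gain t y w :=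
  \int[mu]_(u in `[t, T]) (vol M * Y t y u w * policy_mean t y u w)
  - k * \int[mu]_(u in `[t, T]) (vol M * Y t y u w * other_mean t y u w)
  + (vol M * (ito P F B t T (policy_mean t y) w + ito P F Bi t T (policy_sd t y) w)
     - k * (vol M * (ito P F B t T (other_mean t y) w + ito P F Bj t T (other_sd t y) w))).

Lemma value_decomposition t x y : t \in `[0, T] ->
  [/\ ito_integrable P F B t T (policy_mean t y), ito_integrable P F Bi t T (policy_sd t y),
      ito_integrable P F B t T (other_mean t y) & ito_integrable P F Bj t T (other_sd t y)] /\
  exists X : Omega -> R,
    [/\ X \in Lfun P 2%:E, (fun w => running_reward t y w + X w) \in Lfun P 1%:E,
        {ae P, forall w, X w = x + relative_gain t y w},
        g t x y = fine 'E_P[X] &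
        V t x y = fine 'E_P[(fun w => running_reward t y w + X w)%R]
          - gam A / 2 * fine 'V_P[X]].
Proof.
move=> tT; have [t0 tT'] : 0 <= t /\ t <= T by move: tT; rewrite in_itv/= => /andP.
have in0 s : s \in `[t, T] -> s \in `[0, T].
  by rewrite !in_itv/= => /andP[ts ->]; rewrite (le_trans t0).
(* With xj = 0 the initial relative wealth is x itself. *)
have [Xi [Xj []]] := hVg x 0 y tT.
rewrite mulr0 subr0 => -[aXi imi isi XiE] [aXj imj isj XjE] [X2 X1] gE VE.
have mE s w : s \in `[t, T] ->
    mean (Pi s (Xi s w - k * Xj s w) (Y t y s w)) = policy_mean t y s w.
  by move=> sT; have [] := uquantile_functionals (PiE (Xi s w - k * Xj s w) 0 (Y t y s w) (in0 s sT)).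
have sE s w : s \in `[t, T] ->
    Num.sqrt (var (Pi s (Xi s w - k * Xj s w) (Y t y s w))) = policy_sd t y s w.
  move=> sT; rewrite /policy_sd.
  by have [_ -> _] := uquantile_functionals (PiE (Xi s w - k * Xj s w) 0 (Y t y s w) (in0 s sT)).
have RE w : \int[mu]_(s in `[t, T]) (lam A s *
    choquet (reg A) (Pi s (Xi s w - k * Xj s w) (Y t y s w))) = running_reward t y w.
  apply: eq_Rintegral => s; rewrite inE/= => sT; congr (_ * _).
  by have [_ _] := uquantile_functionals (PiE (Xi s w - k * Xj s w) 0 (Y t y s w) (in0 s sT)).
apply: conj.
  apply: And4; [| |exact: imj|exact: isj].
    by have [I /(is_ito_ext mE) HI] := imi; exists I.
  by have [I /(is_ito_ext sE) HI] := isi; exists I.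
exists (fun w => Xi T w - k * Xj T w).
have TT : T \in `[t, T] by rewrite in_itv/= tT' lexx.
have RE' : (fun w => running_reward t y w + (Xi T w - k * Xj T w)) =
  (fun w => \int[mu]_(s in `[t, T]) (lam A s *
    choquet (reg A) (Pi s (Xi s w - k * Xj s w) (Y t y s w))) + (Xi T w - k * Xj T w)).
  by apply/funext => w; rewrite RE.
apply: And5; [exact: X2|by rewrite RE'; exact: X1| |exact: gE|by rewrite RE'; exact: VE].
apply: filterS2 (XiE T TT) (XjE T TT) => w -> ->.
rewrite (ito_ext _ _ _ mE) (ito_ext _ _ _ sE) /relative_gain.
have -> : \int[mu]_(u in `[t, T]) (vol M * Y t y u w * policy_mean t y u w) =
  \int[mu]_(u in `[t, T]) (vol M * Y t y u w * mean (Pi u (Xi u w - k * Xj u w) (Y t y u w))).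
  by apply: eq_Rintegral => u; rewrite inE/= => uT; rewrite mE.
have ringE (a b c e z k' v : R) :
  z + a + v * c - k' * (0 + b + v * e) = z + (a - k' * b + (v * c - k' * (v * e))) by ring.
exact: ringE.
Qed.

Lemma Lfun1_rint (X : Omega -> R) : X \in Lfun P 1%:E -> P.-integrable setT (EFin \o X).
Proof. by move=> /Lfun1_integrable. Qed.

Lemma Lfun2_rint (X : Omega -> R) : X \in Lfun P 2%:E -> P.-integrable setT (EFin \o X).
Proof. 
by move=> X2; apply: Lfun1_rint; apply: Lfun_subset12 X2; rewrite fin_num_measure. Qed.

Lemma fine_expectation (X : Omega -> R) : fine 'E_P[X] = \int[P]_w X w.
Proof. by rewrite unlock. Qed.

Lemma fine_variance (X : Omega -> R) : fine 'V_P[X] = \int[P]_w (X w - \int[P]_w X w) ^+ 2.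
Proof.
rewrite /variance covariance.unlock !fine_expectation.
by apply: eq_Rintegral => w _; rewrite expr2.
Qed.

(** The processes started from wealth x and from 0 are obtained separately. Both terminal values are
    nevertheless, almost surely, the initial value plus the same [relative_gain], so they differ by
    x, which the variance does not see. *)
Lemma value_translation t x y : t \in `[0, T] -> V t x y = x + V t 0 y.
Proof.
move=> tT.
have [_ [X [X2 X1 XE _ ->]]] := value_decomposition x y tT.
have [_ [Z [Z2 Z1 ZE _ ->]]] := value_decomposition 0 y tT.
have XZ : {ae P, forall w, X w = x + Z w}.
  by apply: filterS2 XE ZE => w -> ->; rewrite add0r.
have iX := Lfun2_rint X2; have iZ := Lfun2_rint Z2.
have iRX := Lfun1_rint X1; have iRZ := Lfun1_rint Z1.
have ix : P.-integrable setT (EFin \o (cst x : Omega -> R)).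
  by apply: rint_cst => //; exact: probability_lty.
have EX : \int[P]_w X w = x + \int[P]_w Z w.
  rewrite -[x in RHS](Rintegral_cst_prob P) -RintegralDf//.
  apply: ae_eq_Rintegral => //.
  - exact: rint_measurable iX.
  - exact: rint_measurable (rintD measurableT ix iZ).
  - by apply: filterS XZ => w ->.
have ER : \int[P]_w (running_reward t y w + X w) = x + \int[P]_w (running_reward t y w + Z w).
  rewrite -[x in RHS](Rintegral_cst_prob P) -RintegralDf//.
  apply: ae_eq_Rintegral => //.
  - exact: rint_measurable iRX.
  - exact: rint_measurable (rintD measurableT ix iRZ).
  - by apply: filterS XZ => w -> _ /=; rewrite addrCA.
rewrite !fine_expectation !fine_variance EX ER addrA; congr (_ - _ * _).
apply: ae_eq_Rintegral => //.
- by apply: measurable_funX; apply: measurable_funB => //; exact: rint_measurable iX.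
- by apply: measurable_funX; apply: measurable_funB => //; exact: rint_measurable iZ.
- by apply: filterS XZ => w -> _; congr (_ ^+ 2); ring.
Qed.

End value_structure.

(** * Dependence of the expected wealth on the state *)

Section expectation_structure.
Context {R : realType} {d : measure_display} {Omega : measurableType d}.
Context (P : probability Omega R) (M : market R) (F : R -> set (set Omega)).
Context (B Bt : R -> Omega -> R) (A : agent (horizon M)) (Bi Bj : R -> Omega -> R).
Context (Y : R -> R -> R -> Omega -> R) (Pij : R -> R -> distr R).
Context (Pi : R -> R -> R -> distr R) (V g : R -> R -> R -> R).
Local Notation T := (horizon M).
Local Notation mu := (@lebesgue_measure R).
Local Notation k := (relw A).
Local Notation rv := (corr M * yvol M).
Local Notation iota := (speed M).
Context (hF : filtration_upto T F).
Context (hB : brownian_wrt P T F B) (hBt : brownian_wrt P T F Bt)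
  (hBi : brownian_wrt P T F Bi) (hBj : brownian_wrt P T F Bj).
Context (hY : forall t y : R, t \in `[0, T] -> state_process P M F B Bt t y (Y t y)).
Context (hVg : value_functions P F B A Bi Bj Y Pij Pi V g).
Context (a1 a2 th : R -> R).
Context (hPi : forall t x y p : R, t \in `[0, T] -> p \in `]0, 1[ ->
  quantile (Pi t x y) p = y / (gam A * vol M) + k * mean (Pij t y)
    - rv / vol M * (a2 t * y + a1 t) + th t * rderiv (reg A) (1 - p)).

Lemma policy_uquantile t x y s : t \in `[0, T] -> 0 < s < 1 ->
  uquantile (Pi t x y) s = y / (gam A * vol M) + k * mean (Pij t y)
    - rv / vol M * (a2 t * y + a1 t) + th t * rderiv (reg A) s.
Proof.
move=> tT s01; rewrite uquantileE// hPi//; last by rewrite in_itv/= subr_gt0 gtrBl andbC.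
by rewrite subKr.
Qed.

Lemma policy_uquantile_eq t x x' y : t \in `[0, T] ->
  uquantile (Pi t x y) = uquantile (Pi t x' y).
Proof.
move=> tT; apply/funext => s; have [s01|s01] := boolP (s \in `]0, 1[%classic).
  by move: s01; rewrite inE/= in_itv/= => s01; rewrite !policy_uquantile.
by rewrite /uquantile !patchE (negbTE s01).
Qed.

Lemma policy_meanE t x y : t \in `[0, T] ->
  mean (Pi t x y) = y / (gam A * vol M) + k * mean (Pij t y)
    - rv / vol M * (a2 t * y + a1 t).
Proof.
move=> tT; have hc := convex_chord_concave (reg_concave A).
have [] := uquantile_affine hc (@reg_cont _ _ A) (reg0 A) (reg1 A) (reg_L2 A)
  (m := Pi t x y) (theta := th t) (fun s => @policy_uquantile t x y s tT).
by [].
Qed.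

Context (t : R) (t0 : 0 <= t) (tT : t <= T).
Local Notation cont f := {within `[t, T], continuous f}.
Context (ca1 : cont a1) (ca2 : cont a2).
Context (b1 b2 db1 db2 : R -> R).
Context (cb1 : C1oo b1 db1 t T) (cb2 : C1oo b2 db2 t T).
Context (db2E : forall u, u \in `[t, T] ->
  db2 u = 2 * iota * b2 u + 2 * rv * a2 u - 2 / gam A).
Context (db1E : forall u, u \in `[t, T] ->
  db1 u = iota * b1 u + rv * a1 u - iota * ybar M * b2 u).
Context (b1T : b1 T = 0) (b2T : b2 T = 0).

Let t0T : t \in `[0, T]. Proof. by rewrite in_itv/= t0. Qed.

Let c1 u := - rv * a1 u.
Let c2 u := (gam A)^-1 - rv * a2 u.
Local Notation e := (fun u => expR (- iota * (u - t))).

Let cc1 : cont c1.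
Proof. by apply: contM => //; exact: cont_cst. Qed.

Let cc2 : cont c2.
Proof. by apply: contB; [exact: cont_cst|apply: contM => //; exact: cont_cst]. Qed.

Let J y w := \int[mu]_(u in `[t, T]) (c2 u * Y t y u w ^+ 2 + c1 u * Y t y u w).

Let I y w :=
  vol M * (ito P F B t T (policy_mean Y Pi t y) w + ito P F Bi t T (policy_sd Y Pi t y) w)
  - k * (vol M * (ito P F B t T (other_mean Y Pij t y) w + ito P F Bj t T (other_sd Y Pij t y) w)).

Let cY2 (y1 : R -> R) : cont y1 -> cont (fun u => y1 u ^+ 2).
Proof. by move=> cy u; apply: cvgM; exact: cy. Qed.

Let decomposition x y := value_decomposition hVg policy_uquantile_eq x y t0T.

Let zero_mean_I y : zero_mean P (I y).
Proof.
have [[i1 i2 i3 i4] _] := decomposition 0 y.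
have z1 := ito_zero_mean hF t0 (lexx T) hB (itoP i1).
have z2 := ito_zero_mean hF t0 (lexx T) hBi (itoP i2).
have z3 := ito_zero_mean hF t0 (lexx T) hB (itoP i3).
have z4 := ito_zero_mean hF t0 (lexx T) hBj (itoP i4).
have := zero_meanD (zero_meanZ (vol M) (zero_meanD z1 z2))
  (zero_meanZ (- k) (zero_meanZ (vol M) (zero_meanD z3 z4))).
by congr (zero_mean P); apply/funext => w; rewrite mulNr.
Qed.

(** The mean of the other agent cancels between the two drift integrals. Merging them needs its
    product with Y to be integrable along the path, which [ito_integrable_path] provides. *)
Let relative_gainE y : {ae P, forall w,
  relative_gain P F B A Bi Bj Y Pij Pi t y w = J y w + I y w}.
Proof.
have [[_ _ i3 _] _] := decomposition 0 y.
have [_ cY _] := hY y t0T.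
apply: filterS2 cY (ito_integrable_path hF t0 (lexx T) i3) => w cYw sm.
rewrite /relative_gain -/(I y w); congr (_ + _).
have mI : measurable (`[t, T]%classic : set (measurableTypeR R)) by [].
have sY : sqint mu `[t, T] (fun u => vol M * Y t y u w).
  apply: sqintZ => //; split; first exact: rint_measurable (cont_rint cYw).
  by apply: cont_rint; exact: cY2.
have iM := sqint_rintM mI sY sm.
have iJ : mu.-integrable `[t, T] (EFin \o (fun u => c2 u * Y t y u w ^+ 2 + c1 u * Y t y u w)).
  by apply: cont_rint; apply: contD; apply: contM => //; exact: cY2.
apply/eqP; rewrite subr_eq; apply/eqP.
rewrite -RintegralZl// -RintegralDf//; last exact: rintZ.
apply: eq_Rintegral => u; rewrite inE/= in_itv/= => /andP[tu uT].
rewrite /policy_mean policy_meanE; last by rewrite in_itv/= uT (le_trans t0).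
rewrite -/(other_mean Y Pij t y u w) /c1 /c2.
have g0 : gam A != 0 by rewrite gt_eqF// gam_gt0.
have s0 : vol M != 0 by rewrite gt_eqF// vol_gt0.
move: (Y t y u w) (other_mean Y Pij t y u w) => z m.
by field; rewrite g0 s0.
Qed.

(** Both states are driven by the same noises, which cancel in the difference; the latter solves a
    homogeneous linear integral equation. *)
Let state_shift y : {ae P, forall w, forall u, u \in `[t, T] ->
  Y t y u w = Y t 0 u w + y * e u}.
Proof.
have [_ cY eY] := hY y t0T; have [_ cZ eZ] := hY 0 t0T.
apply: filterS2 (filterI cY eY) (filterI cZ eZ) => w [cYw eYw] [cZw eZw].
have cD := contB cYw cZw.
have H s : s \in `[t, T] -> Y t y s w - Y t 0 s w =
    y - iota * \int[mu]_(u in `[t, s]) (Y t y u w - Y t 0 u w).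
  move=> sT; rewrite eYw// eZw//.
  have [ts sT'] : t <= s /\ s <= T by move: sT; rewrite in_itv/= => /andP.
  have sub : `[t, s]%classic `<=` (`[t, T]%classic : set R) by apply: subset_itvl; rewrite bnd_simp.
  have ciY : cont (fun u => iota * (ybar M - Y t y u w)).
    by apply: contM; [exact: cont_cst|apply: contB => //; exact: cont_cst].
  have iY : mu.-integrable `[t, s] (EFin \o (fun u => iota * (ybar M - Y t y u w))).
    exact: integrableS (cont_rint ciY).
  have ciZ : cont (fun u => iota * (ybar M - Y t 0 u w)).
    by apply: contM; [exact: cont_cst|apply: contB => //; exact: cont_cst].
  have iZ : mu.-integrable `[t, s] (EFin \o (fun u => iota * (ybar M - Y t 0 u w))).
    exact: integrableS (cont_rint ciZ).
  have iD : mu.-integrable `[t, s] (EFin \o (fun u => Y t y u w - Y t 0 u w)).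
    exact: integrableS (cont_rint cD).
  have E : \int[mu]_(u in `[t, s]) (iota * (ybar M - Y t y u w)) -
    \int[mu]_(u in `[t, s]) (iota * (ybar M - Y t 0 u w)) =
    - iota * \int[mu]_(u in `[t, s]) (Y t y u w - Y t 0 u w).
    rewrite -RintegralB// -RintegralZl//.
    by apply: eq_Rintegral => u _; ring.
  have ringE (a b c e z : R) : a - b = - iota * e -> z + a + c - (0 + b + c) = z - iota * e.
    by move=> abE; rewrite -mulNr -abE; ring.
  exact: ringE E.
move=> u uT; have := linear_path_unique tT (speed_gt0 M) cD H uT.
by move=> /eqP; rewrite subr_eq addrC => /eqP.
Qed.

(** Expanding the square in J along the shifted path leaves a linear and a quadratic term in y,
    whose coefficients are [integral_c1_mean] and [integral_c2]. The centred remainder Q comes from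
    the path started at 0, so one Q serves all y. *)
Let J_shift : exists2 Q, zero_mean P Q & forall y, {ae P, forall w,
  J y w = J 0 w + (b1 t * y + b2 t / 2 * y ^+ 2) + y * Q w}.
Proof.
have db2E' u : u \in `[t, T] -> db2 u = 2 * iota * b2 u - 2 * c2 u.
  by move=> uT; rewrite db2E// /c2; ring.
have db1E' u : u \in `[t, T] -> db1 u = iota * b1 u - c1 u - iota * ybar M * b2 u.
  by move=> uT; rewrite db1E// /c1; ring.
have [Q zQ QE] := integral_c1_mean hF hB hBt (hY 0 t0T) t0 tT cb1 cb2 cc1 cc2
  db2E' db1E' b1T b2T.
have q2 := integral_c2 tT cb2 cc2 db2E' b2T.
exists Q => // y; have [_ cZ _] := hY 0 t0T.
apply: filterS3 cZ QE (state_shift y) => w cZw QEw shift.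
have ce : cont e := (C1oo_decay t T iota).2.
have cJ : cont (fun u => c2 u * Y t 0 u w ^+ 2 + c1 u * Y t 0 u w).
  by apply: contD; apply: contM => //; exact: cY2.
have cK : cont (fun u => e u * (2 * c2 u * Y t 0 u w + c1 u)).
  apply: contM => //; apply: contD => //; apply: contM => //; apply: contM => //.
  exact: cont_cst.
have cL : cont (fun u => c2 u * e u ^+ 2) by apply: contM => //; exact: cY2.
have cK' : cont (fun u => y * (e u * (2 * c2 u * Y t 0 u w + c1 u))).
  by apply: contM => //; exact: cont_cst.
have cL' : cont (fun u => y ^+ 2 * (c2 u * e u ^+ 2)).
  by apply: contM => //; exact: cont_cst.
have -> : J y w = J 0 w + y * \int[mu]_(u in `[t, T]) (e u * (2 * c2 u * Y t 0 u w + c1 u))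
    + y ^+ 2 * \int[mu]_(u in `[t, T]) (c2 u * e u ^+ 2).
  rewrite -!RintegralZl//; try exact: cont_rint.
  rewrite -!RintegralDf//; try exact: cont_rint; last by apply: cont_rint; exact: contD.
  by apply: eq_Rintegral => u; rewrite inE/= => uT; rewrite shift//; ring.
by rewrite q2 QEw; ring.
Qed.

(** The term free of x and y is [g t 0 0]. [J 0] is never integrated by itself: it cancels pathwise
    between the terminal wealths X and Z, both known to be integrable. *)
Lemma expectation_quadratic : exists d0, forall x y,
  g t x y = x + (d0 + b1 t * y + b2 t / 2 * y ^+ 2).
Proof.
have [Q zQ QE] := J_shift; exists (g t 0 0) => x y.
have [_ [X [X2 _ XE -> _]]] := decomposition x y.
have [_ [Z [Z2 _ ZE -> _]]] := decomposition 0 0.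
rewrite !fine_expectation.
have iX := Lfun2_rint X2; have iZ := Lfun2_rint Z2.
have zN := zero_meanD (zero_meanD (zero_mean_I y) (zero_meanZ (-1) (zero_mean_I 0)))
  (zero_meanZ y zQ).
set N := (fun w => _) in zN.
set c := x + b1 t * y + b2 t / 2 * y ^+ 2.
have ic : P.-integrable setT (EFin \o (cst c : Omega -> R)).
  by apply: rint_cst => //; exact: probability_lty.
have icZ := rintD measurableT ic iZ.
have -> : \int[P]_w X w = \int[P]_w ((c + Z w) + N w).
  apply: ae_eq_Rintegral => //.
  - exact: rint_measurable iX.
  - exact: rint_measurable (rintD measurableT icZ zN.1).
  apply: filterS3 (filterI XE ZE) (filterI (relative_gainE y) (relative_gainE 0)) (QE y).
  move=> w [-> ->] [-> ->] -> _; rewrite /c /N; move: (J 0 w) (I y w) (I 0 w) (Q w) => *; ring.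
rewrite RintegralDf//; last exact: zN.1.
rewrite RintegralDf// Rintegral_cst_prob zN.2 /c.
by move: (\int[P]_w Z w) => z; ring.
Qed.

End expectation_structure.

Theorem theorem3 (R : realType) (d : measure_display)
  (Omega : measurableType d) (P : probability Omega R)
  (M : market R) (ag : 'I_2 -> agent (horizon M))
  (F : R -> set (set Omega)) (B Bt : R -> Omega -> R)
  (Bbar : 'I_2 -> R -> Omega -> R)
  (Y : R -> R -> R -> Omega -> R)
  (i j : 'I_2)
  (Pij : R -> R -> distr R)
  (a10 a20 : R -> R) (theta0 : R)
  (Pi : nat -> R -> R -> R -> distr R)
  (V g : nat -> R -> R -> R -> R)
  (hF : filtration_upto (horizon M) F)
  (hB : independent_brownian P (horizon M) F (noises B Bt Bbar))
  (hY : forall (t y : R), t \in `[0, horizon M] ->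
          state_process P M F B Bt t y (Y t y))
  (hij : i != j)
  (hPij : forall (t y : R), t \in `[0, horizon M] ->
            finite_second_moment (Pij t y))
  (ha10 : {within `[0, horizon M], continuous a10})
  (ha20 : {within `[0, horizon M], continuous a20})
  (htheta0 : 0 <= theta0)
  (hPi0 : forall (t x y p : R), t \in `[0, horizon M] -> p \in `]0, 1[ ->
     quantile (Pi 0%N t x y) p =
       y / (gam (ag i) * vol M) + relw (ag i) * mean (Pij t y)
       - corr M * yvol M / vol M * (a20 t * y + a10 t)
       + theta0 * rderiv (reg (ag i)) (1 - p))
  (hVg : forall n, value_functions P F B (ag i) (Bbar i) (Bbar j)
                     Y Pij (Pi n) (V n) (g n))
  (hupdate : forall n (t x y : R), t \in `[0, horizon M] ->
     is_argmax (update_objective (ag i) (Pij t y) (V n) (g n) t x y)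
               (Pi n.+1 t x y)) :
  exists a1 a2 : nat -> R -> R,
    [/\ forall t : R, t \in `[0, horizon M] -> a1 0%N t = a10 t /\ a2 0%N t = a20 t,
        forall n (t : R), t \in `[0, horizon M] ->
          is_tderiv (horizon M) (a2 n.+1) t
            (2 * speed M * a2 n.+1 t + 2 * corr M * yvol M * a2 n t
             - 2 / gam (ag i)) /\
          is_tderiv (horizon M) (a1 n.+1) t
            (speed M * a1 n.+1 t + corr M * yvol M * a1 n t
             - speed M * ybar M * a2 n.+1 t),
        forall n, a2 n.+1 (horizon M) = 0 /\ a1 n.+1 (horizon M) = 0,
        forall n (t x y p : R), t \in `[0, horizon M] -> p \in `]0, 1[ ->
          quantile (Pi n.+1 t x y) p =
            y / (gam (ag i) * vol M) + relw (ag i) * mean (Pij t y)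
            - corr M * yvol M / vol M * (a2 n.+1 t * y + a1 n.+1 t)
            + lam (ag i) t / (gam (ag i) * vol M ^+ 2)
              * rderiv (reg (ag i)) (1 - p) &
        let kappa := speed M + corr M * yvol M in
        {uniform `[0, horizon M], a1 @ \oo -->
           (fun t => speed M * ybar M / (gam (ag i) * kappa ^+ 2)
                     * (1 - expR (- kappa * (horizon M - t))) ^+ 2)} /\
        {uniform `[0, horizon M], a2 @ \oo -->
           (fun t => (gam (ag i) * kappa)^-1
                     * (1 - expR (- 2 * kappa * (horizon M - t))))}].
Proof.
set A := ag i; set T := horizon M in hF hB hY hPij ha10 ha20 hPi0 hupdate *.
have T0 : 0 < T := horizon_gt0 M.
have iota0 := speed_gt0 M; have g0 := gam_gt0 A; have yb0 := ybar_gt0 M.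
set rv := corr M * yvol M.
have rv0 : 0 <= rv.
  by rewrite mulr_ge0 ?(ltW (yvol_gt0 M))//; have /andP[] := corr_itv M.
pose a2 := a2seq T (speed M) rv (gam A) a20.
pose a1 := a1seq T (speed M) rv (gam A) (ybar M) a10 a20.
have a2d n t : t \in `[0, T] -> is_tderiv T (a2 n.+1) t
    (2 * speed M * a2 n.+1 t + 2 * rv * a2 n t - 2 / gam A).
  by move=> tT; rewrite -addrA; exact: a2seq_tderiv.
have a1d n t : t \in `[0, T] -> is_tderiv T (a1 n.+1) t
    (speed M * a1 n.+1 t + rv * a1 n t - speed M * ybar M * a2 n.+1 t).
  by move=> tT; rewrite -addrA; exact: a1seq_tderiv.
have hBk := independent_brownian_wrt.
have bB := hBk _ _ _ _ _ _ _ _ None hB.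
have bBt := hBk _ _ _ _ _ _ _ _ (Some None) hB.
have bBbar l := hBk _ _ _ _ _ _ _ _ (Some (Some l)) hB.
have a_init t : t \in `[0, T] -> a1 0%N t = a10 t /\ a2 0%N t = a20 t.
  by move=> tT; rewrite /a1 /a2/= (clamp_id tT).
(* The coefficient of h' is an arbitrary function [th]: it does not affect the mean, and it changes
   from theta0 to lambda / (gamma sigma^2) at the first update. *)
have step n th : (forall t x y p : R, t \in `[0, T] -> p \in `]0, 1[ ->
     quantile (Pi n t x y) p =
       y / (gam A * vol M) + relw A * mean (Pij t y)
       - rv / vol M * (a2 n t * y + a1 n t) + th t * rderiv (reg A) (1 - p)) ->
   forall t x y p : R, t \in `[0, T] -> p \in `]0, 1[ ->
     quantile (Pi n.+1 t x y) p =
       y / (gam A * vol M) + relw A * mean (Pij t y)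
       - rv / vol M * (a2 n.+1 t * y + a1 n.+1 t)
       + lam A t / (gam A * vol M ^+ 2) * rderiv (reg A) (1 - p).
  move=> hPin t x y p tT; have [t0 tT'] : 0 <= t /\ t <= T.
    by move: tT; rewrite in_itv/= => /andP.
  have c1 : {within `[t, T], continuous a1 n}.
    by apply: continuous_subspaceT; exact: a1seq_continuous.
  have c2 : {within `[t, T], continuous a2 n}.
    by apply: continuous_subspaceT; exact: a2seq_continuous.
  have C1 := C1ooW t0 (lexx T) (is_tderiv_C1oo T0 (a1d n)).
  have C2 := C1ooW t0 (lexx T) (is_tderiv_C1oo T0 (a2d n)).
  have [d0 gE] : exists d0, forall x' y', g n t x' y' =
      x' + (d0 + a1 n.+1 t * y' + a2 n.+1 t / 2 * y' ^+ 2).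
    apply: (expectation_quadratic hF bB bBt (bBbar i) (bBbar j) hY (hVg n) hPin
      t0 tT' c1 c2 C1 C2) => //; [exact: a1seqT|exact: a2seqT].
  have VE x' y' := value_translation (hVg n) (policy_uquantile_eq hPin) x' y' tT.
  exact: (update_quantile tT VE gE (hupdate n t x y tT)).
(* Existence of some coefficient is the invariant that covers stage 0 and the later stages
   together. *)
have form n : exists th, forall t x y p : R, t \in `[0, T] -> p \in `]0, 1[ ->
     quantile (Pi n t x y) p =
       y / (gam A * vol M) + relw A * mean (Pij t y)
       - rv / vol M * (a2 n t * y + a1 n t) + th t * rderiv (reg A) (1 - p).
  elim: n => [|n [th IHn]]; last by exists (fun t => lam A t / (gam A * vol M ^+ 2)); exact: step IHn.
  by exists (fun=> theta0) => t x y p tT p01; rewrite hPi0//; have [-> ->] := a_init t tT.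
exists a1, a2; split.
- exact: a_init.
- move=> n t tT; split; last exact: a1d.
  by rewrite -(mulrA 2 (corr M)); exact: a2d.
- by move=> n; split; [exact: a2seqT|exact: a1seqT].
- by move=> n t x y p tT p01; have [th /step] := form n; apply.
- exact: seq_uniform_cvg.
Qed.
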